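(* Let $n \ge 2$, $q>1$, $1<p<\frac{2n}{n-1}$, and assume $$\Big(\frac{n-1}{2}p-1\Big)(pq-1) < p+2 .$$ Let $f,g,\tilde f,\tilde g$ be non-negative functions on $\mathbb{R}^n$. Assume $f+g$ does not vanish identically and $\tilde g$ does not vanish identically. Let $0<\varepsilon\le 1$. Suppose that, for some $T\in(0,\infty]$, the Cauchy problem $$\square u=|v|^q,\qquad \square v=|\partial_t u|^p,$$ $$(u,\partial_tu,v,\partial_tv)(0,x)=(\varepsilon f,\varepsilon g,\varepsilon\tilde f,\varepsilon\tilde g)(x)$$ has a solution $(u,v)$ on $[0,T)$ in the weak sense described in the context. Suppose moreover that this solution is localized inside the cone: $$\operatorname{supp}(u,v,\partial_tu,\partial_tv)\subset\{(t,x)\in[0,T)\times\mathbb{R}^n : |x|\le t+1\}.$$ Then there is a constant $C_1>0$, depending only on $n,p,q,f,g,\tilde f,\tilde g$ (and not on $\varepsilon$), such that $$T\le C_1\,\varepsilon^{-\frac{p(pq-1)}{p+2-\left(\frac{n-1}{2}p-1\right)(pq-1)}}.$$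
   Context: Here $\square=\partial_t^2-\Delta$ on $[0,T)\times\mathbb{R}^n$, and $\langle \phi,\psi\rangle=\int_{\mathbb{R}^n}\phi\psi\,dx$. A pair $(u,v)$ is a (weak) solution on $[0,T)$ of $\square u=|v|^q$, $\square v=|\partial_t u|^p$ if both of the following hold. (i) For every $\psi\in C_0^\infty((0,T)\times\mathbb{R}^n)$, $$\int_0^T\langle |v(s)|^q,\psi(s)\rangle ds=\int_0^T\langle u(s),(\partial_s^2\psi-\Delta\psi)(s)\rangle ds,$$ $$\int_0^T\langle |\partial_s u(s)|^p,\psi(s)\rangle ds=\int_0^T\langle v(s),(\partial_s^2\psi-\Delta\psi)(s)\rangle ds.$$ (ii) The regularity conditions $$u,v,\partial_tu,\partial_tv\in C([0,T);L^1(\mathbb{R}^n)),\qquad v\in C((0,T);L^q(\mathbb{R}^n)),\qquad \partial_tu\in C((0,T);L^p(\mathbb{R}^n))$$ hold. The initial conditions are understood in the sense of the $C([0,T);L^1)$ continuity in (ii). *)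

(* Defs.v *)
From HB Require Import structures.
From mathcomp Require Import all_boot all_order all_algebra.
From mathcomp Require Import all_classical all_reals all_analysis.

Set Implicit Arguments.
Unset Strict Implicit.
Unset Printing Implicit Defensive.

Import Order.TTheory GRing.Theory Num.Theory.
Import numFieldNormedType.Exports.

Local Open Scope classical_set_scope.
Local Open Scope ring_scope.

Section Defs.
Variables (R : realType) (n : nat).

(* Euclidean norm on R^n = 'rV[R]_n (the library norm on 'rV is the max norm) *)
Definition enorm (x : 'rV[R]_n) : R := Num.sqrt (\sum_(i < n) x ord0 i ^+ 2).

Definition Rn_measurable (phi : 'rV[R]_n -> R) : Prop :=
  forall B : set R, open B ->
    <<s [set U : set 'rV[R]_n | open U] >> (phi @^-1` B).

Definition set_coord (x : 'rV[R]_n) (k : nat) (s : R) : 'rV[R]_n :=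
  \row_(j < n) (if (j : nat) == k then s else x ord0 j).

(* Lebesgue integral over R^n, defined as the iterated one-dimensional
   Lebesgue integral (Tonelli/Fubini), non-negative (extended) version *)
Fixpoint iint_aux (k : nat) (F : 'rV[R]_n -> \bar R) (x : 'rV[R]_n) : \bar R :=
  match k with
  | 0 => F x
  | k'.+1 => (\int[@lebesgue_measure R]_s iint_aux k' F (set_coord x k' s))%E
  end.
Definition iint (F : 'rV[R]_n -> \bar R) : \bar R := iint_aux n F 0.

Fixpoint iintR_aux (k : nat) (F : 'rV[R]_n -> R) (x : 'rV[R]_n) : R :=
  match k with
  | 0 => F x
  | k'.+1 => Rintegral (@lebesgue_measure R) setT
               (fun s => iintR_aux k' F (set_coord x k' s))
  end.
Definition iintR (F : 'rV[R]_n -> R) : R := iintR_aux n F 0.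

Definition pairing (phi psi : 'rV[R]_n -> R) : R := iintR (fun x => phi x * psi x).

Definition inL (r : R) (phi : 'rV[R]_n -> R) : Prop :=
  Rn_measurable phi /\ (iint (fun x => (`|phi x| `^ r)%:E) < +oo)%E.

Definition contL (r : R) (I : set R) (phi : R -> 'rV[R]_n -> R) : Prop :=
  (forall t, I t -> inL r (phi t)) /\
  (forall t, I t -> forall e : R, 0 < e -> exists2 d : R, 0 < d &
     forall s, I s -> `|s - t| < d ->
       (iint (fun x => (`|phi s x - phi t x| `^ r)%:E) < e%:E)%E).

Definition Ico0 (T : \bar R) : set R := [set s | 0 <= s /\ (s%:E < T)%E].
Definition Ioo0 (T : \bar R) : set R := [set s | 0 < s /\ (s%:E < T)%E].

Fixpoint iterD (V W : normedModType R) (vs : seq V) (f : V -> W) : V -> W :=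
  match vs with
  | [::] => f
  | v :: vs' => 'D_v (iterD vs' f)
  end.
Definition smooth (V W : normedModType R) (f : V -> W) : Prop :=
  forall (vs : seq V) (z : V), differentiable (iterD vs f) z.

Definition uncurry (psi : R -> 'rV[R]_n -> R) : R * 'rV[R]_n -> R :=
  fun z => psi z.1 z.2.

Definition test_fun (T : \bar R) (psi : R -> 'rV[R]_n -> R) : Prop :=
  smooth (uncurry psi) /\
  exists a b rho : R, [/\ 0 < a, a <= b, (b%:E < T)%E &
    forall t x, psi t x != 0 -> [/\ a <= t, t <= b & enorm x <= rho]].

Definition e_t : R * 'rV[R]_n := (1, 0).
Definition e_x (i : 'I_n) : R * 'rV[R]_n := (0, delta_mx 0 i).

Definition dt (psi : R -> 'rV[R]_n -> R) (t : R) (x : 'rV[R]_n) : R :=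
  'D_e_t (uncurry psi) (t, x).

Definition box (psi : R -> 'rV[R]_n -> R) (t : R) (x : 'rV[R]_n) : R :=
  'D_e_t ('D_e_t (uncurry psi)) (t, x)
  - \sum_(i < n) 'D_(e_x i) ('D_(e_x i) (uncurry psi)) (t, x).

Definition tint (T : \bar R) (F : R -> R) : R :=
  Rintegral (@lebesgue_measure R) (Ioo0 T) F.

Definition is_dt (T : \bar R) (u w : R -> 'rV[R]_n -> R) : Prop :=
  forall psi, test_fun T psi ->
    tint T (fun s => pairing (u s) (dt psi s)) = - tint T (fun s => pairing (w s) (psi s)).

Definition weak_solution (p q : R) (T : \bar R)
    (u ut v vt : R -> 'rV[R]_n -> R) : Prop :=
  [/\ is_dt T u ut, is_dt T v vt,
      (forall psi, test_fun T psi ->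
         tint T (fun s => pairing (fun x => `|v s x| `^ q) (psi s))
         = tint T (fun s => pairing (u s) (box psi s))),
      (forall psi, test_fun T psi ->
         tint T (fun s => pairing (fun x => `|ut s x| `^ p) (psi s))
         = tint T (fun s => pairing (v s) (box psi s))) &
      [/\ contL 1 (Ico0 T) u, contL 1 (Ico0 T) v, contL 1 (Ico0 T) ut,
          contL 1 (Ico0 T) vt & contL q (Ioo0 T) v /\ contL p (Ioo0 T) ut]].

Definition L1_eq (phi psi : 'rV[R]_n -> R) : Prop :=
  iint (fun x => (`|phi x - psi x|)%:E) = 0%E.

Definition in_cone (T : \bar R) (w : R -> 'rV[R]_n -> R) : Prop :=
  forall t, Ico0 T t ->
    iint (fun x => (if t + 1 < enorm x then `|w t x| else 0)%:E) = 0%E.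

End Defs.

(* Main.v *)
Require Import Defs.
From HB Require Import structures.
From mathcomp Require Import all_boot all_order all_algebra.
From mathcomp Require Import all_classical all_reals all_analysis measurable_realfun.
From mathcomp Require Import ring lra.
Import Order.TTheory GRing.Theory Num.Theory.
Import numFieldNormedType.Exports.
Local Open Scope classical_set_scope.
Local Open Scope ring_scope.

(** Inside the cone the functions [e^{x.w}] may be cut off to admissible spatial
  test functions without being changed. The moments [A = int u e^{x.w}] and
  [B = int u_t e^{x.w}] then satisfy [A' = B] and [B' = int |v|^q e^{x.w} + |w|^2 A];
  similarly for [v].

  For [|w| = 1] this forces [B(t) >= c eps e^t]. The weight [e^{x.w - (t+1)}] on the
  ball of radius [t + 1] concentrates on a cap around [(t+1) w] of volume about
  [t^{(n-1)/2}], and about [t^{(n-1)/2}] directions have essentially disjoint caps.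
  Jensen's inequality on each cap, summed over the caps, gives
  [int |u_t|^p >= c eps^p t^{(n-1)(1-p/2)}].

  For [w = 0] the moments [F], [G], [H] of [v], [u_t], [v_t] satisfy [F' = H],
  [G' >= c t^{-n(q-1)} F^q] and [H' >= c t^{-n(p-1)} G^p]. The previous bound gives
  [F >= c eps^p t^{n+1-(n-1)p/2}] at time [3 t], and iterating the integral
  inequalities over intervals of geometrically decreasing length in [[3 t, 4 t]] makes
  [F(4 t)] infinite unless [eps^{p(pq-1)} t^gamma] is bounded, where
  [gamma = p + 2 - ((n-1)p/2 - 1)(pq-1)]. *)

(** * Lebesgue measure on row vectors *)

(** The weak formulation only admits tests compactly supported in the open interval [(0, T)], so it
    does not see time 0. The moments are therefore handled as continuous functions with continuous
    distributional derivatives, hence as C^1 functions of [0 < t < T], and the initial data enter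
    through L^1 continuity up to 0. Every test is a product of one-variable functions: [e^{x.w}]
    factorises, and cutting off each factor separately reduces smoothness in all variables to
    smoothness on the line.

    The growth [c eps e^t] matches the maximum [e^{t+1}] of the weight on the ball, so after
    normalisation the weighted integral of [|u_t|] is at least [c eps] in every direction, at every
    time. Jensen then costs the cap volume to the power [1 - p], and the number of caps multiplies
    by that volume once more: this is the exponent [(n-1)(2-p)/2].

    The exponent [gamma] counts powers of [t]: [n(1 - pq)] from the two Jensen factors over the
    ball, [p + 2] from the three time integrations of one round (the first is raised to the power
    [p]), and [pq - 1] times the exponent [(n-1)(1-p/2) + 2] of the starting value of [F]. *)

(* An alias carrying the Borel sigma-algebra, for which [Rn_measurable] is [measurable_fun]. *)
Definition borel_rV (R : realType) (n : nat) := 'rV[R]_n.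
Definition borel_rV_display : measure_display. Proof. exact: default_measure_display. Qed.

Section BorelRV.
Variables (R : realType) (n : nat).
HB.instance Definition _ := Pointed.on (borel_rV R n).
HB.instance Definition _ := @isMeasurable.Build borel_rV_display (borel_rV R n)
  <<s [set U : set 'rV[R]_n | open U] >> (@sigma_algebra0 _ setT _) (@sigma_algebraC _ _)
  (@sigma_algebra_bigcup _ setT _).
End BorelRV.

Section IteratedMeasure.
Variables (R : realType) (n : nat).
Local Notation E := (borel_rV R n).
Local Notation RT := (measurableTypeR R).

Lemma measurable_coord (j : 'I_n) : measurable_fun setT (fun x : E => x ord0 j : R).
Proof.
apply: (@measurability _ _ E (measurableTypeR R) setT _ _ (RGenOpens.measurableE R)) => _ [_ [a [b ->]] <-].
rewrite setTI; apply: sub_sigma_algebra => /=.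
have -> : (fun x : E => x ord0 j) @^-1` `]a, b[%classic =
          (fun x : 'rV[R]_n => x ord0 j) @^-1` `]a, b[%classic by [].
by apply: open_comp => // x _; exact: coord_continuous.
Qed.

(** An open set is the union of the rational cubes that it contains, a countable family, so
    measurability of the coordinates suffices. *)
Lemma measurable_rV d (T : measurableType d) (h : T -> E) :
  (forall j, measurable_fun setT (fun t => h t ord0 j : R)) -> measurable_fun setT h.
Proof.
move=> mh; apply: (@measurability _ _ T E setT h [set U : set 'rV[R]_n | open U]) => // _ [U oU <-].
pose box (c : 'rV[rat]_n * nat) : set 'rV[R]_n :=
  [set x | forall j, `|x ord0 j - ratr (c.1 ord0 j)| < c.2.+1%:R^-1].
have -> : setT `&` h @^-1` U =
   \bigcup_(c in [set c | box c `<=` U]) h @^-1` (box c).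
  rewrite setTI; apply/seteqP; split => t /=; last by case=> c /= cU; exact: cU.
  move=> Ut; have /nbhs_ballP[e /= e0 eU] : nbhs (h t : 'rV[R]_n) U.
    by apply: open_nbhs_nbhs; split.
  (* A rational centre within [1/(m+1)] of [h t] keeps the whole cube within [2/(m+1)] of [h t]. *)
  have [m me] : exists m : nat, m.+1%:R^-1 + m.+1%:R^-1 < e.
    have /= e20 : 0 < e / 2 by rewrite divr_gt0.
    exists (Num.truncn (e / 2)^-1); rewrite [ltRHS]splitr.
    by apply: ltrD; rewrite invf_plt ?posrE// truncnS_gt.
  have /choice[c hc] (j : 'I_n) : exists c : rat, `|h t ord0 j - ratr c| < m.+1%:R^-1.
    have /rat_in_itvoo[c] : h t ord0 j - m.+1%:R^-1 < h t ord0 j + m.+1%:R^-1.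
      by rewrite ltrBlDr -addrA ltrDl addr_gt0// invr_gt0 ltr0n.
    by rewrite in_itv /= => hc; exists c; rewrite distrC ltr_distl.
  exists (\row_j c j, m) => /=; last by move=> j; rewrite mxE.
  move=> x /= hx; apply: eU; split => // i j; rewrite ord1.
  have := hx j; rewrite mxE /ball /= => hxj.
  rewrite -[h t ord0 j - x _ _](subrKA (ratr (c j))) (le_lt_trans (ler_normD _ _))//.
  by apply: lt_trans me; apply: ltrD => //; rewrite distrC.
rewrite bigcup_mkcond; apply: countable_bigcupT_measurable => //= c.
case: ifPn => // _.
have -> : h @^-1` box c = \bigcap_(j in [set: 'I_n])
    [set t | `|h t ord0 j - ratr (c.1 ord0 j)| < c.2.+1%:R^-1].
  by apply/seteqP; split => t /= ht j => [_|]; exact: ht.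
apply: fin_bigcap_measurable => // j _.
rewrite -[X in measurable X]setTI.
apply: (@measurable_fun_ltr _ _ _ _ (fun t => `|h t ord0 j - ratr (c.1 ord0 j)|) (cst _)) => //.
by apply: measurableT_comp => //; exact: measurable_funB.
Qed.

Lemma measurable_set_coord k :
  measurable_fun setT (fun z : E * RT => set_coord z.1 k z.2 : E).
Proof.
apply: measurable_rV => j; rewrite /set_coord.
under eq_fun do rewrite mxE.
case: eqP => _; first exact: measurable_snd.
exact: (measurableT_comp (measurable_coord j) measurable_fst).
Qed.

Lemma measurable_set_coordr k (x : E) :
  measurable_fun setT (fun s : RT => set_coord x k s : E).
Proof. exact: (measurableT_comp (measurable_set_coord k) (measurable_pair1 x)). Qed.

Local Open Scope ereal_scope.

Lemma iint_aux_ge0 k (F : 'rV[R]_n -> \bar R) x : (forall x, 0 <= F x) -> 0 <= iint_aux k F x.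
Proof. by move=> F0; elim: k x => //= k ih x; apply: integral_ge0. Qed.

Lemma measurable_iint_aux k (F : E -> \bar R) :
  (forall x, 0 <= F x) -> measurable_fun setT F ->
  measurable_fun setT (iint_aux k F : E -> \bar R).
Proof.
move=> F0 mF; elim: k => //= k ih.
apply: (@measurable_fun_fubini_tonelli_F _ _ E RT R lebesgue_measure
  (fun z => iint_aux k F (set_coord z.1 k z.2))).
  exact: measurableT_comp ih (measurable_set_coord k).
by move=> z; exact: iint_aux_ge0.
Qed.

Lemma measurable_iint_aux_slice k j (F : E -> \bar R) x :
  (forall x, 0 <= F x) -> measurable_fun setT F ->
  measurable_fun setT (fun s : RT => iint_aux k F (set_coord x j s)).
Proof.
by move=> F0 mF; apply: measurableT_comp (measurable_set_coordr _ _); exact: measurable_iint_aux.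
Qed.

Lemma le_iint_aux k (F G : E -> \bar R) x :
  (forall x, 0 <= F x) -> measurable_fun setT F -> measurable_fun setT G ->
  (forall x, F x <= G x) -> iint_aux k F x <= iint_aux k G x.
Proof.
move=> F0 mF mG FG; have G0 y : 0 <= G y by exact: le_trans (F0 y) (FG y).
elim: k x => //= k ih x; apply: ge0_le_integral => //.
- by move=> s _; exact: iint_aux_ge0.
- exact: measurable_iint_aux_slice.
- exact: measurable_iint_aux_slice.
Qed.

Lemma iint_aux_nneseries k (F : nat -> E -> \bar R) x :
  (forall i x, 0 <= F i x) -> (forall i, measurable_fun setT (F i)) ->
  iint_aux k (fun y => \sum_(i <oo) F i y) x = \sum_(i <oo) iint_aux k (F i) x.
Proof.
move=> F0 mF; elim: k x => //= k ih x.
under eq_integral do rewrite ih.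
rewrite integral_nneseries// => i; first exact: measurable_iint_aux_slice.
by move=> s _; exact: iint_aux_ge0.
Qed.

Lemma iint_aux_lim k (F : nat -> E -> \bar R) x :
  (forall i x, 0 <= F i x) -> (forall i, measurable_fun setT (F i)) ->
  (forall y, nondecreasing_seq (F ^~ y)) ->
  iint_aux k (fun y => limn (F ^~ y)) x = limn (fun i => iint_aux k (F i) x).
Proof.
move=> F0 mF ndF; elim: k x => //= k ih x.
under eq_integral do rewrite ih.
rewrite monotone_convergence//.
- by move=> i; exact: measurable_iint_aux_slice.
- by move=> i s _; exact: iint_aux_ge0.
- by move=> s _ a b ab; apply: le_iint_aux => // y; exact: ndF.
Qed.

Lemma iint_aux_sum k I (r : seq I) (F : I -> E -> \bar R) x :
  (forall i x, 0 <= F i x) -> (forall i, measurable_fun setT (F i)) ->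
  iint_aux k (fun y => \sum_(i <- r) F i y) x = \sum_(i <- r) iint_aux k (F i) x.
Proof.
move=> F0 mF; elim: k x => //= k ih x.
under eq_integral do rewrite ih.
rewrite ge0_integral_sum// => i; first exact: measurable_iint_aux_slice.
by move=> s _; exact: iint_aux_ge0.
Qed.

Lemma iint_auxD k (F G : E -> \bar R) x :
  (forall x, 0 <= F x) -> (forall x, 0 <= G x) ->
  measurable_fun setT F -> measurable_fun setT G ->
  iint_aux k (F \+ G) x = iint_aux k F x + iint_aux k G x.
Proof.
move=> F0 G0 mF mG; elim: k x => //= k ih x.
under eq_integral do rewrite ih.
by rewrite ge0_integralD//; [move=> s _; exact: iint_aux_ge0|exact: measurable_iint_aux_slice|
  move=> s _; exact: iint_aux_ge0|exact: measurable_iint_aux_slice].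
Qed.

Lemma iint_auxZl k (F : E -> \bar R) (c : R) x : (0 <= c)%R ->
  (forall x, 0 <= F x) -> measurable_fun setT F ->
  iint_aux k (fun y => c%:E * F y) x = c%:E * iint_aux k F x.
Proof.
move=> c0 F0 mF; elim: k x => //= k ih x.
under eq_integral do rewrite ih.
rewrite ge0_integralZl_EFin//; last exact: measurable_iint_aux_slice.
by move=> s _; exact: iint_aux_ge0.
Qed.

(** Lebesgue measure in the first [k] coordinates, the others frozen at those of [x]. Defining it by
    the iterated integral of the indicator makes it agree with [iint_aux] on indicators by
    construction. *)
Definition iter_measure k (x : E) (A : set E) : \bar R := iint_aux k (fun y : E => \d_y A) x.

Lemma measurable_dirac_set (A : set E) : measurable A -> measurable_fun setT (fun y : E => \d_y A : \bar R).
Proof. by move=> mA; apply/measurable_EFinP; exact: measurable_indic. Qed.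

Section iter_measure_instance.
Variables (k : nat) (x : E).

Let iter_measure0 : iter_measure k x set0 = 0.
Proof.
rewrite /iter_measure; elim: k x => /= [y|j ih y]; first by rewrite measure0.
by under eq_integral do rewrite ih; rewrite integral0.
Qed.

Let iter_measure_ge0 A : 0 <= iter_measure k x A.
Proof. exact: iint_aux_ge0. Qed.

Let iter_measure_sigma_additive : semi_sigma_additive (iter_measure k x).
Proof.
move=> F mF tF mUF; rewrite /iter_measure.
have -> : (fun y => \d_y (\bigcup_i F i) : \bar R) = (fun y => \sum_(i <oo) \d_y (F i)).
  by apply/funext => y; rewrite measure_bigcup//; apply: eq_eseriesl => i; rewrite in_setT.
rewrite iint_aux_nneseries//; last by move=> i; exact: measurable_dirac_set.
by apply: is_cvg_nneseries => i _ _; exact: iter_measure_ge0.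
Qed.

HB.instance Definition _ := isMeasure.Build _ _ _ (iter_measure k x)
  iter_measure0 iter_measure_ge0 iter_measure_sigma_additive.
End iter_measure_instance.

Import HBNNSimple.
(** Both sides agree on indicators and respect finite nonnegative combinations and monotone limits,
    hence agree on all limits of simple functions. *)
Lemma integral_iter_measure k x (F : E -> \bar R) :
  (forall x, 0 <= F x) -> measurable_fun setT F ->
  \int[iter_measure k x]_y F y = iint_aux k F x.
Proof.
move=> F0 mF; pose g := nnsfun_approx measurableT mF.
have FE : F = fun y => limn (fun i => (g i y)%:E).
  by apply/funext => y; apply/esym/cvg_lim => //; exact: cvg_nnsfun_approx.
have mg i : measurable_fun setT (fun y => (g i y)%:E) by exact/measurable_EFinP.
have g0 i y : 0 <= (g i y)%:E by rewrite lee_fin.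
have ndg y : nondecreasing_seq (fun i => (g i y)%:E).
  by move=> a b ab; rewrite lee_fin; exact/lefP/nd_nnsfun_approx.
rewrite {}FE monotone_convergence// iint_aux_lim//; congr (limn _).
apply/funext => i; rewrite integralT_nnsfun sintegralE fsbig_finite//=.
have -> : (fun y => (g i y)%:E) =
    (fun y : E => \sum_(r <- finmap.enum_fset (fset_set (range (g i)))) (r%:E * \d_y (g i @^-1` [set r]))).
  apply/funext => y; rewrite {1}fimfunE fsbig_finite//= -sumEFin.
  by apply: eq_bigr => r _; rewrite EFinM.
(* [iint_aux_sum] wants nonnegative terms for every real [r], not only for values of [g i].
   Replacing [r] by [max r 0] is harmless: a negative [r] has an empty preimage. *)
have E1 (r : R) (y : E) : (r%:E * \d_y (g i @^-1` [set r])) = ((Num.max r 0)%:E * \d_y (g i @^-1` [set r])).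
  have [r0|r0] := leP 0%R r => //.
  suff -> : \d_y (g i @^-1` [set r]) = 0 :> \bar R by rewrite !mule0.
  by rewrite preimage_nnfun0// measure0.
under [in RHS]eq_fun => y do under eq_bigr => r _ do rewrite E1.
rewrite iint_aux_sum; last 2 first.
- by move=> r y; rewrite mule_ge0// lee_fin le_max lexx orbT.
- by move=> r; apply: measurable_funeM; exact: measurable_dirac_set.
apply: eq_bigr => r _; rewrite iint_auxZl ?le_max ?lexx ?orbT//; last exact: measurable_dirac_set.
have [r0|r0] := leP 0%R r => //.
by rewrite mul0e preimage_nnfun0// measure0 mule0.
Qed.

Local Open Scope ring_scope.

Lemma measurable_integral_slice (G : E * RT -> \bar R) : measurable_fun setT G ->
  measurable_fun setT (fun x : E => \int[lebesgue_measure]_s G (x, s))%E.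
Proof.
move=> mG; rewrite (_ : (fun _ => _) = (fun x : E => \int[lebesgue_measure]_s G^\+ (x, s) - \int[lebesgue_measure]_s G^\- (x, s))%E); last first.
  by apply/funext => x; rewrite [LHS]integralE; congr (_ - _)%E; apply: eq_integral => s _; rewrite ?funeposE ?funenegE.
apply: emeasurable_funB.
  exact: (@measurable_fun_fubini_tonelli_F _ _ E RT R lebesgue_measure _ (measurable_funepos mG)).
exact: (@measurable_fun_fubini_tonelli_F _ _ E RT R lebesgue_measure _ (measurable_funeneg mG)).
Qed.

Lemma measurable_iintR_aux k (F : E -> R) : measurable_fun setT F ->
  measurable_fun setT (iintR_aux k F : E -> R).
Proof.
move=> mF; elim: k => //= k ih.
apply: (measurableT_comp (fine_measurable measurableT)) => /=.
apply: (measurable_integral_slice (fun z => (iintR_aux k F (set_coord z.1 k z.2))%:E)).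
by apply/measurable_EFinP; exact: measurableT_comp ih (measurable_set_coord k).
Qed.

(** Fubini for the real-valued iteration. Each inner [Rintegral] passes through [fine], so it
    carries no meaning on slices that are not integrable; these form a null set, where measurability
    of [iintR_aux] is all that is required. *)
Lemma iintR_auxE k x (F : E -> R) :
  (iter_measure k x).-integrable setT (EFin \o F) ->
  iintR_aux k F x = Rintegral (iter_measure k x) setT F.
Proof.
move=> intF; have mEF := measurable_int _ intF.
have mF : measurable_fun setT F by apply/measurable_EFinP.
have mp : measurable_fun setT ((EFin \o F)^\+)%E by exact: measurable_funepos.
have mn : measurable_fun setT ((EFin \o F)^\-)%E by exact: measurable_funeneg.
have IE j y : (\int[iter_measure j y]_z (F z)%:E =
    iint_aux j (EFin \o F)^\+ y - iint_aux j (EFin \o F)^\- y)%E.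
  by rewrite integralE !integral_iter_measure.
elim: k x intF => [|k ih] x intF.
  by rewrite /Rintegral IE /= -[RHS]/(fine ((_ \- _)%E x)) -funeposneg.
have /integrable_funepos-/(_ measurableT) := intF.
have /integrable_funeneg-/(_ measurableT) := intF.
move=> /integrableP[_]; under eq_integral do rewrite gee0_abs//.
rewrite integral_iter_measure//= => intn.
move=> /integrableP[_]; under eq_integral do rewrite gee0_abs//.
rewrite integral_iter_measure//= => intp.
have {}intn : lebesgue_measure.-integrable setT (fun s : RT => iint_aux k ((EFin \o F)^\-)%E (set_coord x k s)).
  apply/integrableP; split; first exact: measurable_iint_aux_slice.
  by under eq_integral do rewrite gee0_abs ?iint_aux_ge0//.
have {}intp : lebesgue_measure.-integrable setT (fun s : RT => iint_aux k ((EFin \o F)^\+)%E (set_coord x k s)).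
  apply/integrableP; split; first exact: measurable_iint_aux_slice.
  by under eq_integral do rewrite gee0_abs ?iint_aux_ge0//.
rewrite /Rintegral IE /= -integralB//; congr fine.
apply: ae_eq_integral => //.
- apply/measurable_EFinP.
  apply: (measurableT_comp (measurable_iintR_aux k F mF) (measurable_set_coordr k x)).
- by apply: emeasurable_funB; [exact: measurable_int intp|exact: measurable_int intn].
have := integrable_ae measurableT intp; have := integrable_ae measurableT intn.
apply: filterS2 => s /(_ Logic.I) fn /(_ Logic.I) fp _ /=.
rewrite ih; last first.
  apply/integrableP; split => //; rewrite -/(comp _ _).
  rewrite integral_iter_measure//; last by exact: measurableT_comp.
  have -> : (fun y => `|(F y)%:E|)%E = (fun y => (EFin \o F)^\+ y + (EFin \o F)^\- y)%E.
    by rewrite -fune_abse.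
  by rewrite iint_auxD// lte_add_pinfty// ltey_eq ?fn ?fp.
by rewrite /Rintegral IE fineK// fin_numB fn fp.
Qed.

Lemma Rn_measurableP (phi : 'rV[R]_n -> R) :
  Rn_measurable phi <-> measurable_fun setT (phi : E -> R).
Proof.
split=> [mphi|mphi B oB].
  apply: (@measurability _ _ E (measurableTypeR R) setT _ _ (RGenOpens.measurableE R)) => _ [_ [a [b ->]] <-].
  by rewrite setTI; apply: mphi; exact: interval_open.
by have := mphi measurableT _ (open_measurable oB); rewrite setTI.
Qed.

Definition lebesgue_rV : {measure set E -> \bar R} := iter_measure n (0 : E).

Lemma iintE (F : E -> \bar R) : (forall x, 0%E <= F x)%E -> measurable_fun setT F ->
  iint F = (\int[lebesgue_rV]_x F x)%E.
Proof. by move=> F0 mF; rewrite integral_iter_measure. Qed.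

Lemma iintRE (F : E -> R) : lebesgue_rV.-integrable setT (EFin \o F) ->
  iintR F = Rintegral lebesgue_rV setT F.
Proof. exact: iintR_auxE. Qed.

End IteratedMeasure.

(** * Smooth functions of one variable *)

Section SmoothLine.
Variable R : realType.
Implicit Types (f g : R -> R) (x a b : R).

Definition smooth1 f := forall k x, derivable (derive1n k f) x 1.

(** Coinduction for smoothness: exhibiting a class closed under differentiation replaces formulas
    for the iterated derivatives. *)
Lemma smooth1_ind (C : (R -> R) -> Prop) :
  (forall f, C f -> exists2 df, C df & forall x, is_derive x 1 f (df x)) ->
  forall f, C f -> smooth1 f.
Proof.
move=> HC f Cf k.
suff [g Cg ->] : exists2 g, C g & derive1n k f = g.
  by have [dg _ dgP] := HC _ Cg; move=> x; case: (dgP x).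
elim: k => [|k [g Cg gE]]; first by exists f.
rewrite derive1nS gE; have [dg Cdg dgP] := HC _ Cg; exists dg => //.
by apply/funext => x; rewrite derive1E; case: (dgP x).
Qed.

Lemma smooth1_is_derive f x : smooth1 f -> is_derive x 1 f (derive1 f x).
Proof. by move=> sf; rewrite derive1E; apply: DeriveDef => //; exact: (sf 0). Qed.

Lemma smooth1_derive1 f : smooth1 f -> smooth1 (derive1 f).
Proof. by move=> sf k x; rewrite -derive1Sn; exact: (sf k.+1). Qed.

Lemma smooth1_continuous f : smooth1 f -> continuous f.
Proof.
by move=> sf x; apply: differentiable_continuous; apply/derivable1_diffP; exact: (sf 0).
Qed.

(** Inverses are taken only of functions already known to be smooth; the derivative [- f' f^-1 f^-1]
    still lies in the class, which is what [smooth1_ind] asks for. *)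
Inductive smooth1_alg : (R -> R) -> Prop :=
| Salg_smooth f : smooth1 f -> smooth1_alg f
| Salg_inv f : smooth1 f -> (forall x, f x != 0) -> smooth1_alg (fun x => (f x)^-1)
| Salg_add f g : smooth1_alg f -> smooth1_alg g -> smooth1_alg (fun x => f x + g x)
| Salg_mul f g : smooth1_alg f -> smooth1_alg g -> smooth1_alg (fun x => f x * g x).

Lemma smooth1_cst c : smooth1 (fun _ => c).
Proof.
apply: (smooth1_ind (fun f => exists c, f = fun _ => c)); last by exists c.
move=> _ [d ->]; exists (fun _ => 0); first by exists 0.
by move=> x; exact: is_derive_cst.
Qed.

Lemma smooth1_algP f : smooth1_alg f -> smooth1 f.
Proof.
apply: smooth1_ind => {}f; elim=> {f}.
- move=> f sf; exists (derive1 f); first exact/Salg_smooth/smooth1_derive1.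
  by move=> x; exact: smooth1_is_derive.
- move=> f sf f0; exists (fun x => (-1) * (derive1 f x * ((f x)^-1 * (f x)^-1))).
    apply: Salg_mul; first exact/Salg_smooth/smooth1_cst.
    by apply: Salg_mul; [exact/Salg_smooth/smooth1_derive1|apply: Salg_mul; exact: Salg_inv].
  move=> x; have dfx := smooth1_is_derive f x sf.
  apply: (is_derive_eq (is_deriveV (f0 x) dfx)).
  by rewrite /GRing.scale /= expr2 invfM; ring.
- move=> f g sf [df Sdf dfP] sg [dg Sdg dgP]; exists (fun x => df x + dg x); first exact: Salg_add.
  by move=> x; have := dfP x; have := dgP x => ? ?; exact: is_deriveD.
- move=> f g sf [df Sdf dfP] sg [dg Sdg dgP].
  exists (fun x => f x * dg x + g x * df x); first by apply: Salg_add; exact: Salg_mul.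
  by move=> x; have := dfP x; have := dgP x => ? ?; exact: is_deriveM.
Qed.

Lemma smooth1D f g : smooth1 f -> smooth1 g -> smooth1 (fun x => f x + g x).
Proof. by move=> sf sg; apply/smooth1_algP/Salg_add; exact: Salg_smooth. Qed.

Lemma smooth1M f g : smooth1 f -> smooth1 g -> smooth1 (fun x => f x * g x).
Proof. by move=> sf sg; apply/smooth1_algP/Salg_mul; exact: Salg_smooth. Qed.

Lemma smooth1V f : smooth1 f -> (forall x, f x != 0) -> smooth1 (fun x => (f x)^-1).
Proof. by move=> sf f0; apply/smooth1_algP/Salg_inv. Qed.

Lemma is_derive_comp_affine f a b x df : is_derive (a * x + b) 1 f df ->
  is_derive x 1 (fun y => f (a * y + b)) (a * df).
Proof.
move=> dfx.
have d1 : is_derive x 1 (fun y => a * y + b) a.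
  by apply: is_derive_eq; rewrite addr0 /GRing.scale /= mulr1.
rewrite mulrC; exact: (@is_derive1_comp _ f (fun y => a * y + b) x df a).
Qed.

Lemma smooth1_affine f a b : smooth1 f -> smooth1 (fun x => f (a * x + b)).
Proof.
move=> sf; apply: (smooth1_ind (fun g => exists c f, smooth1 f /\ g = fun x => c * f (a * x + b))).
  move=> _ [c [g [sg ->]]]; exists (fun x => (c * a) * derive1 g (a * x + b)).
    by exists (c * a), (derive1 g); split; [exact: smooth1_derive1|].
  move=> x; have dg := smooth1_is_derive g (a * x + b) sg.
  have dgc := is_derive_comp_affine _ _ _ _ _ dg.
  by apply: is_derive_eq; rewrite /GRing.scale /= -mulrA.
by exists 1, f; split => //; apply/funext => x; rewrite mul1r.
Qed.

(** * Exponentials, and the cut-offs built from them *)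

Lemma smooth1_expR : smooth1 (@expR R).
Proof.
apply: (smooth1_ind (fun f => f = @expR R)) => // _ ->; exists (@expR R) => // x.
exact: is_derive_expR.
Qed.

(** The powers of [1/x] are included because the flat function [e^{-1/x}] alone is not stable under
    differentiation, while the span of this family is. *)
Definition expinv (m : nat) x : R := if 0 < x then x ^- m * expR (- x^-1) else 0.

Lemma pow_le_expR (m : nat) (y : R) : 0 <= y -> y ^+ m <= m`!%:R * expR y.
Proof.
case: m => [|m] y0; first by rewrite expr0 fact0 mul1r -expR0 ler_expR.
rewrite mulrC -ler_pdivrMr ?ltr0n ?fact_gt0//.
by rewrite (le_trans _ (expR_ge1Dxn m y0))// lerDr.
Qed.

(** This is [y^(m+1) <= (m+1)! e^y] at [y = 1/x]. A linear bound at every index is what makes the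
    difference quotients at 0 tend to 0. *)
Lemma expinv_le (m : nat) x : `|expinv m x| <= m.+1`!%:R * `|x|.
Proof.
rewrite /expinv; case: ltP => [x0|_]; last by rewrite normr0 mulr_ge0.
rewrite (gtr0_norm x0) ger0_norm; last by rewrite mulr_ge0 ?expR_ge0// invr_ge0 exprn_ge0// ltW.
have := pow_le_expR m.+1 x^-1; rewrite invr_ge0 (ltW x0) => /(_ isT) h.
rewrite expRN ler_pdivrMr ?expR_gt0// mulrAC -ler_pdivrMr//.
by rewrite -exprVn -exprSr.
Qed.

Lemma is_derive_expinv (m : nat) x :
  is_derive x 1 (expinv m) ((- m%:R) * expinv m.+1 x + expinv m.+2 x).
Proof.
have [x0|x0|->] := ltgtP x 0.
- have E : expinv m x = 0 by rewrite /expinv ltNge (ltW x0).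
  have -> : - m%:R * expinv m.+1 x + expinv m.+2 x = 0.
    by rewrite /expinv ltNge (ltW x0) /= mulr0 addr0.
  have nE : \near x, cst 0 x = expinv m x.
    near=> y; rewrite /expinv ifF//; apply/negbTE; rewrite -leNgt ltW//.
    by near: y; exact: lt_nbhsl.
  exact: near_eq_is_derive nE (is_derive_cst _ _ _).
- have -> : - m%:R * expinv m.+1 x + expinv m.+2 x =
      (x ^- m) * (expR (- x^-1) * x ^- 2) + expR (- x^-1) * (- m%:R * x ^- m.+1).
    by rewrite /expinv x0 -addn2 exprD invfM; ring.
  have nE : \near x, (fun y => y ^- m * expR (- y^-1)) x = expinv m x.
    near=> y; rewrite /expinv ifT//.
    by near: y; exact: lt_nbhsr.
  apply: near_eq_is_derive nE _.
  have xn0 : x != 0 by rewrite gt_eqF.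
  have d1 : is_derive x 1 (fun y : R => expR (- y^-1)) (expR (- x^-1) * x ^- 2).
    have dV : is_derive x 1 (fun y : R => - y^-1) (x ^- 2).
      apply: is_derive_eq (is_deriveN (is_deriveV xn0 (is_derive_id x 1))) _.
      by rewrite /GRing.scale /= mulr1 opprK.
    exact: (@is_derive1_comp _ (@expR R) (fun y : R => - y^-1)).
  have d2 : is_derive x 1 (fun y : R => y ^- m) (- m%:R * x ^- m.+1).
    case: m => [|m].
      by rewrite oppr0 mul0r; under eq_fun do rewrite expr0 invr1; exact: is_derive_cst.
    have xm0 : x ^+ m.+1 != 0 by rewrite expf_neq0.
    have dX : is_derive x 1 (fun y : R => y ^+ m.+1) ((m.+1%:R * x ^+ m) *: 1).
      by have := is_deriveX m.+1 (is_derive_id x (1 : R)); rewrite exprfctE.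
    have dV := is_deriveV (f := fun y : R => y ^+ m.+1) xm0 dX.
    apply: (is_derive_eq dV).
    rewrite /GRing.scale /= mulr1 !(exprS x).
    by field; rewrite expf_neq0.
  exact: is_deriveM.
- have -> : - m%:R * expinv m.+1 0 + expinv m.+2 0 = 0.
    by rewrite /expinv ltxx /= mulr0 addr0.
  have lim0 : (fun h : R => h^-1 *: (expinv m (h *: 1 + 0) - expinv m 0)) @ 0^' --> (0 : R).
    apply/cvgrPdist_le => /= e e0.
    near=> h; have h0 : h != 0 by near: h; exact: nbhs_dnbhs_neq.
    rewrite sub0r normrN /GRing.scale /= mulr1 addr0 {2}/expinv ltxx subr0 normrM normfV.
    rewrite ler_pdivrMl ?normr_gt0//.
    (* One factor [h] is split off, so that the linear bound at index [m.+1] leaves a difference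
       quotient of size [O(|h|)]. *)
    have -> : expinv m h = h * expinv m.+1 h.
      rewrite /expinv; case: ifP => h1; last by rewrite mulr0.
      by rewrite mulrA; congr (_ * _); rewrite exprS invfM mulrA divff// mul1r.
    rewrite normrM ler_wpM2l// (le_trans (expinv_le _ _))// mulrC -ler_pdivlMr ?ltr0n ?fact_gt0//.
    by near: h; apply: dnbhs0_le; rewrite divr_gt0// ltr0n fact_gt0.
  apply: DeriveDef; first by apply/cvg_ex; exists 0.
  by apply/cvg_lim.
Unshelve. all: by end_near. Qed.

Lemma smooth1_expinv m : smooth1 (expinv m).
Proof.
pose C (f : R -> R) := exists r : seq (R * nat), f = fun x => \sum_(c <- r) c.1 * expinv c.2 x.
apply: (smooth1_ind C); last first.
  by exists [:: (1, m)]; apply/funext => x; rewrite big_seq1 mul1r.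
move=> _ [r ->].
exists (fun x => \sum_(c <- r) c.1 * ((- c.2%:R) * expinv c.2.+1 x + expinv c.2.+2 x)).
  exists (flatten [seq [:: (c.1 * - c.2%:R, c.2.+1); (c.1, c.2.+2)] | c <- r]).
  apply/funext => x; rewrite big_flatten /= big_map; apply: eq_bigr => c _.
  by rewrite big_cons big_seq1 /= mulrDr mulrA.
move=> x; elim: r => [|c r ih].
  by under eq_fun do rewrite big_nil; rewrite big_nil; exact: is_derive_cst.
under eq_fun do rewrite big_cons; rewrite big_cons.
apply: is_deriveD => //.
have dc := is_derive_expinv c.2 x.
exact: (is_deriveZ c.1 dc).
Qed.

Lemma expinv_gt0 m x : 0 < x -> 0 < expinv m x.
Proof. by move=> x0; rewrite /expinv x0 mulr_gt0 ?expR_gt0// invr_gt0 exprn_gt0. Qed.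

Lemma expinv_ge0 m x : 0 <= expinv m x.
Proof. by have [x0|/expinv_gt0-/(_ m)/ltW//] := leP x 0; rewrite /expinv ltNge x0. Qed.

Lemma expinv_eq0 m x : x <= 0 -> expinv m x = 0.
Proof. by move=> x0; rewrite /expinv ltNge x0. Qed.

Lemma derive1_expinv0 x : derive1 (expinv 0) x = expinv 2 x.
Proof.
by rewrite derive1E; case: (is_derive_expinv 0 x) => _ ->; rewrite oppr0 mul0r add0r.
Qed.

(** The standard smooth transition between the values 0 and 1; the two terms of the denominator
    never vanish together. *)
Definition step x := expinv 0 x / (expinv 0 x + expinv 0 (1 - x)).

Lemma step_den_gt0 x : 0 < expinv 0 x + expinv 0 (1 - x).
Proof.
have [x0|x0] := ltP 0 x; first by rewrite ltr_pwDl ?expinv_gt0 ?expinv_ge0.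
by rewrite ltr_pwDr ?expinv_ge0 ?expinv_gt0// subr_gt0 (le_lt_trans x0).
Qed.

Lemma smooth1_step : smooth1 step.
Proof.
apply: smooth1M; first exact: smooth1_expinv.
apply: smooth1V; last by move=> x; rewrite gt_eqF ?step_den_gt0.
apply: smooth1D; first exact: smooth1_expinv.
have := smooth1_affine _ (-1) 1 (smooth1_expinv 0).
by under eq_fun do rewrite mulN1r addrC.
Qed.

Lemma step_eq0 x : x <= 0 -> step x = 0.
Proof. by move=> x0; rewrite /step expinv_eq0// mul0r. Qed.

Lemma step_eq1 x : 1 <= x -> step x = 1.
Proof.
move=> x1; rewrite /step [X in _ / (_ + X)]expinv_eq0 ?subr_le0// addr0 divff//.
by rewrite gt_eqF// expinv_gt0// (lt_le_trans _ x1).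
Qed.

Lemma step_ge0 x : 0 <= step x.
Proof. by rewrite /step divr_ge0 ?expinv_ge0// ltW ?step_den_gt0. Qed.

Lemma step_le1 x : step x <= 1.
Proof. by rewrite /step ler_pdivrMr ?step_den_gt0// mul1r lerDl expinv_ge0. Qed.

(** In the quotient rule the numerator is a sum of products of nonnegative functions, [expinv 2]
    being the derivative of [expinv 0]. The sign is what lets rescaled copies of this derivative
    serve as averaging kernels. *)
Lemma derive1_step_ge0 x : 0 <= derive1 step x.
Proof.
pose D y := expinv 0 y + expinv 0 (1 - y).
have dN : is_derive x 1 (expinv 0) (expinv 2 x).
  by rewrite -derive1_expinv0; apply: smooth1_is_derive; exact: smooth1_expinv.
have dN1 : is_derive x 1 (fun y => expinv 0 (1 - y)) (- expinv 2 (1 - x)).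
  have d1 : is_derive (-1 * x + 1) 1 (expinv 0) (expinv 2 (1 - x)).
    rewrite mulN1r addrC -derive1_expinv0; apply: smooth1_is_derive; exact: smooth1_expinv.
  have := is_derive_comp_affine _ _ _ _ _ d1; rewrite mulN1r.
  by under eq_fun do rewrite mulN1r addrC.
have dD : is_derive x 1 D (expinv 2 x + - expinv 2 (1 - x)) by exact: is_deriveD.
have D0 : D x != 0 by rewrite gt_eqF// step_den_gt0.
have dV := is_deriveV D0 dD.
have dS := is_deriveM dN dV.
rewrite derive1E -/step; have -> : step = (expinv 0 * (fun y => (D y)^-1))%R by [].
case: dS => _ ->; rewrite /GRing.scale /=.
have -> : expinv 0 x * (- (D x) ^- 2 * (expinv 2 x - expinv 2 (1 - x))) + (D x)^-1 * expinv 2 x =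
   (expinv 0 (1 - x) * expinv 2 x + expinv 0 x * expinv 2 (1 - x)) / D x ^+ 2.
  rewrite /D in D0 *; move: D0; set A := expinv 0 x; set B := expinv 0 (1 - x) => D0.
  by field.
by rewrite divr_ge0 ?exprn_even_ge0// addr_ge0// mulr_ge0 ?expinv_ge0.
Qed.

Lemma derive1_local_cst f c a x : a > 0 -> (forall y, `|y - x| < a -> f y = c) -> derive1 f x = 0.
Proof.
move=> a0 fc; rewrite derive1E.
have fE : \near x, f x = cst c x.
  near=> y; apply: fc; rewrite distrC.
  by near: y; exact: nbhsx_ballx.
rewrite (near_eq_derive _ fE); exact: derive_cst.
Unshelve. all: by end_near. Qed.

Lemma derive1_step_eq0 x : (x < 0) || (1 < x) -> derive1 step x = 0.
Proof.
case/orP => x0.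
  apply: (@derive1_local_cst _ 0 (- x)); first by rewrite oppr_gt0.
  by move=> y; rewrite ltr_distl => /andP[_ yx]; rewrite step_eq0// ltW// (lt_le_trans yx)// subrr.
apply: (@derive1_local_cst _ 1 (x - 1)); first by rewrite subr_gt0.
by move=> y; rewrite ltr_distl => /andP[+ _]; rewrite subKr => yx; rewrite step_eq1// ltW.
Qed.

Definition plateau L x := step (x + (L + 1)) * step (L + 1 - x).

Lemma smooth1_plateau L : smooth1 (plateau L).
Proof.
apply: smooth1M.
  have := smooth1_affine _ 1 (L + 1) smooth1_step.
  by under eq_fun do rewrite mul1r.
have := smooth1_affine _ (-1) (L + 1) smooth1_step.
by under eq_fun do rewrite mulN1r addrC.
Qed.

Lemma plateau_ge0 L x : 0 <= plateau L x.
Proof. by rewrite mulr_ge0 ?step_ge0. Qed.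

Lemma plateau_le1 L x : plateau L x <= 1.
Proof. by rewrite mulr_ile1 ?step_ge0 ?step_le1. Qed.

Lemma plateau_eq1 L x : `|x| <= L -> plateau L x = 1.
Proof. by rewrite ler_norml => /andP[Lx xL]; rewrite /plateau !step_eq1 ?mulr1//; lra. Qed.

Lemma plateau_neq0 L x : plateau L x != 0 -> `|x| <= L + 1.
Proof.
rewrite mulf_eq0 negb_or => /andP[h1 h2].
have {}h1 : 0 < x + (L + 1) by rewrite ltNge; apply: contra h1 => /step_eq0 ->.
have {}h2 : 0 < L + 1 - x by rewrite ltNge; apply: contra h2 => /step_eq0 ->.
by rewrite ler_norml; apply/andP; split; lra.
Qed.

End SmoothLine.

(** * Weak derivatives on an interval *)

Section WeakDerivative.
Variable R : realType.
Local Notation mu := (@lebesgue_measure R).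
Implicit Types (f g b c : R -> R).

Definition cont_on (l r : R) f := forall t, l < t -> t < r -> {for t, continuous f}.

Lemma cont_onM l r f g : cont_on l r f -> cont_on l r g -> cont_on l r (fun t => f t * g t).
Proof. by move=> cf cg t lt tr; apply: continuousM; [exact: cf|exact: cg]. Qed.

Lemma cont_onD l r f g : cont_on l r f -> cont_on l r g -> cont_on l r (fun t => f t + g t).
Proof. by move=> cf cg t lt tr; apply: continuousD; [exact: cf|exact: cg]. Qed.

Lemma cont_onN l r f : cont_on l r f -> cont_on l r (fun t => - f t).
Proof. by move=> cf t lt tr; apply: continuousN; exact: cf. Qed.

Lemma cont_on_continuous l r f : continuous f -> cont_on l r f.
Proof. by move=> cf t _ _; exact: cf. Qed.

Lemma cont_on_cst l r k : cont_on l r (fun _ => k).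
Proof. by move=> t _ _; exact: cst_continuous. Qed.

Lemma cont_on_within l r f s t : cont_on l r f -> l < s -> t < r ->
  {within `[s, t], continuous f}.
Proof.
move=> cf ls tr; apply: continuous_in_subspaceT => x; rewrite inE /= in_itv /= => /andP[sx xt].
by apply: cf; [exact: lt_le_trans sx|exact: le_lt_trans tr].
Qed.

Lemma cont_on_integrable l r f s t : cont_on l r f -> l < s -> t < r ->
  mu.-integrable `[s, t] (EFin \o f).
Proof.
move=> cf ls tr; apply: continuous_compact_integrable; first exact: segment_compact.
exact: cont_on_within cf ls tr.
Qed.

(** Tests live on a compact [[s, t]] inside [(l, r)], so continuity of [b] and [c] on the open
    interval already makes both integrals finite. *)
Definition weak_derivative (l r : R) b c := forall h (s t : R), smooth1 R h ->
  l < s -> s <= t -> t < r -> (forall x, h x != 0 -> s <= x <= t) ->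
  Rintegral mu `[s, t] (fun x => derive1 h x * b x) = - Rintegral mu `[s, t] (fun x => h x * c x).

Lemma RintegralN_cont l r f s t : cont_on l r f -> l < s -> t < r ->
  Rintegral mu `[s, t] (fun x => - f x) = - Rintegral mu `[s, t] f.
Proof.
move=> cf ls tr; have := @RintegralZl _ _ _ mu `[s, t]%classic f (-1) _ (cont_on_integrable _ _ _ _ _ cf ls tr).
by rewrite mulN1r => <-//; under [in RHS]eq_Rintegral do rewrite mulN1r.
Qed.

Lemma weak_derivativeN l r b c : cont_on l r b -> cont_on l r c ->
  weak_derivative l r b c -> weak_derivative l r (fun x => - b x) (fun x => - c x).
Proof.
move=> cb cc w h s t sh ls st tr hs.
under eq_Rintegral do rewrite mulrN; under [in RHS]eq_Rintegral do rewrite mulrN.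
rewrite !(@RintegralN_cont l r) ?w//; apply: cont_onM => //; apply: cont_on_continuous.
  exact: smooth1_continuous.
by apply: smooth1_continuous; exact: smooth1_derive1.
Qed.

(** The rescaled derivative of [step] is a kernel of unit mass carried by [[a, a + d]]; averages
    against it will stand for values at [a]. *)
Lemma Rintegral_bump (s t a d : R) : 0 < d -> s <= a -> a + d <= t ->
  Rintegral mu `[s, t] (fun x => d^-1 * derive1 (step R) (d^-1 * x + (- (d^-1 * a)))) = 1.
Proof.
move=> d0 sa adt; have st : s < t by lra.
pose F x := step R (d^-1 * x + - (d^-1 * a)).
have dF (x : R) : is_derive x 1 F (d^-1 * derive1 (step R) (d^-1 * x + (- (d^-1 * a)))).
  by apply: is_derive_comp_affine; apply: smooth1_is_derive; exact: smooth1_step.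
have cF : continuous F.
  by apply: smooth1_continuous; apply: smooth1_affine; exact: smooth1_step.
rewrite /Rintegral (@continuous_FTC2 _ _ F)//.
- rewrite /F -!mulrBr step_eq1; last by rewrite mulrC ler_pdivlMr// mul1r; lra.
  by rewrite [step R _]step_eq0 /= ?subr0// pmulr_rle0 ?invr_gt0// subr_le0.
- apply: (@cont_on_within (s - 1) (t + 1)); [|lra|lra].
  apply: cont_onM; first exact: cont_on_cst.
  apply: cont_on_continuous; apply: (@smooth1_continuous R (fun x => derive1 (step R) (d^-1 * x + - (d^-1 * a)))).
  by apply: smooth1_affine; apply: smooth1_derive1; exact: smooth1_step.
- split => [x _||]; first by case: (dF x).
    by apply: cvg_at_right_filter; exact: cF.
  by apply: cvg_at_left_filter; exact: cF.
- by move=> x _; rewrite derive1E; case: (dF x).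
Qed.

Lemma Rintegral_cst_itv (s t k : R) : s <= t -> Rintegral mu `[s, t] (fun _ => k) = k * (t - s).
Proof.
move=> st; rewrite Rintegral_cst//= lebesgue_measure_itv /= lte_fin.
by move: st; rewrite le_eqVlt => /orP[/eqP ->|->]; rewrite ?ltxx ?subrr.
Qed.

Lemma le_Rintegral_cont l r f g s t : cont_on l r f -> cont_on l r g -> l < s -> t < r ->
  (forall x, s <= x <= t -> f x <= g x) -> Rintegral mu `[s, t] f <= Rintegral mu `[s, t] g.
Proof.
move=> cf cg ls tr fg; apply: le_Rintegral => //.
- exact: cont_on_integrable cf ls tr.
- exact: cont_on_integrable cg ls tr.

Qed.

(* Testing against the difference of two smoothed Heaviside functions. *)
Lemma weak_derivative_ge l r b c m s t t' : cont_on l r b -> cont_on l r c ->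
  weak_derivative l r b c -> l < s -> s < t -> t < t' -> t' < r ->
  (forall x, s <= x <= t' -> m <= c x) -> m * (t - s) <= b t - b s.
Proof.
have key (bs bt M X Y Z e : R) : bs - e / 3 <= X -> Y <= bt + e / 3 -> M - e / 3 <= Z ->
  X - Y = - Z -> M <= bt - bs + e by lra.
move=> cb cc w ls st tt' t'r mc.
apply/ler_addgt0Pr => e e0.
have e30 : 0 < e / 3 by rewrite divr_gt0.
have /cvgrPdist_le/(_ _ e30)/nbhs_ballP[d1 /= d10 hd1] := cb s ls (lt_trans (lt_trans st tt') t'r).
have /cvgrPdist_le/(_ _ e30)/nbhs_ballP[d2 /= d20 hd2] := cb t (lt_trans ls st) (lt_trans tt' t'r).
(* [d < d1] and [d < d2] control the averages of [b] near [s] and [t]; [t + d < t'] keeps the test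
   where [c] is bounded below; [|m| d] is the error made in giving the test the mass [t - s]. *)
have [d [[d0 dd1 dd2] [dt' dst dm]]] : exists d : R, [/\ 0 < d, d < d1 & d < d2] /\ [/\ t + d < t', d < t - s & `|m| * d <= e / 3].
  pose k := Num.min (Num.min d1 d2) (Num.min (Num.min (t' - t) (t - s)) (e / 3 / (`|m| + 1))).
  have m10 : 0 < `|m| + 1 by rewrite ltr_wpDl.
  have k0 : 0 < k by rewrite !lt_min d10 d20 !subr_gt0 tt' st divr_gt0.
  have k2 : k / 2 < k by rewrite ltr_pdivrMr// ltr_pMr// ltr1n.
  have k2p : 0 < k / 2 by rewrite divr_gt0.
  move: (lexx k); rewrite {2}/k !le_min => /andP[/andP[ka kb] /andP[/andP[kc kd] ke]].
  exists (k / 2); split; [by split; lra|split; [lra|lra|]].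
  have : (`|m| + 1) * (k / 2) <= e / 3.
    by rewrite mulrC -ler_pdivlMr//; lra.
  by rewrite mulrDl mul1r; lra.
pose S (a x : R) : R := step R (d^-1 * x + (- (d^-1 * a))).
pose B (a x : R) : R := d^-1 * derive1 (step R) (d^-1 * x + (- (d^-1 * a))).
have sS a : smooth1 R (S a) by apply: smooth1_affine; exact: smooth1_step.
have dS a (x : R) : is_derive x 1 (S a) (B a x).
  by apply: is_derive_comp_affine; apply: smooth1_is_derive; exact: smooth1_step.
have cS a : cont_on l r (S a) by apply: cont_on_continuous; exact: smooth1_continuous.
have cB a : cont_on l r (B a).
  apply: cont_onM; first exact: cont_on_cst.
  apply: cont_on_continuous; apply: (@smooth1_continuous R (fun x => derive1 (step R) (d^-1 * x + - (d^-1 * a)))).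
  by apply: smooth1_affine; apply: smooth1_derive1; exact: smooth1_step.
have arg (a x : R) : d^-1 * x + - (d^-1 * a) = (x - a) / d by rewrite -mulrBr mulrC.
have S0 (a x : R) : x <= a -> S a x = 0.
  by move=> xa; rewrite /S arg step_eq0// pmulr_lle0 ?invr_gt0// subr_le0.
have S1 (a x : R) : a + d <= x -> S a x = 1.
  by move=> xa; rewrite /S arg step_eq1// ler_pdivlMr// mul1r; lra.
have S01 (a x : R) : 0 <= S a x <= 1 by rewrite step_ge0 step_le1.
have B0 (a x : R) : (x < a) || (a + d < x) -> B a x = 0.
  move=> h; rewrite /B arg derive1_step_eq0 ?mulr0//.
  by rewrite pmulr_llt0 ?invr_gt0// subr_lt0 ltr_pdivlMr// mul1r ltrBrDl.
have Bge0 (a x : R) : 0 <= B a x by rewrite mulr_ge0 ?derive1_step_ge0// invr_ge0 ltW.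
have ls' : l < s by [].
have tdr : t + d < r by lra.
pose h (x : R) : R := S s x - S t x.
have sh : smooth1 R h.
  apply: smooth1D => //.
  have := smooth1M _ _ _ (smooth1_cst R (-1)) (sS t).
  by under eq_fun do rewrite mulN1r.
have dh x : derive1 h x = B s x - B t x.
  rewrite derive1E; have := is_deriveB (dS s x) (dS t x).
  by case.
have hsupp (x : R) : h x != 0 -> s <= x <= t + d.
  move=> hx; apply/andP; split; rewrite leNgt; apply: contra hx => hx; rewrite /h.
    by rewrite !S0 ?subrr//; lra.
  by rewrite !S1 ?subrr//; lra.
have h01 (x : R) : 0 <= h x.
  rewrite /h subr_ge0; have [xt|tx] := leP x t; first by rewrite (S0 t)//; case/andP: (S01 s x).
  by rewrite (S1 s) ?(andP (S01 t x)).2//; lra.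
have h1 (x : R) : h x <= 1.
  by rewrite /h lerBlDr (le_trans (andP (S01 s x)).2)// lerDl (andP (S01 t x)).1.
have := w h s (t + d) sh ls' _ tdr hsupp.
have -> : s <= t + d by lra.
move=> /(_ isT).
under eq_Rintegral do rewrite dh mulrBl.
rewrite RintegralB//; last 2 first.
- by apply: (@cont_on_integrable l r) => //; exact: cont_onM.
- by apply: (@cont_on_integrable l r) => //; exact: cont_onM.
have I1 : b s - e / 3 <= Rintegral mu `[s, t + d] (fun x => B s x * b x).
  apply: (@le_trans _ _ (Rintegral mu `[s, t + d] (fun x => (b s - e / 3) * B s x))).
    rewrite RintegralZl//; last exact: (@cont_on_integrable l r).
    by rewrite Rintegral_bump ?mulr1//; lra.
  apply: (@le_Rintegral_cont l r) => //; [|exact: cont_onM|].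
    by apply: cont_onM => //; exact: cont_on_cst.
  move=> x _; rewrite mulrC.
  have [xs|] := boolP ((x < s) || (s + d < x)); first by rewrite B0// !mul0r.
  rewrite negb_or -!leNgt => /andP[sx xs]; rewrite ler_wpM2l//.
  have := hd1 x; rewrite /ball /= ltr_distlC => /(_ _).
  rewrite ler_distlC => /(_ _)/andP[]; [|lra].
  by apply/andP; split; lra.
have I2 : Rintegral mu `[s, t + d] (fun x => B t x * b x) <= b t + e / 3.
  apply: (@le_trans _ _ (Rintegral mu `[s, t + d] (fun x => (b t + e / 3) * B t x))); last first.
    rewrite RintegralZl//; last exact: (@cont_on_integrable l r).
    by rewrite Rintegral_bump ?mulr1//; lra.
  apply: (@le_Rintegral_cont l r) => //; [exact: cont_onM| |].
    by apply: cont_onM => //; exact: cont_on_cst.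
  move=> x _; rewrite [leRHS]mulrC.
  have [xs|] := boolP ((x < t) || (t + d < x)); first by rewrite B0// !mul0r.
  rewrite negb_or -!leNgt => /andP[sx xs]; rewrite ler_wpM2l//.
  have := hd2 x; rewrite /ball /= ltr_distlC => /(_ _).
  rewrite ler_distlC => /(_ _)/andP[]; [|lra].
  by apply/andP; split; lra.
have I3 : m * (t - s) - e / 3 <= Rintegral mu `[s, t + d] (fun x => h x * c x).
  have ch : cont_on l r h by apply: cont_on_continuous; exact: smooth1_continuous.
  apply: (@le_trans _ _ (Rintegral mu `[s, t + d] (fun x => m * h x))); last first.
    apply: (@le_Rintegral_cont l r) => //; [|exact: cont_onM|].
      by apply: cont_onM => //; exact: cont_on_cst.
    by move=> x /andP[sx xt]; rewrite mulrC ler_wpM2l// mc// sx/= (le_trans xt)// ltW.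
  rewrite RintegralZl//; last exact: (@cont_on_integrable l r).
  have Iup : Rintegral mu `[s, t + d] h <= t + d - s.
    have std : s <= t + d by move: st d0; clear; lra.
    have := Rintegral_cst_itv s (t + d) 1 std; rewrite mul1r => <-.
    by apply: (@le_Rintegral_cont l r) => //; exact: cont_on_cst.
  have Ilo : t - s - d <= Rintegral mu `[s, t + d] h.
    have ih : mu.-integrable `[s, t + d] (EFin \o h) by exact: (@cont_on_integrable l r).
    have -> : t - s - d = Rintegral mu `[s + d, t] h.
      rewrite (_ : Rintegral _ _ _ = Rintegral mu `[s + d, t] (fun=> 1)).
        by rewrite Rintegral_cst_itv; move: dst; clear; lra.
      apply: eq_Rintegral => x; rewrite inE /= in_itv /= => /andP[sx xt].
      by rewrite /h S1// S0// subr0.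
    have sub : `[s + d, t]%classic `<=` `[s, t + d]%classic.
      move=> x /=; rewrite !in_itv /= => /andP[sx xt].
      by apply/andP; split; move: d0 sx xt; clear; lra.
    apply: fine_le.
    - by apply: integrable_fin_num => //; exact: integrableS ih.
    - exact: integrable_fin_num.
    - apply: ge0_subset_integral => //; first exact: measurable_int ih.
      by move=> x _; rewrite lee_fin.
  (* For [m >= 0] a lower bound on the mass of [h] is needed, for [m < 0] an upper one; each differs
     from [t - s] by [d]. *)
  have [m0|m0] := leP 0 m.
    rewrite ger0_norm// in dm; apply: (@le_trans _ _ (m * (t - s - d))); last exact: ler_wpM2l.
    by rewrite mulrBr; move: dm; clear; lra.
  rewrite ltr0_norm// in dm; apply: (@le_trans _ _ (m * (t + d - s))); last by rewrite ler_wnM2l// ltW.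
  have -> : m * (t + d - s) = m * (t - s) - - m * d by ring.
  by move: dm; clear; lra.
exact: key I1 I2 I3.
Qed.

(** A continuous distributional derivative is classical: near [t], [c >= c t - e] and
    [- c >= - c t - e], so [weak_derivative_ge] for [(b, c)] and for [(- b, - c)] squeezes the
    increments of [b]. *)
Lemma is_derive_weak_derivative l r b c t : cont_on l r b -> cont_on l r c ->
  weak_derivative l r b c -> l < t -> t < r -> is_derive t 1 b (c t).
Proof.
move=> cb cc w lt tr.
(* Both endpoints are free near [t], so one estimate covers left and right difference quotients. *)
have H e : 0 < e -> exists2 d, 0 < d & forall x y, `|x - t| < d -> `|y - t| < d -> x < y ->
     `|b y - b x - c t * (y - x)| <= e * (y - x).
  move=> e0.
  have /cvgrPdist_le/(_ _ e0)/nbhs_ballP[d1 /= d10 hd1] := cc t lt tr.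
  pose d := Num.min (d1 / 2) (Num.min (t - l) (r - t) / 2).
  have [dd1 dl dr d0] : [/\ d <= d1 / 2, d <= (t - l) / 2, d <= (r - t) / 2 & 0 < d].
    rewrite /d !lt_min !ge_min lexx /= !ler_pM2r ?invr_gt0// !ge_min !lexx /= !orbT; split => //.
    by rewrite !divr_gt0// lt_min !subr_gt0 lt tr.
  exists d => // x y; rewrite !ltr_distlC => /andP[xl xr] /andP[yl yr] xy.
  have cb' (z : R) : t - d <= z <= t + d -> `|c t - c z| <= e.
    by move=> /andP[z1 z2]; apply: hd1; rewrite /ball /= ltr_distlC; apply/andP; split; lra.
  have U := @weak_derivative_ge l r b c (c t - e) x y (t + d) cb cc w.
  have V := @weak_derivative_ge l r _ _ (- c t - e) x y (t + d) (cont_onN _ _ _ cb) (cont_onN _ _ _ cc) (weak_derivativeN _ _ _ _ cb cc w).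
  have {}U : (c t - e) * (y - x) <= b y - b x.
    apply: U; [lra|done|lra|lra|].
    move=> z /andP[z1 z2]; have := cb' z _; rewrite ler_distlC => /(_ _)/andP[]; [apply/andP; split; lra|lra].
  have {}V : (- c t - e) * (y - x) <= - b y - - b x.
    apply: V; [lra|done|lra|lra|].
    move=> z /andP[z1 z2]; have := cb' z _; rewrite ler_distlC => /(_ _)/andP[]; [apply/andP; split; lra|lra].
  rewrite ler_norml; apply/andP; split; lra.
have lim : (fun h : R => h^-1 *: (b (h *: 1 + t) - b t)) @ 0^' --> c t.
  apply/cvgrPdist_le => /= e e0; have [d d0 Hd] := H _ e0.
  near=> h; have h0 : h != 0 by near: h; exact: nbhs_dnbhs_neq.
  have hd : `|h| < d by near: h; exact: dnbhs0_lt.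
  rewrite /GRing.scale /= mulr1.
  have -> : c t - h^-1 * (b (h + t) - b t) = - h^-1 * (b (h + t) - b t - c t * h) by field.
  rewrite normrM normrN normfV mulrC ler_pdivrMr ?normr_gt0//.
  have [hp|hn] := ltP 0 h.
    have := Hd t (h + t); rewrite subrr normr0 addrK ltrDr => /(_ d0 hd hp).
    by rewrite (gtr0_norm hp).
  have {}hn : h < 0 by rewrite lt_neqAle h0.
  have := Hd (h + t) t; rewrite subrr normr0 addrK gtrDr => /(_ hd d0 hn).
  rewrite (ltr0_norm hn) -normrN; congr (_ <= _); [congr (`|_|)|]; ring.
apply: DeriveDef; first by apply/cvg_ex; exists (c t).
by apply/cvg_lim.
Unshelve. all: by end_near. Qed.

End WeakDerivative.

(** * Product test functions *)

Section ProductTestFunctions.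
Variables (R : realType) (n : nat).
Local Notation V := (R * 'rV[R]_n)%type.

Lemma derive_line (f : V -> R) (z v : V) :
  'D_v f z = derive1 (fun h : R => f (h *: v + z)) 0.
Proof.
rewrite derive1E; apply: (congr1 (fun F : R -> R => lim (F @ 0^'))).
by apply/funext => h /=; rewrite scale0r add0r addr0 /GRing.scale /= mulr1.
Qed.

Lemma differentiable_fst_rV (z : V) : differentiable (fun z : V => z.1) z.
Proof.
apply: (@linear_differentiable _ _ _ (fst : {linear V -> R^o})).
by move=> x; exact: cvg_fst.
Qed.

Lemma differentiable_snd_rV (z : V) : differentiable (fun z : V => z.2) z.
Proof.
apply: (@linear_differentiable _ _ _ (snd : {linear V -> 'rV[R]_n})).
by move=> x; exact: cvg_snd.
Qed.

(* A class of differentiable functions stable under all directional derivatives, hence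
   consisting of smooth functions. *)
Inductive smooth_alg : (V -> R) -> Prop :=
| SV_time g : smooth1 R g -> smooth_alg (fun z => g z.1)
| SV_coord g j : smooth1 R g -> smooth_alg (fun z => g (z.2 ord0 j))
| SV_add f g : smooth_alg f -> smooth_alg g -> smooth_alg (fun z => f z + g z)
| SV_mul f g : smooth_alg f -> smooth_alg g -> smooth_alg (fun z => f z * g z).

Lemma smooth_algD f : smooth_alg f ->
  (forall z, differentiable f z) /\ forall v, smooth_alg ('D_v f).
Proof.
elim=> {f} [g sg|g j sg|f g Sf [df Df] Sg [dg Dg]|f g Sf [df Df] Sg [dg Dg]].
- have dg x : differentiable g x by apply/derivable1_diffP; exact: (sg 0).
  split=> [z|v].
    apply: (@differentiable_comp _ _ _ _ (fun z : V => z.1) g) => //.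
    exact: differentiable_fst_rV.
  rewrite (_ : 'D_v _ = fun z => v.1 * derive1 g z.1).
    by apply: SV_mul; [exact: (SV_time (fun _ => v.1) (smooth1_cst _ _))|exact/SV_time/smooth1_derive1].
  apply/funext => z; rewrite derive_line.
  have dgz : is_derive (v.1 * 0 + z.1) 1 g (derive1 g z.1).
    by rewrite mulr0 add0r; exact: smooth1_is_derive.
  have [_ <-] := is_derive_comp_affine _ _ _ _ _ _ dgz.
  rewrite -derive1E; apply: (congr1 (fun F : R -> R => derive1 F 0)).
  by apply/funext => h /=; rewrite /GRing.scale /= mulrC.
- have dg x : differentiable g x by apply/derivable1_diffP; exact: (sg 0).
  split=> [z|v].
    apply: (@differentiable_comp _ _ _ _ (fun z : V => z.2 ord0 j) g) => //.
    apply: (@differentiable_comp _ _ _ _ (fun z : V => z.2) (fun x => x ord0 j)) => //.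
      exact: differentiable_snd_rV.
    exact: differentiable_coord.
  rewrite (_ : 'D_v _ = fun z => v.2 ord0 j * derive1 g (z.2 ord0 j)).
    by apply: SV_mul; [exact: (SV_time (fun _ => v.2 ord0 j) (smooth1_cst _ _))|exact/SV_coord/smooth1_derive1].
  apply/funext => z; rewrite derive_line.
  have dgz : is_derive (v.2 ord0 j * 0 + z.2 ord0 j) 1 g (derive1 g (z.2 ord0 j)).
    by rewrite mulr0 add0r; exact: smooth1_is_derive.
  have [_ <-] := is_derive_comp_affine _ _ _ _ _ _ dgz.
  rewrite -derive1E; apply: (congr1 (fun F : R -> R => derive1 F 0)).
  by apply/funext => h /=; rewrite !mxE mulrC.
- split=> [z|v]; first exact: differentiableD.
  rewrite (_ : 'D_v _ = fun z => 'D_v f z + 'D_v g z); first exact: SV_add.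
  by apply/funext => z; rewrite (@deriveD _ _ _ f g)//; exact: diff_derivable.
- split=> [z|v]; first exact: differentiableM.
  rewrite (_ : 'D_v _ = fun z => f z * 'D_v g z + g z * 'D_v f z).
    by apply: SV_add; exact: SV_mul.
  by apply/funext => z; rewrite (@deriveM _ _ f g)//; exact: diff_derivable.
Qed.

Lemma smooth_algP f : smooth_alg f -> smooth f.
Proof.
move=> Sf vs; suff /smooth_algD[] : smooth_alg (Defs.iterD vs f) by [].
by elim: vs => //= v vs /smooth_algD[_].
Qed.

Implicit Types (h : R -> R) (k : 'I_n -> R -> R).

Definition prod_fun k (x : 'rV[R]_n) : R := \prod_(j < n) k j (x ord0 j).

Definition prod_test h k (t : R) (x : 'rV[R]_n) : R := h t * prod_fun k x.

Lemma smooth_prod_test h k : smooth1 R h -> (forall j, smooth1 R (k j)) ->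
  smooth (uncurry (prod_test h k)).
Proof.
move=> sh sk; apply: smooth_algP; apply: SV_mul; first exact: SV_time.
rewrite /prod_fun; elim: (index_enum _) => [|j s ih].
  under eq_fun do rewrite big_nil; exact: (SV_time (fun _ => 1) (smooth1_cst _ _)).
by under eq_fun do rewrite big_cons; apply: SV_mul => //; exact: (SV_coord _ j).
Qed.

Lemma enorm_le_box (L : R) (x : 'rV[R]_n) : (forall j, `|x ord0 j| <= L) ->
  enorm x <= Num.sqrt (\sum_(j < n) L ^+ 2).
Proof.
move=> xL; rewrite ler_wsqrtr//; apply: ler_sum => j _.
by rewrite -real_normK ?num_real// ler_pXn2r// ?nnegrE ?normr_ge0// (le_trans _ (xL j)).
Qed.

Lemma coord_le_enorm (x : 'rV[R]_n) j : `|x ord0 j| <= enorm x.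
Proof.
rewrite -sqrtr_sqr ler_wsqrtr// (bigD1 j)//= lerDl.
by apply: sumr_ge0 => i _; exact: sqr_ge0.
Qed.

Lemma test_fun_prod (T : \bar R) h k (a b L : R) : smooth1 R h -> (forall j, smooth1 R (k j)) ->
  0 < a -> a <= b -> (b%:E < T)%E -> (forall t, h t != 0 -> a <= t <= b) ->
  (forall j y, k j y != 0 -> `|y| <= L) -> test_fun T (prod_test h k).
Proof.
move=> sh sk a0 ab bT hab kL; split; first exact: smooth_prod_test.
exists a, b, (Num.sqrt (\sum_(j < n) L ^+ 2)); split => // t x.
rewrite mulf_eq0 negb_or => /andP[/hab/andP[-> ->] /prodf_neq0 kx]; split => //.
by apply: enorm_le_box => j; apply: (kL j); exact: kx.
Qed.

Lemma derive_time_prod h k : smooth1 R h ->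
  'D_(e_t R n) (uncurry (prod_test h k)) = uncurry (prod_test (derive1 h) k).
Proof.
move=> sh; apply/funext => -[t x]; rewrite derive_line /uncurry /prod_test /=.
have dh : is_derive (1 * 0 + t) 1 h (derive1 h t).
  by rewrite mul1r add0r; exact: smooth1_is_derive.
have {}dh := is_derive_comp_affine _ _ _ _ _ _ dh.
have [_ E] := is_deriveZ (prod_fun k x) dh.
rewrite [X in derive1 X _](_ : _ = prod_fun k x \*: (fun y : R => h (1 * y + t))).
  by rewrite derive1E E mul1r mulrC.
by apply/funext => s /=; rewrite scaler0 add0r /GRing.scale /= mulr1 mulrC mul1r.
Qed.

Lemma derive_space_prod h k i : smooth1 R (k i) ->
  'D_(e_x R i) (uncurry (prod_test h k)) =
  uncurry (prod_test h (fun j => if j == i then derive1 (k j) else k j)).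
Proof.
move=> sk; apply/funext => -[t x]; rewrite derive_line /uncurry /prod_test /=.
pose c := h t * \prod_(j < n | j != i) k j (x ord0 j).
have dk : is_derive (1 * 0 + x ord0 i) 1 (k i) (derive1 (k i) (x ord0 i)).
  by rewrite mul1r add0r; exact: smooth1_is_derive.
have {}dk := is_derive_comp_affine _ _ _ _ _ _ dk.
have [_] := is_deriveZ c dk.
rewrite mul1r /GRing.scale /= => E.
rewrite /prod_fun (bigD1 i)//= eqxx.
rewrite (eq_bigr (fun j => k j (x ord0 j))); last by move=> j /negbTE ->.
rewrite [X in derive1 X _](_ : _ = c \*: (fun y : R => k i (1 * y + x ord0 i))).
  by rewrite derive1E E /c mulrAC -mulrA.
apply/funext => s /=; rewrite (bigD1 i)//= !mxE /= !eqxx mulr1 mulrCA mulrC.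
rewrite (eq_bigr (fun j => k j (x ord0 j))); last first.
  by move=> j /negbTE ji; rewrite !mxE ji andbF mulr0 add0r.
by rewrite mulr0 add0r mul1r.
Qed.

Lemma dt_prod h k t x : smooth1 R h -> dt (prod_test h k) t x = prod_test (derive1 h) k t x.
Proof. by move=> sh; have := congr1 (fun F => F (t, x)) (derive_time_prod h k sh). Qed.

Definition prod_laplace k (x : 'rV[R]_n) : R :=
  \sum_(i < n) prod_fun (fun j => if j == i then derive1 (derive1 (k j)) else k j) x.

Lemma box_prod h k t x : smooth1 R h -> (forall j, smooth1 R (k j)) ->
  box (prod_test h k) t x = derive1 (derive1 h) t * prod_fun k x - h t * prod_laplace k x.
Proof.
move=> sh sk; rewrite /box derive_time_prod//.
congr (_ - _).
  exact: (congr1 (fun F => F (t, x)) (derive_time_prod _ k (smooth1_derive1 _ _ sh))).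
rewrite /prod_laplace mulr_sumr; apply: eq_bigr => i _.
rewrite derive_space_prod//.
set k' := fun j : 'I_n => _.
have sk' : smooth1 R (k' i) by rewrite /k' eqxx; exact: smooth1_derive1.
rewrite (congr1 (fun F => F (t, x)) (derive_space_prod h k' i sk')).
rewrite /uncurry /prod_test /k' /=; congr (_ * prod_fun _ _).
by apply/funext => j; case: eqP.
Qed.

(** One factor of the cut-off of [e^{x.w}]; cutting each coordinate separately keeps the test
    function a product. *)
Definition exp_plateau (L w y : R) : R := plateau R L y * expR (w * y).

Lemma smooth1_exp_plateau L w : smooth1 R (exp_plateau L w).
Proof.
apply: smooth1M; first exact: smooth1_plateau.
have := smooth1_affine R _ w 0 (smooth1_expR R).
by under eq_fun do rewrite addr0.
Qed.

Lemma exp_plateauE L w y : `|y| <= L -> exp_plateau L w y = expR (w * y).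
Proof. by move=> yL; rewrite /exp_plateau plateau_eq1// mul1r. Qed.

Lemma exp_plateau_neq0 L w y : exp_plateau L w y != 0 -> `|y| <= L + 1.
Proof. by rewrite mulf_eq0 negb_or => /andP[/plateau_neq0]. Qed.

Lemma exp_plateau_ge0 L w y : 0 <= exp_plateau L w y.
Proof. by rewrite mulr_ge0 ?plateau_ge0// expR_ge0. Qed.

(** The conclusion reproduces the hypothesis on [f] with [c * w] in place of [c], so the lemma can
    be applied twice. The open interval reflects that differentiation is local. *)
Lemma derive1_near_exp (f : R -> R) (L c w y : R) :
  (forall y, `|y| < L -> f y = c * expR (w * y)) -> `|y| < L ->
  derive1 f y = c * w * expR (w * y).
Proof.
move=> fE yL.
have nE : \near y, f y = c * expR (w * y).
  near=> z; apply: fE.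
  rewrite -[z](subrK y) (le_lt_trans (ler_normD _ _))// -ltrBrDr distrC.
  by near: z; apply: nbhsx_ballx; rewrite subr_gt0.
rewrite derive1E (near_eq_derive _ nE).
have de : is_derive (w * y + 0) 1 (@expR R) (expR (w * y)).
  by rewrite addr0; exact: is_derive_expR.
have {}de := is_derive_comp_affine _ _ _ _ _ _ de.
have [_] := is_deriveZ c de; rewrite /GRing.scale /= mulrA => <-.
rewrite -!derive1E; apply: (congr1 (fun F : R -> R => derive1 F y)).
by apply/funext => z /=; rewrite addr0.
Unshelve. all: by end_near. Qed.

Lemma derive2_exp_plateau L w y : `|y| < L ->
  derive1 (derive1 (exp_plateau L w)) y = w ^+ 2 * exp_plateau L w y.
Proof.
move=> yL; rewrite exp_plateauE ?(ltW yL)// expr2.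
apply: (derive1_near_exp _ L) => // {yL}y yL.
rewrite -[X in X * expR _]mul1r.
by apply: (derive1_near_exp _ L) => // {yL}y yL; rewrite exp_plateauE ?(ltW yL)// mul1r.
Qed.

(** [e^{x.w}] is an eigenfunction of the Laplacian with eigenvalue [|w|^2]; the relation survives
    the cut-off wherever every factor is inside its plateau. *)
Lemma prod_laplace_exp L (w : 'I_n -> R) (x : 'rV[R]_n) : (forall j, `|x ord0 j| < L) ->
  prod_laplace (fun j => exp_plateau L (w j)) x =
  (\sum_(i < n) w i ^+ 2) * prod_fun (fun j => exp_plateau L (w j)) x.
Proof.
move=> xL; rewrite /prod_laplace mulr_suml; apply: eq_bigr => i _.
rewrite /prod_fun [in LHS](bigD1 i)//= [in RHS](bigD1 i)//= eqxx derive2_exp_plateau// -mulrA.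
by congr (_ * (_ * _)); apply: eq_bigr => j /negbTE ->.
Qed.

End ProductTestFunctions.

(** * Integrals at a fixed time *)

Section Pairings.
Variables (R : realType) (n : nat).
Local Notation E := (borel_rV R n).
Local Notation leb := (lebesgue_rV R n).
Implicit Types (phi X : E -> R).

Definition Rn_mfun phi := measurable_fun setT (phi : E -> R).
Definition Rn_integrable phi := leb.-integrable setT (EFin \o phi).

Lemma Rn_integrableP phi : Rn_mfun phi ->
  (\int[leb]_x (`|phi x|)%:E < +oo)%E <-> Rn_integrable phi.
Proof.
move=> mphi; split=> [phioo|/integrableP[]//].
by apply/integrableP; split => //; exact/measurable_EFinP.
Qed.

Lemma Rn_integrable_mfun phi : Rn_integrable phi -> Rn_mfun phi.
Proof. by move=> /measurable_int/measurable_EFinP. Qed.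

Lemma iint_abs phi : Rn_mfun phi -> iint (fun x => `|phi x|%:E) = (\int[leb]_x (`|phi x|)%:E)%E.
Proof.
move=> mphi; rewrite iintE//.
by apply/measurable_EFinP; exact: measurableT_comp.
Qed.

Lemma inL_mfun r phi : inL r phi -> Rn_mfun phi.
Proof. by case=> /Rn_measurableP. Qed.

Lemma measurable_abs_powR r phi : Rn_mfun phi -> Rn_mfun (fun x => `|phi x| `^ r).
Proof.
move=> mphi.
have := @measurableT_comp _ _ _ _ _ _ _ _ _ (@measurable_powR R r) (measurableT_comp (@normr_measurable R setT) mphi).
exact.
Qed.

Lemma inL_integrable r phi : inL r phi -> Rn_integrable (fun x => `|phi x| `^ r).
Proof.
move=> [/Rn_measurableP mphi phioo].
have mr := measurable_abs_powR r phi mphi.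
apply/Rn_integrableP => //; move: phioo.
under [X in iint X]eq_fun do rewrite -[X in X%:E]ger0_norm ?powR_ge0//.
by rewrite iint_abs.
Qed.

Lemma inL1_integrable phi : inL 1 phi -> Rn_integrable phi.
Proof.
move=> phiL; have mphi := inL_mfun 1 phi phiL; apply/Rn_integrableP => //.
move: phiL => [_]; under [X in iint X]eq_fun do rewrite powRr1//.
by rewrite iint_abs.
Qed.

Lemma Rn_integrableM phi X K : Rn_integrable phi -> Rn_mfun X -> (forall x, `|X x| <= K) ->
  Rn_integrable (fun x => phi x * X x).
Proof.
move=> iphi mX XK; have mphi := Rn_integrable_mfun _ iphi.
apply: (@le_integrable _ E R leb setT _ _ (fun x => (K * phi x)%:E)) => //.
- by apply/measurable_EFinP; exact: measurable_funM.
- by move=> x _; rewrite lee_fin !normrM mulrC ler_wpM2r// (le_trans (XK x))// ler_norm.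
- by have := integrableZl measurableT K iphi.
Qed.

Lemma Rn_RintegralD phi psi : Rn_integrable phi -> Rn_integrable psi ->
  Rintegral leb setT (fun x => phi x + psi x) = Rintegral leb setT phi + Rintegral leb setT psi.
Proof. by move=> i1 i2; rewrite RintegralD. Qed.

Lemma Rn_integrableD phi psi : Rn_integrable phi -> Rn_integrable psi ->
  Rn_integrable (fun x => phi x + psi x).
Proof. by move=> i1 i2; have := integrableD measurableT i1 i2. Qed.

Lemma Rn_integrableZ k phi : Rn_integrable phi -> Rn_integrable (fun x => k * phi x).
Proof. by move=> i1; have := integrableZl measurableT k i1. Qed.

Lemma Rn_integrableB phi psi : Rn_integrable phi -> Rn_integrable psi ->
  Rn_integrable (fun x => phi x - psi x).
Proof. by move=> i1 i2; have := integrableB measurableT i1 i2. Qed.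

Lemma Rn_integrable_norm phi : Rn_integrable phi -> Rn_integrable (fun x => `|phi x|).
Proof. exact: integrable_norm. Qed.

Lemma Rn_integral_lt (phi : E -> R) e : Rn_integrable phi -> (forall x, 0 <= phi x) ->
  (iint (fun x => (phi x)%:E) < e%:E)%E <-> Rintegral leb setT phi < e.
Proof.
move=> iphi phi0; rewrite iintE//; last exact: measurable_int iphi.
by rewrite /Rintegral -lte_fin fineK//; exact: integrable_fin_num.
Qed.

Lemma le_Rn_integral phi psi : Rn_integrable phi -> Rn_integrable psi ->
  (forall x, phi x <= psi x) -> Rintegral leb setT phi <= Rintegral leb setT psi.
Proof. by move=> i1 i2 h; apply: le_Rintegral => // x _. Qed.

(** Continuity relative to [I], kept in epsilon-delta form because it is used both inside the time
    interval and at its endpoint 0. *)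
Definition econt (I : set R) (A : R -> R) := forall t, I t -> forall e : R, 0 < e ->
  exists2 d : R, 0 < d & forall s, I s -> `|s - t| < d -> `|A s - A t| < e.

Lemma econt_cont_on (I : set R) A (l r : R) : econt I A -> (forall t, l < t -> t < r -> I t) ->
  cont_on R l r A.
Proof.
move=> eA lrI t lt tr; apply/cvgrPdist_le => e e0.
have [d d0 hd] := eA t (lrI t lt tr) e e0.
apply/nbhs_ballP; exists (Num.min d (Num.min (t - l) (r - t))) => /=.
  by rewrite !lt_min d0 !subr_gt0 lt tr.
move=> s /=; rewrite /ball /= !lt_min => /and3P[sd sl sr].
have ls : l < s by move: sl; rewrite ltr_distlC => /andP[+ _]; lra.
have {}sr : s < r by move: sr; rewrite ltr_distlC => /andP[_ +]; lra.
by rewrite distrC ltW// hd//; [exact: lrI|rewrite distrC].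
Qed.

Lemma econt_pairing (I : set R) (u : R -> E -> R) X K : contL 1 I u -> Rn_mfun X ->
  (forall x, `|X x| <= K) -> econt I (fun s => Rintegral leb setT (fun x => u s x * X x)).
Proof.
move=> [uL uc] mX XK t It e e0.
have K10 : 0 < `|K| + 1 by rewrite ltr_wpDl.
have [d d0 hd] := uc t It (e / (`|K| + 1)) (divr_gt0 e0 K10).
exists d => // s Is sd; have {hd} := hd s Is sd.
have is_ := inL1_integrable _ (uL s Is); have it := inL1_integrable _ (uL t It).
have ist := Rn_integrable_norm _ (Rn_integrableB _ _ is_ it).
under [X in iint X]eq_fun do rewrite powRr1//.
move/(Rn_integral_lt _ _ ist) => /(_ (fun _ => normr_ge0 _)) hD.
rewrite -RintegralB//; [|exact: Rn_integrableM mX XK|exact: Rn_integrableM mX XK].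
under eq_Rintegral do rewrite -mulrBl.
have iB := Rn_integrableB _ _ is_ it.
apply: (le_lt_trans (le_normr_Rintegral _ _)) => //.
  exact: Rn_integrableM mX XK.
apply: (@le_lt_trans _ _ (Rintegral leb setT (fun x => K * `|u s x - u t x|))).
  apply: le_Rn_integral; first by apply: Rn_integrable_norm; exact: Rn_integrableM mX XK.
    exact: Rn_integrableZ.
  by move=> x; rewrite normrM mulrC ler_wpM2r.
rewrite RintegralZl//.
apply: (@le_lt_trans _ _ ((`|K| + 1) * Rintegral leb setT (fun x => `|u s x - u t x|))).
  by rewrite ler_wpM2r// ?Rintegral_ge0// (le_trans (ler_norm K))// lerDl.
by rewrite mulrC -ltr_pdivlMr.
Qed.

(** With [h] defined by [(1 + h)^r = 1 + d], either [y <= h x] and [x + y <= (1 + h) x], or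
    [x < y / h] and [x + y <= (1/h + 1) y]. A leading factor as close to 1 as desired gives
    continuity of r-th power integrals without Minkowski's inequality. *)
Lemma powR_add_le (r d : R) : 1 <= r -> 0 < d -> exists2 C : R, 0 <= C &
  forall x y : R, 0 <= x -> 0 <= y -> (x + y) `^ r <= (1 + d) * x `^ r + C * y `^ r.
Proof.
move=> r1 d0; have r0 : 0 < r by exact: lt_le_trans r1.
pose h := (1 + d) `^ r^-1 - 1.
have h1r : (1 + h) `^ r = 1 + d.
  by rewrite addrC subrK -powRrM mulVf ?gt_eqF// powRr1// addr_ge0// ltW.
have h0 : 0 < h.
  have : 1 `^ r^-1 < (1 + d) `^ r^-1.
    by apply: gt0_ltr_powR; rewrite ?invr_gt0 ?nnegrE ?in_itv /= ?andbT ?addr_ge0 ?(ltW d0)// ltrDl.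
  by rewrite powR1 /= subr_gt0.
exists ((h^-1 + 1) `^ r) => [|x y x0 y0]; first exact: powR_ge0.
have [yx|xy] := leP y (h * x).
  apply: (@le_trans _ _ ((1 + d) * x `^ r)); last by rewrite lerDl mulr_ge0 ?powR_ge0.
  have h10 : 0 <= 1 + h by rewrite addr_ge0// ltW.
  rewrite -h1r -powRM//; apply: ge0_ler_powR.
  - exact: ltW.
  - by rewrite nnegrE addr_ge0.
  - by rewrite nnegrE mulr_ge0.
  - by rewrite mulrDl mul1r lerD2l.
apply: (@le_trans _ _ ((h^-1 + 1) `^ r * y `^ r)); last first.
  by rewrite lerDr mulr_ge0 ?powR_ge0// addr_ge0// ltW.
have h10 : 0 <= h^-1 + 1 by rewrite addr_ge0// invr_ge0 ltW.
rewrite -powRM//; apply: ge0_ler_powR.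
- exact: ltW.
- by rewrite nnegrE addr_ge0.
- by rewrite nnegrE mulr_ge0.
- by rewrite mulrDl mul1r lerD2r ler_pdivlMl// ltW.
Qed.

(** Each of [v s] and [v t] is the other plus a difference that is small in L^r, so [powR_add_le]
    applies in both directions. *)
Lemma econt_pow_pairing (I : set R) (r : R) (v : R -> E -> R) X K : 1 <= r -> contL r I v -> Rn_mfun X ->
  (forall x, 0 <= X x <= K) ->
  econt I (fun s => Rintegral leb setT (fun x => `|v s x| `^ r * X x)).
Proof.
have key (a b dl Y e : R) : 0 <= b -> 0 < dl -> dl <= 1 -> dl * (2 * b + 1) <= e / 2 ->
    Y <= 1 -> Y <= e / 4 -> 0 < e -> a <= (1 + dl) * b + Y -> b <= (1 + dl) * a + Y -> `|a - b| < e.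
  move=> b0 dl0 dl1 dle Y1 Ye e0 h1 h2.
  have h3 : dl * b <= b by rewrite ler_piMl.
  have h4 : dl * a <= dl * (2 * b + 1) by rewrite ler_wpM2l ?(ltW dl0)//; lra.
  have h5 : dl * b <= dl * (2 * b + 1) by rewrite ler_wpM2l ?(ltW dl0)//; lra.
  by rewrite ltr_norml; apply/andP; split; lra.
move=> r1 [vL vc] mX X0K t It e e0.
have XK x : `|X x| <= K by case/andP: (X0K x) => h1 h2; rewrite ger0_norm.
have K0 : 0 <= K by exact: le_trans (normr_ge0 _) (XK 0).
pose N s := Rintegral leb setT (fun x => `|v s x| `^ r * X x).
have iN s : I s -> Rn_integrable (fun x => `|v s x| `^ r * X x).
  by move=> Is; apply: Rn_integrableM mX XK; exact: inL_integrable (vL s Is).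
have N0 s : 0 <= N s.
  by apply: Rintegral_ge0 => x _; rewrite mulr_ge0 ?powR_ge0//; case/andP: (X0K x).
(* With [del <= 1] and a remainder at most 1, [N s <= 2 * N t + 1]; hence [del] is chosen to make
   [del * (2 * N t + 1) <= e / 2], which bounds the relative error in both directions. *)
pose del := Num.min 1 (e / (4 * (N t + 1))).
have Nt1 : 0 < 4 * (N t + 1) by rewrite mulr_gt0// ltr_wpDl.
have del0 : 0 < del by rewrite lt_min ltr01 divr_gt0.
have del1 : del <= 1 by rewrite ge_min lexx.
have dele : del * (2 * N t + 1) <= e / 2.
  apply: (@le_trans _ _ (e / (4 * (N t + 1)) * (2 * N t + 1))).
    by rewrite ler_wpM2r ?ge_min ?lexx ?orbT// addr_ge0// mulr_ge0.
  rewrite mulrAC ler_pdivrMr// -mulrA ler_pM2l//.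
  by have := N0 t; lra.
have [C C0 hC] := powR_add_le r del r1 del0.
pose m := Num.min 1 (e / 4).
have m0 : 0 < m by rewrite lt_min ltr01 divr_gt0.
have CK : 0 < C * K + 1 by rewrite ltr_wpDl// mulr_ge0.
have [d d0 hd] := vc t It (m / (C * K + 1)) (divr_gt0 m0 CK).
exists d => // s Is sd; have {hd} := hd s Is sd.
have mv q : I q -> Rn_mfun (v q) by move=> Iq; exact: inL_mfun (vL q Iq).
move=> hs; have iD : Rn_integrable (fun x => `|v s x - v t x| `^ r).
  apply: (@inL_integrable r (fun x => v s x - v t x)); split; last by rewrite (lt_le_trans hs)// leey.
  by apply/Rn_measurableP; apply: measurable_funB; exact: mv.
move: hs => /(Rn_integral_lt _ _ iD) => /(_ (fun _ => powR_ge0 _ _)) hD.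
pose D := Rintegral leb setT (fun x => `|v s x - v t x| `^ r).
have D0 : 0 <= D by apply: Rintegral_ge0 => x _; exact: powR_ge0.
have main s1 s2 : I s1 -> I s2 -> (forall x, `|v s1 x| <= `|v s2 x| + `|v s x - v t x|) ->
    N s1 <= (1 + del) * N s2 + C * K * D.
  move=> I1 I2 h12.
  have -> : (1 + del) * N s2 = Rintegral leb setT (fun x => (1 + del) * (`|v s2 x| `^ r * X x)).
    by rewrite RintegralZl//; exact: iN.
  have -> : C * K * D = Rintegral leb setT (fun x => C * K * `|v s x - v t x| `^ r).
    by rewrite RintegralZl.
  rewrite -Rn_RintegralD; [|exact/Rn_integrableZ/iN|exact: Rn_integrableZ].
  apply: le_Rn_integral; first exact: iN.
    by apply: Rn_integrableD; [exact/Rn_integrableZ/iN|exact: Rn_integrableZ].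
  move=> x; case/andP: (X0K x) => X0 X1.
  apply: (@le_trans _ _ (((1 + del) * `|v s2 x| `^ r + C * `|v s x - v t x| `^ r) * X x)).
    rewrite ler_wpM2r//; apply: le_trans (hC _ _ _ _) => //.
    by apply: ge0_ler_powR; rewrite ?nnegrE ?addr_ge0// (le_trans _ r1).
  rewrite mulrDl mulrA lerD2l -!mulrA ler_wpM2l// mulrC ler_wpM2r// powR_ge0//.
have CKD : C * K * D <= m.
  apply: (@le_trans _ _ ((C * K + 1) * D)); first by rewrite ler_wpM2r// lerDl.
  by rewrite -ler_pdivlMl// mulrC ltW.
have h1 : N s <= (1 + del) * N t + C * K * D.
  apply: main => // x; rewrite -{1}[v s x](subrK (v t x)) addrC.
  exact: ler_normD.
have h2 : N t <= (1 + del) * N s + C * K * D.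
  apply: main => // x; rewrite -{1}[v t x](subrK (v s x)) addrC (le_trans (ler_normD _ _))//.
  by rewrite lerD2l distrC.
have m1 : m <= 1 by rewrite ge_min lexx.
have me : m <= e / 4 by rewrite ge_min lexx orbT.
rewrite -/(N s) -/(N t).
exact: (key _ _ del _ _ (N0 t) del0 del1 dele (le_trans CKD m1) (le_trans CKD me) e0 h1 h2).
Qed.

Lemma ae_cone (r : R) phi : Rn_mfun phi ->
  iint (fun x : E => (if r < enorm x then `|phi x| else 0)%:E) = 0%E ->
  {ae leb, forall x : E, r < enorm x -> phi x = 0}.
Proof.
move=> mphi h.
have men : Rn_mfun (fun x : E => enorm x).
  apply: (measurableT_comp (f := @Num.sqrt R)).
    by apply: continuous_measurable_fun; exact: sqrt_continuous.
  apply: measurable_sum => i; apply: measurable_funX; exact: measurable_coord.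
have mp : Rn_mfun (fun x : E => if r < enorm x then phi x else 0).
  by apply: measurable_fun_ifT => //; exact: measurable_fun_ltr.
have : (\int[leb]_x `|(if r < enorm x then phi x else 0)%:E| = 0)%E.
  rewrite -[RHS]h -iint_abs//; congr iint; apply/funext => x.
  by case: ifP => // _; rewrite normr0.
have mEp : measurable_fun setT (fun x : E => (if r < enorm x then phi x else 0)%:E).
  exact/measurable_EFinP.
move/(ae_eq_integral_abs _ measurableT mEp) => ae0.
apply: filterS ae0 => x /(_ Logic.I) /= [] + rx.
by rewrite rx.
Qed.

Lemma ae_eq_Rintegral phi psi : Rn_mfun phi -> Rn_integrable psi ->
  {ae leb, forall x : E, phi x = psi x} ->
  Rn_integrable phi /\ Rintegral leb setT phi = Rintegral leb setT psi.
Proof.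
move=> mphi ipsi h; have mpsi := Rn_integrable_mfun _ ipsi.
split.
  apply/Rn_integrableP => //.
  rewrite (_ : (\int[leb]_x `|phi x|%:E = \int[leb]_x `|psi x|%:E)%E); first by apply/Rn_integrableP.
  apply: ae_eq_integral => //; [by apply/measurable_EFinP; exact: measurableT_comp|by apply/measurable_EFinP; exact: measurableT_comp|].
  by apply: filterS h => x /= -> _.
rewrite /Rintegral; congr fine; apply: ae_eq_integral => //; [exact/measurable_EFinP|exact/measurable_EFinP|].
by apply: filterS h => x /= -> _.
Qed.

Lemma mfun_prod_fun (k : 'I_n -> R -> R) : (forall j, smooth1 R (k j)) -> Rn_mfun (prod_fun R n k).
Proof.
move=> sk; apply: measurable_prod => j _.
apply: (measurableT_comp (f := k j)); last exact: measurable_coord.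
by apply: continuous_measurable_fun; exact: smooth1_continuous.
Qed.

Lemma mfun_prod_laplace (k : 'I_n -> R -> R) : (forall j, smooth1 R (k j)) -> Rn_mfun (prod_laplace R n k).
Proof.
move=> sk; apply: measurable_sum => i; apply: mfun_prod_fun => j.
by case: ifP => // _; do 2 apply: smooth1_derive1.
Qed.

End Pairings.

(** * Moments against cut-off exponentials *)

Section Moments.
Variables (R : realType) (n : nat).
Local Notation E := (borel_rV R n).
Local Notation leb := (lebesgue_rV R n).
Local Notation mu := (@lebesgue_measure R).

Definition exp_cut (L : R) (w : 'I_n -> R) : E -> R := prod_fun R n (fun j => exp_plateau R L (w j)).

Lemma exp_cut_ge0 L w x : 0 <= exp_cut L w x.
Proof. by apply: prodr_ge0 => j _; exact: exp_plateau_ge0. Qed.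

Lemma exp_cut_bounded L w : 0 <= L -> exists K, forall x, 0 <= exp_cut L w x <= K.
Proof.
move=> L0; exists (\prod_(j < n) expR (`|w j| * (L + 1))) => x; rewrite exp_cut_ge0 /=.
apply: ler_prod => j _; rewrite exp_plateau_ge0 /=.
have [->|/exp_plateau_neq0 xL] := eqVneq (exp_plateau R L (w j) (x ord0 j)) 0; first exact: expR_ge0.
apply: (@le_trans _ _ (expR (w j * x ord0 j))).
  by rewrite ler_piMl ?expR_ge0 ?plateau_le1.
by rewrite ler_expR (le_trans (ler_norm _))// normrM ler_wpM2l.
Qed.

Lemma mfun_exp_cut L w : Rn_mfun R n (exp_cut L w).
Proof. by apply: mfun_prod_fun => j; exact: smooth1_exp_plateau. Qed.

Lemma exp_cutE L w (x : E) : enorm x <= L -> exp_cut L w x = expR (\sum_(j < n) w j * x ord0 j).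
Proof.
move=> xL; rewrite expR_sum; apply: eq_bigr => j _; apply: exp_plateauE.
exact: le_trans (coord_le_enorm _ _ _ _) xL.
Qed.

Definition moment (X : E -> R) (u : R -> E -> R) (s : R) : R :=
  Rintegral leb setT (fun x => u s x * X x).

Lemma tint_itv (T : \bar R) (F : R -> R) (s t : R) : 0 < s -> (t%:E < T)%E ->
  (forall x, 0 < x -> (x%:E < T)%E -> ~~ (s <= x <= t) -> F x = 0) ->
  tint T F = Rintegral mu `[s, t] F.
Proof.
move=> s0 tT F0; rewrite /tint Rintegral_mkcond [RHS]Rintegral_mkcond.
congr (Rintegral _ _ _); apply/funext => x; rewrite /patch.
have [xst|xst] := boolP (s <= x <= t).
  case/andP: (xst) => sx xt; rewrite mem_set; last first.
    by split; [exact: lt_le_trans sx|rewrite (le_lt_trans _ tT)// lee_fin].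
  by rewrite mem_set//= in_itv.
rewrite [in RHS]memNset//=; last by rewrite in_itv /=; exact/negP.
by case: ifPn => //; rewrite inE => -[x0 xT]; rewrite F0.
Qed.

Lemma derive1_support (h : R -> R) (s t : R) : (forall x, h x != 0 -> s <= x <= t) ->
  forall x, derive1 h x != 0 -> s <= x <= t.
Proof.
move=> hst x; apply: contra_neqT; rewrite negb_and -!ltNge => xst.
have h0 y : ~~ (s <= y <= t) -> h y = 0 by apply: contraNeq => /hst.
case/orP: xst => xs.
  apply: (@derive1_local_cst R h 0 (s - x)); rewrite ?subr_gt0// => y.
  by rewrite ltr_distl => /andP[_]; rewrite subrKC => ys; rewrite h0// negb_and -ltNge ys.
apply: (@derive1_local_cst R h 0 (x - t)); rewrite ?subr_gt0// => y.
by rewrite ltr_distl => /andP[+ _]; rewrite subKr => ys; rewrite h0// negb_and -!ltNge ys orbT.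
Qed.

Lemma pairing_prod_test (phi : E -> R) (h : R -> R) k t K : Rn_integrable R n phi ->
  Rn_mfun R n (prod_fun R n k) -> (forall x, `|prod_fun R n k x| <= K) ->
  pairing phi (prod_test R n h k t) = h t * Rintegral leb setT (fun x => phi x * prod_fun R n k x).
Proof.
move=> iphi mk kK; have iX := Rn_integrableM R n _ _ _ iphi mk kK.
rewrite /pairing iintRE; last first.
  under eq_fun do rewrite /= /prod_test mulrCA.
  exact: Rn_integrableZ.
by rewrite -RintegralZl//; apply: eq_Rintegral => x _; rewrite /prod_test mulrCA.
Qed.

Lemma iintR0 : iintR (fun _ : 'rV[R]_n => 0 : R) = 0.
Proof.
rewrite iintRE; last exact: integrable0.
by rewrite /Rintegral integral0.
Qed.

(** * Time derivatives of the moments for one wave equation *)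

Section Wave.
Variables (T : \bar R) (u ut F : R -> E -> R) (w : 'I_n -> R) (tau : R).
Hypotheses (tau0 : 0 < tau) (tauT : (tau%:E < T)%E).
Hypotheses (cu : contL 1 (Ico0 T) u) (cut : contL 1 (Ico0 T) ut).
Hypothesis dtu : is_dt T u ut.

(** Before time [tau] the support [|x| <= t + 1] lies strictly inside the plateau; strictness makes
    the derivatives of the cut-offs vanish there too. *)
Let L := tau + 2.
Let k (j : 'I_n) := exp_plateau R L (w j).
Let X := exp_cut L w.
Let lam := \sum_(i < n) w i ^+ 2.

Let sk j : smooth1 R (k j). Proof. exact: smooth1_exp_plateau. Qed.
Let mX : Rn_mfun R n X. Proof. exact: mfun_exp_cut. Qed.
Let L0 : 0 <= L. Proof. by rewrite /L addr_ge0// ltW. Qed.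
Let XK : exists K, forall x, `|X x| <= K.
Proof.
have [K hK] := exp_cut_bounded L w L0; exists K => x.
by case/andP: (hK x) => h1 h2; rewrite ger0_norm.
Qed.

Let Ico_tau t : 0 < t -> t < tau -> Ico0 T t.
Proof. by move=> t0 tt; split; [exact: ltW|rewrite (lt_trans _ tauT)// lte_fin]. Qed.

Lemma econt_moment (v : R -> E -> R) : contL 1 (Ico0 T) v -> econt R (Ico0 T) (moment X v).
Proof. by move=> cv; have [K hK] := XK; exact: econt_pairing cv mX hK. Qed.

Lemma cont_on_moment (v : R -> E -> R) : contL 1 (Ico0 T) v -> cont_on R 0 tau (moment X v).
Proof. by move=> cv; apply: econt_cont_on (econt_moment v cv) Ico_tau. Qed.

Let testX h s t : smooth1 R h -> 0 < s -> s <= t -> t < tau ->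
  (forall x, h x != 0 -> s <= x <= t) -> test_fun T (prod_test R n h k).
Proof.
move=> sh s0 st tt hst; apply: (@test_fun_prod R n T h k s t (L + 1)) => //.
  by rewrite (lt_trans _ tauT)// lte_fin.
by move=> j y; exact: exp_plateau_neq0.
Qed.

Let pairingX (v : R -> E -> R) h t : contL 1 (Ico0 T) v -> Ico0 T t ->
  pairing (v t) (prod_test R n h k t) = h t * moment X v t.
Proof.
move=> [vL _] It; have [K hK] := XK.
by apply: (@pairing_prod_test _ _ _ _ K) => //; exact: inL1_integrable (vL t It).
Qed.

(** Tested with [h(t) X(x)], the weak time derivative of [u] separates into spatial moments; [h] and
    [h'] vanish off [[s, t]], which turns integrals over [(0, T)] into integrals over [[s, t]]. *)
Lemma weak_derivative_moment : weak_derivative R 0 tau (moment X u) (moment X ut).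
Proof.
move=> h s t sh s0 st tt hst.
have tT : (t%:E < T)%E by rewrite (lt_trans _ tauT)// lte_fin.
have := dtu _ (testX h s t sh s0 st tt hst).
have Ico x : 0 < x -> (x%:E < T)%E -> Ico0 T x by move=> x0 xT; split => //; exact: ltW.
rewrite (@tint_itv T _ s t)//; last first.
  move=> x x0 xT xst.
  rewrite (_ : dt _ x = prod_test R n (derive1 h) k x); last by apply/funext => y; rewrite dt_prod.
  rewrite pairingX//; last exact: Ico.
  suff -> : derive1 h x = 0 by rewrite mul0r.
  by move: xst; apply: contraNeq; exact: derive1_support.
rewrite (@tint_itv T _ s t)//; last first.
  move=> x x0 xT xst; rewrite pairingX//; last exact: Ico.
  suff -> : h x = 0 by rewrite mul0r.
  by move: xst; apply: contraNeq => /hst.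
have Ist x : x \in `[s, t]%classic -> Ico0 T x.
  rewrite inE /= in_itv /= => /andP[sx xt]; apply: Ico; first exact: lt_le_trans sx.
  by rewrite (le_lt_trans _ tT)// lee_fin.
move=> E0; transitivity (Rintegral mu `[s, t] (fun r => pairing (u r) (dt (prod_test R n h k) r))).
  apply: eq_Rintegral => x xst.
  rewrite (_ : dt _ x = prod_test R n (derive1 h) k x); last by apply/funext => y; rewrite dt_prod.
  by rewrite pairingX//; exact: Ist.
rewrite E0; congr (- _); apply: eq_Rintegral => x xst.
by rewrite pairingX//; exact: Ist.
Qed.

Hypothesis iF : forall s, Ioo0 T s -> Rn_integrable R n (F s).
Hypothesis cN : cont_on R 0 tau (moment X F).
Hypothesis coneu : in_cone T u.
Hypothesis waveu : forall psi, test_fun T psi ->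
  tint T (fun s => pairing (F s) (psi s)) = tint T (fun s => pairing (u s) (box psi s)).

(** The Laplacian of the cut-off exponential equals [lam * X] only inside the plateau, but [u]
    vanishes almost everywhere outside the cone, so the substitution is valid under the integral. *)
Let pairing_box h t : smooth1 R h -> 0 < t -> t < tau ->
  pairing (u t) (box (prod_test R n h k) t) =
  derive1 (derive1 h) t * moment X u t - h t * (lam * moment X u t).
Proof.
move=> sh t0 tt; have [K hK] := XK.
have It := Ico_tau t t0 tt; have iu := inL1_integrable R n _ (cu.1 t It).
have iX := Rn_integrableM R n _ _ _ iu mX hK.
rewrite (_ : box _ t = fun x => derive1 (derive1 h) t * X x - h t * prod_laplace R n k x); last first.
  by apply/funext => x; rewrite box_prod.
pose c := derive1 (derive1 h) t - h t * lam.
have [i1 i2] : Rn_integrable R n (fun x => u t x * (derive1 (derive1 h) t * X x - h t * prod_laplace R n k x)) /\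
    Rintegral leb setT (fun x => u t x * (derive1 (derive1 h) t * X x - h t * prod_laplace R n k x)) =
    Rintegral leb setT (fun x => c * (u t x * X x)).
  apply: ae_eq_Rintegral; last first.
  - have := ae_cone R n (t + 1) (u t) (Rn_integrable_mfun R n _ iu) (coneu t It).
    apply: filterS => x hx.
    have [xt|tx] := leP (enorm x) (t + 1); last by rewrite hx// !mul0r mulr0.
    rewrite prod_laplace_exp -/lam.
      by rewrite /c -/(exp_cut L w) -/X; ring.
    move=> j; rewrite (le_lt_trans (coord_le_enorm _ _ _ _))// (le_lt_trans xt)// /L; lra.
  - exact: Rn_integrableZ.
  - apply: measurable_funM; first exact: Rn_integrable_mfun iu.
    apply: measurable_funB; apply: measurable_funM => //.
    exact: mfun_prod_laplace.
rewrite /pairing iintRE// i2 RintegralZl// /c -/(moment X u t); ring.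
Qed.

(** The wave equation tested with [h X] produces a term in [h'']. Since [h'] is again an admissible
    test, [weak_derivative_moment] converts it into a term in [h'] and the moment of [ut]. *)
Lemma weak_derivative_wave : weak_derivative R 0 tau (moment X ut)
  (fun s => moment X F s + lam * moment X u s).
Proof.
move=> h s t sh s0 st tt hst.
have tT : (t%:E < T)%E by rewrite (lt_trans _ tauT)// lte_fin.
have := waveu _ (testX h s t sh s0 st tt hst).
have [K hK] := XK.
have pF x : Ioo0 T x -> pairing (F x) (prod_test R n h k x) = h x * moment X F x.
  by move=> Ix; apply: (@pairing_prod_test _ _ _ _ K) => //; exact: iF.
have h0 x : ~~ (s <= x <= t) -> h x = 0 by apply: contraNeq => /hst.
have h20 x : ~~ (s <= x <= t) -> derive1 (derive1 h) x = 0.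
  by apply: contraNeq => /(derive1_support _ _ _ (derive1_support _ _ _ hst)).
rewrite (@tint_itv T _ s t)//; last by move=> x x0 xT xst; rewrite pF// h0// mul0r.
rewrite (@tint_itv T _ s t)//; last first.
  move=> x x0 xT xst; rewrite /pairing -[RHS]iintR0; congr iintR; apply/funext => y.
  by rewrite box_prod// h0// h20// !mul0r subr0 mulr0.
have Ist x : x \in `[s, t]%classic -> 0 < x /\ x < tau.
  rewrite inE /= in_itv /= => /andP[sx xt]; split; first exact: lt_le_trans sx.
  exact: le_lt_trans tt.
have IT x : 0 < x /\ x < tau -> Ioo0 T x.
  by move=> [x0 xt]; split => //; rewrite (lt_trans _ tauT)// lte_fin.
move=> E0; have E1 : Rintegral mu `[s, t] (fun x => h x * moment X F x) =
    Rintegral mu `[s, t] (fun x => derive1 (derive1 h) x * moment X u x - h x * (lam * moment X u x)).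
  transitivity (Rintegral mu `[s, t] (fun r => pairing (F r) (prod_test R n h k r))).
    by apply: eq_Rintegral => x xst; rewrite pF//; apply: IT; exact: Ist.
  rewrite E0; apply: eq_Rintegral => x xst.
  by rewrite pairing_box//; [exact: (Ist x xst).1|exact: (Ist x xst).2].
have csm f : smooth1 R f -> cont_on R 0 tau f.
  by move=> sf; apply: cont_on_continuous; exact: smooth1_continuous.
have cA := cont_on_moment u cu.
have sdh := smooth1_derive1 R h sh; have sddh := smooth1_derive1 R _ sdh.
have cd2 : cont_on R 0 tau (fun x => derive1 (derive1 h) x * moment X u x).
  by apply: cont_onM => //; exact: csm.
have chl : cont_on R 0 tau (fun x => h x * (lam * moment X u x)).
  by apply: cont_onM; [exact: csm|apply: cont_onM => //; exact: cont_on_cst].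
have chN : cont_on R 0 tau (fun x => h x * moment X F x) by apply: cont_onM => //; exact: csm.
move: E1; rewrite RintegralB//; [|exact: cont_on_integrable cd2 s0 tt|exact: cont_on_integrable chl s0 tt].
have := weak_derivative_moment _ _ _ sdh s0 st tt (derive1_support _ _ _ hst).
move=> -> E1.
under [in RHS]eq_Rintegral do rewrite mulrDr.
rewrite RintegralD//; [|exact: cont_on_integrable chN s0 tt|exact: cont_on_integrable chl s0 tt].
rewrite E1.
by rewrite subrK opprK.
Qed.

Lemma is_derive_moment t : 0 < t -> t < tau -> is_derive t 1 (moment X u) (moment X ut t).
Proof.
by apply: is_derive_weak_derivative; [exact: cont_on_moment|exact: cont_on_moment|exact: weak_derivative_moment].
Qed.

Lemma is_derive_wave t : 0 < t -> t < tau ->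
  is_derive t 1 (moment X ut) (moment X F t + lam * moment X u t).
Proof.
apply: (is_derive_weak_derivative _ _ _ _ (fun s => moment X F s + lam * moment X u s)); [exact: cont_on_moment| |exact: weak_derivative_wave].
apply: cont_onD => //; apply: cont_onM; first exact: cont_on_cst.
exact: cont_on_moment.
Qed.

End Wave.

End Moments.

(** * Concentration near the light cone *)

Section GaussianSums.
Variable R : realType.
Let q : R := expR (- 1).
Let E : R := (1 - q)^-1.

Let q1 : 0 < q < 1. Proof. by rewrite expR_gt0 expR_lt1 ltrN10. Qed.
Let E0 : 0 < E. Proof. by rewrite invr_gt0 subr_gt0; case/andP: q1. Qed.
Let EqE : E * q + 1 = E.
Proof.
have q10 : 1 - q != 0 by rewrite gt_eqF// subr_gt0; case/andP: q1.
by rewrite /E; field.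
Qed.

Lemma sum_exp_below (M : nat) (y : R) :
  \sum_(i < M | i%:R <= y) expR (i%:R - y) <= E.
Proof.
(* Strengthened for the induction: while all indices stay below [y], the partial sum is at most [E]
   times its last term, and [E * q + 1 = E] absorbs the next one. *)
suff : \sum_(i < M | i%:R <= y) expR (i%:R - y) <= E * Num.min 1 (expR (M%:R - 1 - y)).
  by move=> h; apply: (le_trans h); rewrite ler_piMr ?(ltW E0)// ge_min lexx.
elim: M => [|M ih]; first by rewrite big_ord0 mulr_ge0 ?(ltW E0)// le_min ler01 expR_ge0.
rewrite big_mkcond big_ord_recr /= -big_mkcond /=.
have -> : M.+1%:R - 1 - y = M%:R - y by rewrite -natr1 addrK.
have [My|yM] := leP M%:R y.
  have h1 : expR (M%:R - y) <= 1 by rewrite expR_le1 subr_le0.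
  rewrite min_r//.
  have {}ih : \sum_(i < M | i%:R <= y) expR (i%:R - y) <= E * (q * expR (M%:R - y)).
    apply: (le_trans ih); rewrite ler_wpM2l ?(ltW E0)// ge_min /q -expRD.
    by rewrite (_ : -1 + (M%:R - y) = M%:R - 1 - y) ?lexx ?orbT//; ring.
  by rewrite -[in leRHS]EqE mulrDl mul1r -mulrA lerD2r.
rewrite addr0 (le_trans ih)// ler_wpM2l ?(ltW E0)// le_min ge_min lexx /=.
by rewrite ge_min ler_expR lerD2r gerBl ler01 orbT.
Qed.

Lemma sum_exp_above (M : nat) (y : R) :
  \sum_(i < M | y < i%:R) expR (y - i%:R) <= E.
Proof.
(* Strengthened for the induction: the second summand reserves room for the terms from index [M]
   on. *)
suff : \sum_(i < M | y < i%:R) expR (y - i%:R) + E * Num.min 1 (expR (y - M%:R)) <= E.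
  by apply: le_trans; rewrite lerDl mulr_ge0 ?(ltW E0)// le_min ler01 expR_ge0.
elim: M => [|M ih].
  by rewrite big_ord0 add0r ler_piMr ?(ltW E0)// ge_min lexx.
rewrite big_mkcond big_ord_recr /= -big_mkcond /=.
have [yM|My] := ltP y M%:R.
  have h1 : expR (y - M%:R) <= 1 by rewrite expR_le1 subr_le0 ltW.
  rewrite min_r// in ih; apply: le_trans ih; rewrite -addrA lerD2l.
  apply: (@le_trans _ _ (expR (y - M%:R) + E * (q * expR (y - M%:R)))).
    rewrite lerD2l ler_wpM2l ?(ltW E0)// ge_min /q -expRD -natr1.
    by rewrite (_ : -1 + (y - M%:R) = y - (M%:R + 1)) ?lexx ?orbT//; ring.
  by rewrite -[in leRHS]EqE mulrDl mul1r mulrA addrC.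
rewrite addr0 big1 ?add0r; last first.
  move=> i yi; exfalso; move: yi; apply/negP; rewrite -leNgt (le_trans _ My)// ler_nat.
  by rewrite ltnW.
by rewrite ler_piMr ?(ltW E0)// ge_min lexx.
Qed.

Definition gauss_sum_bound : R := expR 1 * (E + E).

(** The bound depends neither on the number of grid points nor on [y]. From [(|z|/2 - 1)^2 >= 0] one
    gets [- z^2/4 <= 1 - |z|], whence the factor [e] and one geometric series on each side of
    [y]. *)
Lemma gauss_sum_le (M : nat) (y : R) :
  \sum_(i < M) expR (- (y - i%:R) ^+ 2 / 4) <= gauss_sum_bound.
Proof.
apply: (@le_trans _ _ (\sum_(i < M) expR 1 * expR (- `|y - i%:R|))).
  apply: ler_sum => i _; rewrite -expRD ler_expR.
  have h : 0 <= (`|y - i%:R| / 2 - 1) ^+ 2 by exact: sqr_ge0.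
  rewrite -(@real_normK _ (y - i%:R)) ?num_real//.
  move: h; move: (`|_|) => z; rewrite expr2; nra.
rewrite -mulr_sumr ler_wpM2l ?expR_ge0// (bigID (fun i : 'I_M => i%:R <= y)) /=.
apply: lerD.
  apply: le_trans (sum_exp_below M y); apply: ler_sum => i iy.
  by rewrite ger0_norm ?subr_ge0// opprB.
apply: le_trans (sum_exp_above M y).
under eq_bigl do rewrite -ltNge.
apply: ler_sum => i iy.
by rewrite ltr0_norm ?subr_lt0// opprK.
Qed.

Lemma gauss_sum_bound_gt0 : 0 < gauss_sum_bound.
Proof. by rewrite mulr_gt0 ?expR_gt0// addr_gt0. Qed.

(** The graph of the convex function [y^r] lies above its tangent at [h]; in this form it is Young's
    inequality for [y] and [h^(r-1)] with exponents [r] and [r/(r-1)]. *)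
Lemma powR_tangent (r y h : R) : 1 < r -> 0 <= y -> 0 <= h ->
  r * h `^ (r - 1) * y - (r - 1) * h `^ r <= y `^ r.
Proof.
move=> r1 y0 h0; have r0 : 0 < r by lra. have r10 : 0 < r - 1 by rewrite subr_gt0.
have := @conjugate_powR R y (h `^ (r - 1)) r (r / (r - 1)) y0 (powR_ge0 _ _) r0 (divr_gt0 r0 r10).
have -> : r^-1 + (r / (r - 1))^-1 = 1 by field; rewrite !gt_eqF.
move=> /(_ erefl).
rewrite -powRrM (_ : (r - 1) * (r / (r - 1)) = r); last by field; rewrite gt_eqF.
move=> h1; have : r * (y * h `^ (r - 1)) <= r * (y `^ r / r + h `^ r / (r / (r - 1))).
  by rewrite ler_wpM2l// ltW.
have -> : r * (y `^ r / r + h `^ r / (r / (r - 1))) = y `^ r + (r - 1) * h `^ r.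
  by field; rewrite !gt_eqF.
lra.
Qed.

Local Notation mu := (@lebesgue_measure R).

Lemma integral_gauss (a s : R) : 0 < s ->
  (\int[mu]_x (expR (- (x - a) ^+ 2 / (4 * s)))%:E = (Num.sqrt (4 * s * pi))%:E)%E.
Proof.
move=> s0; pose sg := Num.sqrt (2 * s).
have sg2 : sg ^+ 2 = 2 * s by rewrite sqr_sqrtr// mulr_ge0// ltW.
have sg0 : sg != 0 by rewrite gt_eqF// sqrtr_gt0 mulr_gt0.
have pE x : expR (- (x - a) ^+ 2 / (4 * s)) = (normal_peak sg)^-1 * normal_pdf a sg x.
  rewrite normal_pdfE// mulKf ?gt_eqF ?normal_peak_gt0// /normal_fun sg2.
  by congr (expR (_ / _)); ring.
under eq_integral do rewrite pE EFinM.
rewrite ge0_integralZl_EFin//; last 3 first.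
- by move=> x _; rewrite lee_fin normal_pdf_ge0.
- by apply/measurable_EFinP; exact: measurable_normal_pdf.
- by rewrite invr_ge0 normal_peak_ge0.
rewrite integral_normal_pdf mule1; congr EFin.
by rewrite /normal_peak invrK sg2; congr Num.sqrt; ring.
Qed.

Definition half_exp (z : R) : R := if z <= 0 then expR (z / 2) else 0.

Lemma half_exp_ge0 z : 0 <= half_exp z.
Proof. by rewrite /half_exp; case: ifP => // _; exact: expR_ge0. Qed.

Lemma measurable_half_exp : measurable_fun setT half_exp.
Proof.
apply: measurable_fun_ifT => //; first exact: measurable_fun_ler.
apply: measurableT_comp; first exact: measurable_expR.
exact: measurable_funM.
Qed.

(** Independence of the shift [b] is the point: one coordinate of [x.w] can be integrated with the
    others frozen. *)
Lemma integral_half_exp (w b : R) : 0 < w ->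
  (\int[mu]_x (half_exp (w * x + b))%:E = (2 / w)%:E)%E.
Proof.
move=> w0; pose a := b / w; pose G x := expR ((w * x + b) / 2).
have cond x : (w * x + b <= 0) = (x <= - a).
  by rewrite -lerBrDr sub0r /a -mulNr ler_pdivlMr// mulrC.
transitivity (\int[mu]_(x in `]-oo, (- a)%R]) (G x)%:E)%E.
  rewrite [RHS]integral_mkcond; apply: eq_integral => x _.
  rewrite /patch /half_exp cond; case: ifPn => xa; first by rewrite mem_set//= in_itv.
  by rewrite memNset//= in_itv /=; exact/negP.
have cG : continuous G.
  move=> x; apply: continuous_comp; last exact: continuous_expR.
  apply: continuousM; last exact: cst_continuous.
  apply: continuousD; last exact: cst_continuous.
  exact: mulrl_continuous.
rewrite ge0_integration_by_substitutionNy; last 2 first.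
- exact: continuous_subspaceT.
- by move=> x _; exact: expR_ge0.
pose F x : R := - (2 / w) * G (- x).
have dF (x : R) : is_derive x 1 F (G (- x)).
  have dE : is_derive (- (w / 2) * x + b / 2) 1 (@expR R) (expR (- (w / 2) * x + b / 2)) by exact: is_derive_expR.
  have {}dE := is_derive_comp_affine _ _ _ _ _ _ dE.
  have GE (y : R) : G (- y) = expR (- (w / 2) * y + b / 2).
    by rewrite /G; congr expR; field.
  have := is_deriveZ (- (2 / w)) dE.
  rewrite /F GE; under [X in is_derive _ _ X _ -> _]eq_fun do rewrite -GE.
  move=> H; apply: (is_derive_eq H); rewrite /GRing.scale /=; field; rewrite gt_eqF//.
rewrite (@ge0_continuous_FTC2y _ (G \o -%R) F a 0).
- rewrite /F sub0e -EFinN mulNr opprK; congr EFin.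
  rewrite /G (_ : w * - a + b = 0) ?mul0r ?expR0 ?mulr1//.
  by rewrite /a; field; rewrite gt_eqF.
- by move=> x _; exact: expR_ge0.
- apply: continuous_subspaceT => x; apply: continuous_comp; last exact: cG.
  exact: opp_continuous.
- rewrite -[X in _ --> X](mulr0 (- (2 / w))); apply: cvgMr.
  have GE x : (G \o -%R) x = expR (- ((x - b / w) * (w / 2))).
    by rewrite /G /=; congr expR; field; rewrite gt_eqF.
  rewrite (_ : (fun x => G (- x)) = (fun y => expR (- y)) \o (fun x => (x - b / w) * (w / 2))); last first.
    by apply/funext => x; exact: GE.
  apply: (@cvg_comp _ _ _ _ (fun y : R => expR (- y))); last exact: cvgr_expR.
  by apply/gt0_cvgMly; [rewrite divr_gt0|exact: cvg_addrr].
- by move=> x _; case: (dF x).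
- apply: cvg_at_right_filter.
  by apply: differentiable_continuous; apply/derivable1_diffP; case: (dF a).
- by move=> x _; rewrite derive1E; case: (dF x).
Qed.

End GaussianSums.

(** * Weights concentrating at [rho w], and Jensen's inequality against them *)

Section Concentration.
Variables (R : realType) (m : nat).
Local Notation n := m.+1.
Local Notation E := (borel_rV R n).
Local Notation leb := (lebesgue_rV R n).
Local Notation mu := (@lebesgue_measure R).

(** Integrate the tangent inequality at [h = c / M]. Upper bounds on the mass of [X] and lower
    bounds on the weighted integral suffice, since these enter the tangent line with a negative and
    a positive coefficient. *)
Lemma jensen_weight (r c M : R) (phi X : E -> R) : 1 < r -> 0 <= c -> 0 < M ->
  (forall x, 0 <= X x) ->
  Rn_integrable R n (fun x => `|phi x| `^ r * X x) -> Rn_integrable R n (fun x => `|phi x| * X x) ->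
  Rn_integrable R n X -> Rintegral leb setT X <= M ->
  c <= Rintegral leb setT (fun x => `|phi x| * X x) ->
  c `^ r * M `^ (1 - r) <= Rintegral leb setT (fun x => `|phi x| `^ r * X x).
Proof.
move=> r1 c0 M0 X0 i1 i2 i3 XM cphi.
pose h := c / M; have h0 : 0 <= h by rewrite divr_ge0// ltW.
apply: (@le_trans _ _ (Rintegral leb setT (fun x => r * h `^ (r - 1) * (`|phi x| * X x) - (r - 1) * h `^ r * X x))); last first.
  apply: le_Rn_integral => //.
    by apply: Rn_integrableB; exact: Rn_integrableZ.
  move=> x; rewrite mulrA -mulrBl ler_wpM2r//; exact: powR_tangent.
rewrite RintegralB//; [|exact: Rn_integrableZ|exact: Rn_integrableZ].
rewrite !RintegralZl//.
have hr : h `^ r = h `^ (r - 1) * h.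
  have [h00|hn0] := eqVneq h 0.
    by rewrite h00 mulr0 powR0// gt_eqF// (lt_trans ltr01).
  by rewrite -{3}(powRr1 h0) -powRD ?subrK// hn0 implybT.
have E1 : c `^ r * M `^ (1 - r) = h `^ (r - 1) * c.
  have [c00|cn0] := eqVneq c 0.
    by rewrite c00 mulr0 powR0 ?mul0r// gt_eqF// (lt_trans ltr01).
  rewrite /h powRM// ?invr_ge0 ?(ltW M0)//.
  rewrite -[M^-1]powR_inv1 ?(ltW M0)// -powRrM mulN1r opprB mulrAC.
  by congr (_ * _); rewrite -{3}(powRr1 c0) -powRD ?subrK// cn0 implybT.
have hM : h * M = c by rewrite divfK ?gt_eqF.
clearbody h; rewrite E1.
have hp : 0 <= h `^ (r - 1) by exact: powR_ge0.
have I1 : h `^ (r - 1) * c <= h `^ (r - 1) * Rintegral leb setT (fun x => `|phi x| * X x).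
  exact: ler_wpM2l.
have I2 : (r - 1) * h `^ r * Rintegral leb setT X <= (r - 1) * (h `^ (r - 1) * c).
  apply: (@le_trans _ _ ((r - 1) * h `^ r * M)).
    by rewrite ler_wpM2l// mulr_ge0 ?powR_ge0// subr_ge0 ltW.
  by rewrite hr -!mulrA hM.
have {I1} : r * h `^ (r - 1) * c <= r * h `^ (r - 1) * Rintegral leb setT (fun x => `|phi x| * X x).
  by rewrite -!mulrA ler_wpM2l// (le_trans ler01)// ltW.
move: I2; move: (Rintegral _ _ X) (Rintegral _ _ (fun x => `|phi x| * X x)) => I J; clear.
rewrite !mulrA !mulrBl !mul1r; lra.
Qed.

Definition dir_weight (rho : R) (w : 'I_n -> R) (x : E) : R :=
  if enorm x <= rho then expR (\sum_j w j * x ord0 j - rho) else 0.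

(** Squared distance from [x] to [rho w] without the first coordinate, which is integrated through
    [x.w] instead, where the weight decays exponentially. *)
Definition tail_sq (rho : R) (w : 'I_n -> R) (x : E) : R :=
  \sum_(j < m) (x ord0 (lift ord0 j) - rho * w (lift ord0 j)) ^+ 2.

(* On the ball, [|x - rho w|^2 <= 2 rho (rho - x.w)] since [|w| = 1]. *)
Lemma dir_exponent_le rho (w : 'I_n -> R) (x : E) : 0 < rho -> \sum_j w j ^+ 2 = 1 ->
  enorm x <= rho -> \sum_j w j * x ord0 j - rho <= - tail_sq rho w x / (2 * rho).
Proof.
move=> rho0 w1 xrho.
have x2 : \sum_(i < n) x ord0 i ^+ 2 <= rho ^+ 2.
  have s0 : 0 <= \sum_(i < n) x ord0 i ^+ 2 by apply: sumr_ge0 => i _; exact: sqr_ge0.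
  by rewrite -(sqr_sqrtr s0) ler_pXn2r// ?nnegrE ?sqrtr_ge0// ltW.
have t1 : tail_sq rho w x <= \sum_j (x ord0 j - rho * w j) ^+ 2.
  by rewrite big_ord_recl /= lerDr sqr_ge0.
have t2 : \sum_j (x ord0 j - rho * w j) ^+ 2 =
    \sum_j x ord0 j ^+ 2 - 2 * rho * (\sum_j w j * x ord0 j) + rho ^+ 2.
  have -> : rho ^+ 2 = \sum_j (rho ^+ 2 * w j ^+ 2) by rewrite -mulr_sumr w1 mulr1.
  rewrite mulr_sumr -sumrB -big_split /=.
  by apply: eq_bigr => j _; ring.
rewrite ler_pdivlMr ?mulr_gt0//; rewrite t2 in t1.
by move: x2 t1; move: (\sum_(i < n) x ord0 i ^+ 2) (tail_sq _ _ _) (\sum_j w j * x ord0 j) => a b c; clear; nra.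
Qed.

Lemma mfun_dot (w : 'I_n -> R) : Rn_mfun R n (fun x => \sum_j w j * x ord0 j).
Proof.
by apply: measurable_sum => j; apply: measurable_funM => //; exact: measurable_coord.
Qed.

Lemma mfun_enorm : Rn_mfun R n (fun x => enorm x).
Proof.
apply: (measurableT_comp (f := @Num.sqrt R)).
  by apply: continuous_measurable_fun; exact: sqrt_continuous.
by apply: measurable_sum => i; apply: measurable_funX; exact: measurable_coord.
Qed.

Lemma mfun_dir_weight rho w : Rn_mfun R n (dir_weight rho w).
Proof.
apply: measurable_fun_ifT => //.
  by apply: measurable_fun_ler => //; exact: mfun_enorm.
apply: measurableT_comp; first exact: measurable_expR.
by apply: measurable_funB => //; exact: mfun_dot.
Qed.

Lemma dir_weight_ge0 rho w x : 0 <= dir_weight rho w x.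
Proof. by rewrite /dir_weight; case: ifP => // _; exact: expR_ge0. Qed.

Lemma dir_weight_le_gauss rho w x : 0 < rho -> \sum_j w j ^+ 2 = 1 ->
  dir_weight rho w x <= expR (- tail_sq rho w x / (2 * rho)).
Proof.
move=> rho0 w1; rewrite /dir_weight; case: ifPn => [xr|_]; last exact: expR_ge0.
by rewrite ler_expR; exact: dir_exponent_le.
Qed.

Lemma tail_sq_ge0 rho w x : 0 <= tail_sq rho w x.
Proof. by apply: sumr_ge0 => j _; exact: sqr_ge0. Qed.

(** Half of the exponent [x.w - rho] is kept for integrability in the first coordinate; by
    [dir_exponent_le] the other half becomes a Gaussian in the remaining ones. *)
Lemma dir_weight_le_half rho w x : 0 < rho -> \sum_j w j ^+ 2 = 1 ->
  dir_weight rho w x <=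
  half_exp R (\sum_j w j * x ord0 j - rho) * expR (- tail_sq rho w x / (4 * rho)).
Proof.
move=> rho0 w1; rewrite /dir_weight; case: ifPn => [xr|_]; last first.
  by rewrite mulr_ge0 ?half_exp_ge0 ?expR_ge0.
have h := dir_exponent_le rho w x rho0 w1 xr.
have hneg : \sum_j w j * x ord0 j - rho <= 0.
  by rewrite (le_trans h)// mulNr oppr_le0 divr_ge0 ?tail_sq_ge0 ?mulr_ge0// ltW.
rewrite /half_exp hneg -expRD ler_expR.
move: h; have -> : - tail_sq rho w x / (4 * rho) = (- tail_sq rho w x / (2 * rho)) / 2.
  by field; rewrite gt_eqF.
by move: (_ / (2 * rho)) => z; clear; lra.
Qed.

Section IteratedProduct.
Variables (h : R -> R) (g : 'I_m -> R -> R) (w : 'I_n -> R) (b C0 Cg : R).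
Hypotheses (h0 : forall y, 0 <= h y) (g0 : forall j y, 0 <= g j y).
Hypotheses (mh : measurable_fun setT h) (mg : forall j, measurable_fun setT (g j)).
Hypothesis ih : forall c, (\int[mu]_s (h (w ord0 * s + c))%:E = C0%:E)%E.
Hypothesis ig : forall j, (\int[mu]_s (g j s)%:E = Cg%:E)%E.

Lemma iint_aux_prod k (x : E) : (k <= m)%N ->
  iint_aux k.+1 (fun x : E => (h (\sum_j w j * x ord0 j + b) *
    \prod_(j < m) g j (x ord0 (lift ord0 j)))%:E) x =
  (C0 * Cg ^+ k * \prod_(j < m | (k <= j)%N) g j (x ord0 (lift ord0 j)))%:E.
Proof.
have pr0 (P : pred 'I_m) (y : E) : 0 <= \prod_(j < m | P j) g j (y ord0 (lift ord0 j)).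
  by apply: prodr_ge0 => j _.
elim: k x => [|k IH] x km.
  rewrite /= expr0 mulr1.
  pose c := \sum_(j < m) w (lift ord0 j) * x ord0 (lift ord0 j) + b.
  transitivity (\int[mu]_s ((h (w ord0 * s + c))%:E * (\prod_(j < m) g j (x ord0 (lift ord0 j)))%:E))%E.
    apply: eq_integral => s _; rewrite -EFinM; congr (EFin (h _ * _)).
      rewrite big_ord_recl /c !mxE /= -addrA; congr (_ + (_ + _)).
      by apply: eq_bigr => j _; rewrite !mxE /=.
    by apply: eq_bigr => j _; rewrite !mxE /=.
  rewrite ge0_integralZr//.
  - by rewrite ih -EFinM.
  - apply/measurable_EFinP; apply: measurableT_comp => //.
    by apply: measurable_funD => //; exact: measurable_funM.
  - by move=> s _; rewrite lee_fin.
  - by rewrite lee_fin.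
set W := (fun x : E => _%:E) in IH *.
change (iint_aux k.+2 W x) with (\int[mu]_s iint_aux k.+1 W (set_coord x k.+1 s))%E.
pose kk := Ordinal km.
transitivity (\int[mu]_s ((C0 * Cg ^+ k * \prod_(j < m | (k.+1 <= j)%N) g j (x ord0 (lift ord0 j)))%:E * (g kk s)%:E))%E.
  apply: eq_integral => s _; rewrite IH ?(ltnW km)// -EFinM; congr EFin.
  rewrite (bigD1 kk)//= mxE /= eqxx mulrA mulrAC; congr (_ * _ * _).
  apply: eq_big => [j|j /andP[kj jk]]; first by rewrite andbC -(inj_eq val_inj) /= eq_sym ltn_neqAle.
  by rewrite mxE /= /bump /= add1n eqSS ifF//; apply: contraNF jk => /eqP jk; apply/eqP/val_inj.
have C00 : 0 <= C0 by rewrite -lee_fin -(ih 0); apply: integral_ge0 => s _; rewrite lee_fin.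
have Cg0 : 0 <= Cg by rewrite -lee_fin -(ig kk); apply: integral_ge0 => s _; rewrite lee_fin.
rewrite ge0_integralZl_EFin//.
- by rewrite ig -EFinM; congr EFin; rewrite exprSr; ring.
- by move=> s _; rewrite lee_fin.
- by apply/measurable_EFinP; exact: mg.
- by rewrite !mulr_ge0// exprn_ge0.
Qed.

Lemma iint_prod :
  iint (fun x : E => (h (\sum_j w j * x ord0 j + b) *
    \prod_(j < m) g j (x ord0 (lift ord0 j)))%:E) = (C0 * Cg ^+ m)%:E.
Proof.
rewrite /iint iint_aux_prod// big1 ?mulr1// => j mj.
by move: (ltn_ord j); rewrite ltnNge mj.
Qed.

End IteratedProduct.

(** The mass is at most of the order [rho^(m/2)] of the volume of a cap. The condition on [w ord0]
    bounds the factor [2 / w ord0] by 4. *)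
Lemma integral_dir_weight rho w : 0 < rho -> \sum_j w j ^+ 2 = 1 -> 1 / 2 <= w ord0 ->
  Rn_integrable R n (dir_weight rho w) /\
  Rintegral leb setT (dir_weight rho w) <= 4 * Num.sqrt (4 * rho * pi) ^+ m.
Proof.
move=> rho0 w1 w0; have w00 : 0 < w ord0 by lra.
pose g (j : 'I_m) y := expR (- (y - rho * w (lift ord0 j)) ^+ 2 / (4 * rho)).
have mg j : measurable_fun setT (g j).
  apply: measurableT_comp; first exact: measurable_expR.
  apply: measurable_funM => //; apply: measurableT_comp => //.
  by apply: measurable_funX; exact: measurable_funB.
have gE x : expR (- tail_sq rho w x / (4 * rho)) = \prod_(j < m) g j (x ord0 (lift ord0 j)).
  by rewrite -expR_sum /tail_sq -sumrN mulr_suml.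
have iP := @iint_prod (half_exp R) g w (- rho) (2 / w ord0) (Num.sqrt (4 * rho * pi)) (half_exp_ge0 R)
  (fun j y => expR_ge0 _) (measurable_half_exp R) mg (fun c => integral_half_exp R (w ord0) c w00)
  (fun j => integral_gauss R _ rho rho0).
set W := (fun x : E => _) in iP.
have W0 x : (0 <= W x)%E.
  by rewrite lee_fin mulr_ge0 ?half_exp_ge0//; apply: prodr_ge0 => j _; exact: expR_ge0.
have mW : measurable_fun setT W.
  apply/measurable_EFinP; apply: measurable_funM.
    apply: measurableT_comp; first exact: measurable_half_exp.
    by apply: measurable_funD => //; exact: mfun_dot.
  apply: measurable_prod => j _; apply: measurableT_comp => //; exact: measurable_coord.
have md := mfun_dir_weight rho w.
have mEd : measurable_fun setT (fun x => (dir_weight rho w x)%:E) by exact/measurable_EFinP.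
have d0 x : (0 <= (dir_weight rho w x)%:E)%E by rewrite lee_fin dir_weight_ge0.
have le : (\int[leb]_x (dir_weight rho w x)%:E <= (4 * Num.sqrt (4 * rho * pi) ^+ m)%:E)%E.
  apply: (@le_trans _ _ (iint W)); last first.
    rewrite iP lee_fin ler_wpM2r ?exprn_ge0 ?sqrtr_ge0// ler_pdivrMr//; lra.
  rewrite iintE//; apply: ge0_le_integral => // x _.
  by rewrite lee_fin -gE; exact: dir_weight_le_half.
have int : Rn_integrable R n (dir_weight rho w).
  apply/Rn_integrableP => //.
  under eq_integral do rewrite ger0_norm ?dir_weight_ge0//.
  by rewrite (le_lt_trans le)// ltry.
split => //; rewrite /Rintegral -lee_fin fineK//; exact: integrable_fin_num.
Qed.

(* Directions near the first axis whose other components form a grid of mesh [1 / sqrt rho]. *)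
Definition grid_dir (rho : R) (M : nat) (f : {ffun 'I_m -> 'I_M}) (i : 'I_n) : R :=
  if unlift ord0 i is Some j then (f j)%:R / Num.sqrt rho
  else Num.sqrt (1 - \sum_j ((f j)%:R / Num.sqrt rho) ^+ 2).

Lemma grid_dir_lift rho M (f : {ffun 'I_m -> 'I_M}) j :
  grid_dir rho M f (lift ord0 j) = (f j)%:R / Num.sqrt rho.
Proof. by rewrite /grid_dir liftK. Qed.

Lemma grid_dir0 rho M (f : {ffun 'I_m -> 'I_M}) :
  grid_dir rho M f ord0 = Num.sqrt (1 - \sum_j ((f j)%:R / Num.sqrt rho) ^+ 2).
Proof. by rewrite /grid_dir unlift_none. Qed.

(** In units of [sqrt rho] the transverse grid is made of integers, so the sum over grid functions
    of products is a product of [m] one-dimensional Gaussian sums, bounded whatever the number of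
    directions. *)
Lemma sum_dir_weight_le rho M (x : E) : 0 < rho ->
  (forall f : {ffun 'I_m -> 'I_M}, \sum_j grid_dir rho M f j ^+ 2 = 1) ->
  \sum_(f : {ffun 'I_m -> 'I_M}) dir_weight rho (grid_dir rho M f) x <=
  gauss_sum_bound R ^+ m * (if enorm x <= rho then 1 else 0).
Proof.
move=> rho0 gd1; have [xr|xr] := boolP (enorm x <= rho); last first.
  by rewrite mulr0 big1// => f _; rewrite /dir_weight (negbTE xr).
rewrite mulr1.
pose y (j : 'I_m) := x ord0 (lift ord0 j) / Num.sqrt rho.
have sr0 : Num.sqrt rho != 0 by rewrite gt_eqF// sqrtr_gt0.
have sr2 : rho = Num.sqrt rho ^+ 2 by rewrite sqr_sqrtr// ltW.
apply: (@le_trans _ _ (\sum_(f : {ffun 'I_m -> 'I_M}) \prod_(j < m) expR (- (y j - (f j)%:R) ^+ 2 / 4))).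
  apply: ler_sum => f _; apply: (le_trans (dir_weight_le_gauss _ _ _ rho0 (gd1 f))).
  rewrite -expR_sum ler_expR /tail_sq -sumrN mulr_suml; apply: ler_sum => j _.
  rewrite grid_dir_lift.
  have -> : x ord0 (lift ord0 j) - rho * ((f j)%:R / Num.sqrt rho) = Num.sqrt rho * (y j - (f j)%:R).
    by rewrite /y {1}sr2; field.
  rewrite exprMn -sr2.
  have -> : - (rho * (y j - (f j)%:R) ^+ 2) / (2 * rho) = - ((y j - (f j)%:R) ^+ 2 / 2).
    by field; rewrite gt_eqF.
  by have := sqr_ge0 (y j - (f j)%:R); move: (_ ^+ 2) => z; lra.
rewrite -(bigA_distr_bigA (fun j (i : 'I_M) => expR (- (y j - i%:R) ^+ 2 / 4))) /=.
rewrite -[leRHS](_ : \prod_(j < m) gauss_sum_bound R = _); last by rewrite big_const_ord iter_mulr_1.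
apply: ler_prod => j _; rewrite gauss_sum_le andbT.
by apply: sumr_ge0 => i _; exact: expR_ge0.
Qed.

Lemma Rn_integral_sum I (s : seq I) (F : I -> E -> R) : (forall i, Rn_integrable R n (F i)) ->
  Rn_integrable R n (fun x => \sum_(i <- s) F i x) /\
  Rintegral leb setT (fun x => \sum_(i <- s) F i x) = \sum_(i <- s) Rintegral leb setT (F i).
Proof.
move=> iF; elim: s => [|i s [ih1 ih2]].
  under eq_fun do rewrite big_nil; rewrite big_nil; split; first exact: integrable0.
  by rewrite /Rintegral integral0.
split; first by under eq_fun do rewrite big_cons; exact: Rn_integrableD.
under eq_Rintegral do rewrite big_cons.
by rewrite Rn_RintegralD // big_cons ih2.
Qed.

(* Jensen's inequality for each of about [sqrt rho ^ m] grid directions: each weight has mass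
   [O(sqrt rho ^ m)], and the sum of all the weights is [O(1)]. *)
Lemma concentration (p : R) : (0 < m)%N -> 1 < p -> exists2 K : R, 0 < K &
  forall (rho c : R) (phi : E -> R), 1 <= rho -> 0 <= c ->
    Rn_integrable R n (fun x => `|phi x| `^ p) -> Rn_integrable R n phi ->
    (forall w : 'I_n -> R, \sum_j w j ^+ 2 = 1 ->
       c <= Rintegral leb setT (fun x => `|phi x| * dir_weight rho w x)) ->
    K * c `^ p * (Num.sqrt rho ^+ m) `^ (2 - p) <=
    Rintegral leb setT (fun x => `|phi x| `^ p * (if enorm x <= rho then 1 else 0)).
Proof.
move=> m0 p1.
have m0R : 0 < m%:R :> R by rewrite ltr0n.
(* With transverse components at most [a], their squares sum to at most [m * a ^+ 2 = 1/4], so the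
   first component is at least [sqrt (3/4) >= 1/2]. *)
pose a : R := (2 * Num.sqrt m%:R)^-1.
have a0 : 0 < a by rewrite invr_gt0 mulr_gt0// sqrtr_gt0.
have a2 : a ^+ 2 = (4 * m%:R)^-1.
  by rewrite /a exprVn exprMn sqr_sqrtr ?ler0n//; congr (_^-1); ring.
pose Cw : R := 4 * Num.sqrt (4 * pi) ^+ m.
have Cw0 : 0 < Cw by rewrite mulr_gt0// exprn_gt0// sqrtr_gt0 mulr_gt0// pi_gt0.
pose C2 := gauss_sum_bound R ^+ m.
have C20 : 0 < C2 by rewrite exprn_gt0// gauss_sum_bound_gt0.
exists (a ^+ m * Cw `^ (1 - p) / C2).
  by rewrite divr_gt0// mulr_gt0 ?exprn_gt0// powR_gt0.
move=> rho c phi rho1 c0 iphip iphi hc.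
have rho0 : 0 < rho by exact: lt_le_trans rho1.
have sr0 : 0 < Num.sqrt rho by rewrite sqrtr_gt0.
(* The successor gives at least [a * sqrt rho] grid values per coordinate, while the largest index,
   [M - 1], is still at most [a * sqrt rho]. *)
pose M := (Num.truncn (a * Num.sqrt rho)).+1.
have Mlo : a * Num.sqrt rho <= M%:R by rewrite ltW// truncnS_gt.
have kM (k : 'I_M) : k%:R <= a * Num.sqrt rho.
  rewrite (@le_trans _ _ (Num.truncn (a * Num.sqrt rho))%:R)//.
    by rewrite ler_nat -ltnS.
  by rewrite truncn_le mulr_ge0// ltW.
have sumf (f : {ffun 'I_m -> 'I_M}) : \sum_j ((f j)%:R / Num.sqrt rho) ^+ 2 <= 1 / 4.
  apply: (@le_trans _ _ (\sum_(j < m) a ^+ 2)).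
    apply: ler_sum => j _; rewrite ler_pXn2r// ?nnegrE ?divr_ge0 ?(ltW sr0) ?(ltW a0)//.
    by rewrite ler_pdivrMr.
  rewrite sumr_const card_ord a2 -(mulr_natl (4 * m%:R)^-1 m).
  have -> : m%:R * (4 * m%:R)^-1 = 1 / 4 :> R by field; rewrite gt_eqF.
  by [].
have gd1 (f : {ffun 'I_m -> 'I_M}) : \sum_j grid_dir rho M f j ^+ 2 = 1.
  rewrite big_ord_recl grid_dir0 sqr_sqrtr; last by have := sumf f; lra.
  rewrite [X in _ + X](eq_bigr (fun j => ((f j)%:R / Num.sqrt rho) ^+ 2)).
    by rewrite subrK.
  by move=> j _; rewrite grid_dir_lift.
have gd0 (f : {ffun 'I_m -> 'I_M}) : 1 / 2 <= grid_dir rho M f ord0.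
  rewrite grid_dir0 -[leLHS]ger0_norm// -sqrtr_sqr ler_wsqrtr//.
  by have := sumf f; rewrite expr2; lra.
pose z := Num.sqrt rho ^+ m.
have z0 : 0 < z by rewrite exprn_gt0.
have iW f : Rn_integrable R n (fun x => `|phi x| `^ p * dir_weight rho (grid_dir rho M f) x).
  apply: (@Rn_integrableM R n _ _ 1) => //; first exact: mfun_dir_weight.
  move=> x; rewrite ger0_norm ?dir_weight_ge0// (le_trans (dir_weight_le_gauss _ _ _ rho0 (gd1 f)))//.
  by rewrite expR_le1 mulNr oppr_le0 divr_ge0 ?tail_sq_ge0// mulr_ge0// ltW.
have J f : c `^ p * (Cw * z) `^ (1 - p) <=
    Rintegral leb setT (fun x => `|phi x| `^ p * dir_weight rho (grid_dir rho M f) x).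
  have [id1 id2] := integral_dir_weight rho _ rho0 (gd1 f) (gd0 f).
  apply: jensen_weight => //.
  - by rewrite mulr_gt0.
  - by move=> x; exact: dir_weight_ge0.
  - apply: (@Rn_integrableM R n _ _ 1); first exact: Rn_integrable_norm.
      exact: mfun_dir_weight.
    move=> x; rewrite ger0_norm ?dir_weight_ge0// (le_trans (dir_weight_le_gauss _ _ _ rho0 (gd1 f)))//.
    by rewrite expR_le1 mulNr oppr_le0 divr_ge0 ?tail_sq_ge0// mulr_ge0// ltW.
  - apply: (le_trans id2).
    have -> : Cw * z = 4 * (Num.sqrt (4 * pi) * Num.sqrt rho) ^+ m by rewrite exprMn mulrA.
    by rewrite -sqrtrM ?mulr_ge0 ?pi_ge0// (mulrAC 4 rho).
  - exact: hc.
have iB : Rn_integrable R n (fun x => `|phi x| `^ p * (if enorm x <= rho then 1 else 0)).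
  apply: (@Rn_integrableM R n _ _ 1) => //.
    by apply: measurable_fun_ifT => //; apply: measurable_fun_ler => //; exact: mfun_enorm.
  by move=> x; case: ifP; rewrite ?normr1 ?normr0.
have [iS SE] := Rn_integral_sum _ (index_enum {ffun 'I_m -> 'I_M}) _ iW.
have N1 : (M ^ m)%:R * (c `^ p * (Cw * z) `^ (1 - p)) <=
    C2 * Rintegral leb setT (fun x => `|phi x| `^ p * (if enorm x <= rho then 1 else 0)).
  rewrite -RintegralZl//.
  apply: (@le_trans _ _ (Rintegral leb setT (fun x => \sum_f `|phi x| `^ p * dir_weight rho (grid_dir rho M f) x))).
    rewrite SE -[M in (M ^ _)%:R]card_ord -[m in (_ ^ m)%:R]card_ord -card_ffun mulr_natl -sumr_const.
    by apply: ler_sum => f _; exact: J.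
  apply: le_Rn_integral => //; first exact: Rn_integrableZ.
  move=> x; rewrite -mulr_sumr mulrCA ler_wpM2l ?powR_ge0//.
  exact: sum_dir_weight_le.
have N2 : a ^+ m * z <= (M ^ m)%:R.
  by rewrite /z -exprMn natrX ler_pXn2r// ?nnegrE ?mulr_ge0// ltW.
(* A number of directions of order [z], each contributing [z^(1 - p)] by Jensen, explains the
   exponent [2 - p]. *)
have zp : z `^ (2 - p) = z * z `^ (1 - p).
  rewrite -{2}(@powRr1 _ z (ltW z0)) -powRD; last by rewrite (gt_eqF z0) implybT.
  by congr (_ `^ _); ring.
rewrite -/z zp.
have -> : a ^+ m * Cw `^ (1 - p) / C2 * c `^ p * (z * z `^ (1 - p)) =
   (a ^+ m * z * (c `^ p * (Cw * z) `^ (1 - p))) / C2.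
  by rewrite powRM ?(ltW Cw0) ?(ltW z0)//; field; rewrite gt_eqF.
rewrite ler_pdivrMr// mulrC [leRHS]mulrC; apply: le_trans N1; rewrite mulrC.
by rewrite ler_wpM2r// mulr_ge0 ?powR_ge0.
Qed.

End Concentration.

(** * Differential inequalities *)

Section RealAnalysis.
Variable R : realType.
Implicit Types (A B F G H : R -> R).

Lemma econt_within (I : set R) A (s t : R) : econt R I A -> (forall r, s <= r <= t -> I r) ->
  {within `[s, t], continuous A}.
Proof.
move=> eA stI; apply/subspace_continuousP => x; rewrite /= in_itv /= => xst.
apply/cvgrPdist_le => e e0; have [d d0 hd] := eA x (stI x xst) e e0.
rewrite /within /=; apply/nbhs_ballP; exists d => // y; rewrite /ball /= => yd.
rewrite in_itv /= => yst; rewrite distrC ltW// hd//; first exact: stI.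
by rewrite distrC.
Qed.

Lemma increment_ge A (A' : R -> R) (s t c : R) : s <= t ->
  {within `[s, t], continuous A} -> (forall r, s < r -> r < t -> is_derive r 1 A (A' r)) ->
  (forall r, s < r -> r < t -> c <= A' r) -> c * (t - s) <= A t - A s.
Proof.
rewrite le_eqVlt => /orP[/eqP ->|st cA dA cA'].
  by rewrite !subrr mulr0.
have [r|r rst ->] := @MVT R A A' s t st _ cA.
  by rewrite in_itv /= => /andP[sr rt]; exact: dA.
move: rst; rewrite in_itv /= => /andP[sr rt].
by rewrite ler_wpM2r ?cA'// subr_ge0 ltW.
Qed.

(* [e^{-t} (a + b)] is nondecreasing, hence so is [e^t b - c e^{2t} / 2]. *)
Lemma exponential_growth (a b N : R -> R) (c s : R) :
  {within `[0, s], continuous a} -> {within `[0, s], continuous b} ->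
  (forall r, 0 < r -> r < s -> is_derive r 1 a (b r)) ->
  (forall r, 0 < r -> r < s -> is_derive r 1 b (N r + a r)) ->
  (forall r, 0 < r -> r < s -> 0 <= N r) -> 0 <= c -> c <= a 0 + b 0 -> 0 <= b 0 -> 1 <= s ->
  c / 4 * expR s <= b s.
Proof.
move=> ca cb da db N0 c0 cab b0 s1.
have s0 : 0 <= s by lra.
have cexp (k : R) t : {within `[0, t], continuous (fun x => expR (k * x))}.
  apply: continuous_subspaceT => x; apply: continuous_comp; last exact: continuous_expR.
  exact: mulrl_continuous.
have dexp (k r : R) : is_derive r 1 (fun x => expR (k * x)) (k * expR (k * r)).
  have dE : is_derive (k * r + 0) 1 (@expR R) (expR (k * r)) by rewrite addr0; exact: is_derive_expR.
  have := is_derive_comp_affine _ _ _ _ _ _ dE.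
  by under eq_fun do rewrite addr0.
have sub r : 0 <= r -> r <= s -> `[0, r]%classic `<=` `[0, s]%classic.
  by move=> r0 rs x /=; rewrite !in_itv /= => /andP[-> xr]; exact: le_trans rs.
have h1 r : 0 <= r -> r <= s -> c * expR r <= a r + b r.
  move=> r0 rs; pose g x := expR (- 1 * x) * (a x + b x).
  have := @increment_ge g (fun x => expR (- 1 * x) * N x) 0 r 0 r0.
  rewrite mul0r => H.
  have {}H : 0 <= g r - g 0.
    apply: H.
    - have ca' := continuous_subspaceW (sub r r0 rs) ca; have cb' := continuous_subspaceW (sub r r0 rs) cb.
      by move=> x; exact: (cvgM (cexp (- 1) r x) (cvgD (ca' x) (cb' x))).
    - move=> x x0 xr; have xs : x < s by exact: lt_le_trans rs.
      have := is_deriveM (dexp (- 1) x) (is_deriveD (da x x0 xs) (db x x0 xs)).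
      move=> D; apply: (is_derive_eq D); rewrite /GRing.scale /= -[(a + b) x]/(a x + b x); ring.
    - by move=> x x0 xr; rewrite mulr_ge0 ?expR_ge0// N0// (lt_le_trans xr).
  move: H; rewrite /g mulr0 expR0 mul1r mulN1r expRN subr_ge0 => H.
  by rewrite -ler_pdivlMr ?expR_gt0// (le_trans cab)// (le_trans H)// mulrC.
pose g x := expR (1 * x) * b x - c / 2 * expR (2 * x).
have := @increment_ge g (fun x => expR x * (b x + (N x + a x)) - c * expR (2 * x)) 0 s 0 s0.
rewrite mul0r => H; have {}H : 0 <= g s - g 0.
  apply: H.
  - by move=> x; exact: (cvgB (cvgM (cexp 1 s x) (cb x)) (cvgM (cvg_cst (c / 2)) (cexp 2 s x))).
  - move=> x x0 xs.
    have := is_deriveB (is_deriveM (dexp 1 x) (db x x0 xs)) (is_deriveZ (c / 2) (dexp 2 x)).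
    by move=> D; apply: (is_derive_eq D); rewrite /GRing.scale /= mul1r; field.
  - move=> x x0 xs; rewrite (_ : 2 * x = x + x); last by ring.
    rewrite expRD.
    have -> : expR x * (b x + (N x + a x)) - c * (expR x * expR x) =
       expR x * ((a x + b x - c * expR x) + N x) by ring.
    rewrite mulr_ge0 ?expR_ge0// addr_ge0 ?N0// subr_ge0.
    by apply: h1; exact: ltW.
move: H; rewrite /g !mulr0 expR0 !mul1r mulr1 subr_ge0 => H.
have {}H : c / 2 * (expR (2 * s) - 1) <= expR s * b s by lra.
(* For [s >= 1] the subtracted 1 costs at most half of [e^{2s}]; this turns [c / 2] into [c / 4]. *)
have e2 : 2 <= expR (2 * s).
  by rewrite (le_trans _ (expR_ge1Dx _))//; lra.
rewrite -(ler_pM2l (expR_gt0 s)); apply: le_trans H.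
have -> : expR (2 * s) = expR s * expR s by rewrite -expRD; congr expR; ring.
have : 2 <= expR s * expR s by rewrite -expRD (_ : s + s = 2 * s)//; ring.
by move: (expR s) => y hy; nra.
Qed.

Lemma powR_exprn (x r : R) (k : nat) : 0 <= x -> (x ^+ k) `^ r = (x `^ r) ^+ k.
Proof.
move=> x0; rewrite -(powR_mulrn k x0) -(powR_mulrn k (powR_ge0 x r)).
by rewrite -2!powRrM mulrC.
Qed.

Lemma powR_invr (x r : R) : 0 < x -> x^-1 `^ r = (x `^ r)^-1.
Proof.
move=> x0; apply: (@mulIf _ (x `^ r)); first by rewrite gt_eqF// powR_gt0.
rewrite mulVf ?gt_eqF ?powR_gt0// -powRM ?invr_ge0 ?(ltW x0)//.
by rewrite mulVf ?gt_eqF// powR1.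
Qed.

(** * The blow-up iteration for three coupled integral inequalities *)

Section Blowup.
Variables (F G H : R -> R) (s0 d a b F0 p q mu : R).
Hypotheses (d0 : 0 < d) (a0 : 0 < a) (b0 : 0 < b) (F00 : 0 < F0) (p1 : 1 < p) (q1 : 1 < q).
Hypotheses (mu2 : 2 <= mu) (mupq : 2 `^ (p + 2) <= mu `^ (p * q - 1)).
Let I r := s0 <= r <= s0 + d.
Hypotheses (G0 : forall r, I r -> 0 <= G r) (H0 : forall r, I r -> 0 <= H r) (F_s0 : F0 <= F s0).
Hypothesis hG : forall s t y, I s -> I t -> s <= t -> 0 <= y ->
  (forall r, s <= r <= t -> y <= F r) -> a * y `^ q * (t - s) <= G t - G s.
Hypothesis hH : forall s t y, I s -> I t -> s <= t -> 0 <= y ->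
  (forall r, s <= r <= t -> y <= G r) -> b * y `^ p * (t - s) <= H t - H s.
Hypothesis hF : forall s t y, I s -> I t -> s <= t -> 0 <= y ->
  (forall r, s <= r <= t -> y <= H r) -> y * (t - s) <= F t - F s.

Let F_nd s t : I s -> I t -> s <= t -> F s <= F t.
Proof.
move=> Is It st; have := hF s t 0 Is It st (lexx 0); rewrite mul0r subr_ge0; apply => r /andP[sr rt].
apply: H0; case/andP: Is => s1 s2; case/andP: It => t1 t2; apply/andP; split; lra.
Qed.

(** The bound on [F] needs a length [e] to raise [G], then another to raise [H], then a third to
    raise [F] again. Positivity of [G], [H] and [F] discards the values at the start of each
    stage. *)
Lemma blowup_step s e y : I s -> I (s + 3 * e) -> 0 <= e -> 0 <= y -> y <= F s ->
  b * (a * y `^ q * e) `^ p * e * e <= F (s + 3 * e).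
Proof.
move=> Is Ie e0 y0 yF.
have II r : s <= r <= s + 3 * e -> I r.
  by move=> /andP[r1 r2]; case/andP: Is => s1 s2; case/andP: Ie => t1 t2; apply/andP; split; lra.
have I1 : I (s + e) by apply: II; apply/andP; split; lra.
have I2 : I (s + 2 * e) by apply: II; apply/andP; split; lra.
have Fy r : s <= r <= s + 3 * e -> y <= F r.
  move=> hr; apply: (le_trans yF); apply: F_nd => //; first exact: II.
  by case/andP: hr.
have Gnd r : s + e <= r <= s + 3 * e -> a * y `^ q * e <= G r.
  move=> /andP[r1 r2]; have Ir : I r by apply: II; apply/andP; split; lra.
  have := hG s r y Is Ir _ y0 _.
  have -> : s <= r by lra.
  move=> /(_ isT) h; have {}h : a * y `^ q * (r - s) <= G r - G s.
    by apply: h => x /andP[x1 x2]; apply: Fy; apply/andP; split; lra.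
  have := G0 s Is; have : a * y `^ q * e <= a * y `^ q * (r - s).
    by rewrite ler_wpM2l ?mulr_ge0 ?powR_ge0// ?(ltW a0)//; lra.
  move: h; move: (a * y `^ q * _) (a * y `^ q * _) => X Y; lra.
set y1 := a * y `^ q * e in Gnd *.
have y10 : 0 <= y1 by rewrite !mulr_ge0 ?powR_ge0// ltW.
have Hnd r : s + 2 * e <= r <= s + 3 * e -> b * y1 `^ p * e <= H r.
  move=> /andP[r1 r2]; have Ir : I r by apply: II; apply/andP; split; lra.
  have := hH (s + e) r y1 I1 Ir _ y10 _.
  have -> : s + e <= r by lra.
  move=> /(_ isT) h; have {}h : b * y1 `^ p * (r - (s + e)) <= H r - H (s + e).
    by apply: h => x /andP[x1 x2]; apply: Gnd; apply/andP; split; lra.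
  have := H0 (s + e) I1; have : b * y1 `^ p * e <= b * y1 `^ p * (r - (s + e)).
    by rewrite ler_wpM2l ?mulr_ge0 ?powR_ge0// ?(ltW b0)//; lra.
  move: h; move: (b * y1 `^ p * _) (b * y1 `^ p * _) => X Y; lra.
set y2 := b * y1 `^ p * e in Hnd *.
have y20 : 0 <= y2 by rewrite !mulr_ge0 ?powR_ge0// ltW.
have := hF (s + 2 * e) (s + 3 * e) y2 I2 Ie _ y20 Hnd.
have -> : s + 2 * e <= s + 3 * e by lra.
move=> /(_ isT); rewrite (_ : s + 3 * e - (s + 2 * e) = e); last by ring.
have : 0 <= F (s + 2 * e) by apply: (le_trans y0); apply: Fy; apply/andP; split; lra.
lra.
Qed.

(* Otherwise [F] would exceed [F0 * mu ^ k] at the points [t k], which stay below [s0 + d]. *)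
Lemma blowup : b * a `^ p * (d / 6) `^ (p + 2) * F0 `^ (p * q - 1) < mu.
Proof.
rewrite ltNge; apply/negP => muD.
(* Round [k] uses three intervals of length [e k], that is [d / 2 * 2 ^- k]; over all rounds this
   adds up to [d]. *)
pose e (k : nat) : R := d / 6 * 2 ^- k.
pose t (k : nat) : R := s0 + d * (1 - 2 ^- k).
have p2k (k : nat) : 0 < 2 ^- k :> R by rewrite invr_gt0 exprn_gt0.
have p2k1 (k : nat) : 2 ^- k <= 1 :> R by rewrite invf_le1 ?exprn_gt0// exprn_ege1// ler1n.
have It k : I (t k).
  apply/andP; split; first by rewrite lerDl mulr_ge0 ?(ltW d0)// subr_ge0.
  by rewrite lerD2l ler_piMr ?(ltW d0)// gerBl ltW.
have tS k : t k.+1 = t k + 3 * e k.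
  by rewrite /t /e exprS invfM; field; rewrite expf_neq0.
have mu0 : 0 < mu by exact: lt_le_trans mu2.
have e0 k : 0 < e k by rewrite mulr_gt0// divr_gt0.
have claim k : F0 * mu ^+ k <= F (t k).
  elim: k => [|k ih]; first by rewrite expr0 mulr1 /t expr0 invr1 subrr mulr0 addr0.
  set y := F0 * mu ^+ k in ih.
  have y0 : 0 < y by rewrite mulr_gt0// exprn_gt0.
  rewrite tS; apply: le_trans (blowup_step (t k) (e k) y (It k) _ (ltW (e0 k)) (ltW y0) ih); last first.
    by rewrite -tS.
  (* The first factor is at least [mu] by the assumption refuted here. The second is at least 1
     since the gain [mu^(pq-1)] outweighs the loss [2^(p+2)] caused by halving the lengths. So each
     round multiplies the bound by [mu]. *)
  have -> : b * (a * y `^ q * e k) `^ p * e k * e k =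
     (b * a `^ p * (d / 6) `^ (p + 2) * F0 `^ (p * q - 1)) *
     ((mu `^ (p * q - 1) / 2 `^ (p + 2)) ^+ k) * y.
    have aq0 : 0 <= a * y `^ q by rewrite mulr_ge0 ?powR_ge0// ltW.
    rewrite (powRM _ aq0 (ltW (e0 k))) (powRM _ (ltW a0) (powR_ge0 _ _)) -powRrM (mulrC q).
    have ey : y `^ (p * q) = F0 `^ (p * q - 1) * (mu `^ (p * q - 1)) ^+ k * y.
      rewrite -powR_exprn ?(ltW mu0)// -powRM ?(ltW F00) ?exprn_ge0 ?(ltW mu0)// -/y.
      by rewrite -{3}(powRr1 (ltW y0)) -powRD ?subrK// (gt_eqF y0) implybT.
    have ee : e k `^ p * e k * e k = (d / 6) `^ (p + 2) * ((2 `^ (p + 2)) ^+ k)^-1.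
      have -> : e k `^ p * e k * e k = e k `^ (p + 2).
        rewrite powRD ?(gt_eqF (e0 k)) ?implybT// -mulrA; congr (_ * _).
        by rewrite -[2]/(2%:R) powR_mulrn ?(ltW (e0 k))// expr2.
      have d60 : 0 <= d / 6 by rewrite divr_ge0// ltW.
      by rewrite /e powRM// ?(ltW (p2k k))// powR_invr ?exprn_gt0// powR_exprn.
    rewrite ey exprMn exprVn.
    have -> : b * (a `^ p * (F0 `^ (p * q - 1) * mu `^ (p * q - 1) ^+ k * y) * e k `^ p) * e k * e k =
       b * a `^ p * F0 `^ (p * q - 1) * mu `^ (p * q - 1) ^+ k * y * (e k `^ p * e k * e k) by ring.
    by rewrite ee; ring.
  rewrite exprS mulrCA -/y; apply: ler_pM => //.
  - by rewrite ltW.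
  - by rewrite ltW.
  rewrite -[leLHS]mulr1; apply: ler_pM => //; first by rewrite ltW.
  by rewrite exprn_ege1// ler_pdivlMr ?powR_gt0// mul1r.
have Id : I (s0 + d) by rewrite /I lexx lerDl ltW.
(* Monotonicity carries every bound to the single time [s0 + d], and [mu^k >= 2^k >= k] then
   contradicts the Archimedean property. *)
have Fk (k : nat) : F0 * k%:R <= F (s0 + d).
  apply: (@le_trans _ _ (F (t k))); last by apply: F_nd => //; case/andP: (It k).
  apply: le_trans (claim k); rewrite ler_wpM2l ?(ltW F00)//.
  apply: (@le_trans _ _ (2 ^+ k)); first by rewrite -natrX ler_nat ltnW// ltn_expl.
  by rewrite lerXn2r// nnegrE ?(ltW mu0).
have := Fk (Num.truncn (F (s0 + d) / F0)).+1.
rewrite leNgt => /negP; apply.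
by rewrite -ltr_pdivrMl// mulrC truncnS_gt.
Qed.

End Blowup.

End RealAnalysis.

(** * Blow-up of the moments *)

Section LifespanBound.
Variables (R : realType) (m : nat).
Local Notation n := m.+1.
Local Notation E := (borel_rV R n).
Local Notation leb := (lebesgue_rV R n).
Local Notation mu := (@lebesgue_measure R).

Lemma ae_L1_eq (phi psi : E -> R) : Rn_mfun R n phi -> Rn_mfun R n psi -> L1_eq phi psi ->
  {ae leb, forall x : E, phi x = psi x}.
Proof.
move=> mphi mpsi h; have mB : Rn_mfun R n (fun x => phi x - psi x) by exact: measurable_funB.
have : (\int[leb]_x `|(phi x - psi x)%:E| = 0)%E by rewrite -[RHS]h -iint_abs.
have mEB : measurable_fun setT (fun x : E => (phi x - psi x)%:E) by exact/measurable_EFinP.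
move/(ae_eq_integral_abs _ measurableT mEB); apply: filterS => x /(_ Logic.I) /= [].
by move/eqP; rewrite subr_eq0 => /eqP.
Qed.

Definition volume_const : R := expR 1 * Num.sqrt pi.

(** For [|y| <= L + 1] the cut-off is dominated by [e * exp (- y^2 / (L+1)^2)], of integral
    [volume_const * (L + 1)]. This product bound fits [iint_prod], with the first unit vector as
    [w]. *)
Lemma integral_exp_cut0 (L : R) : 0 <= L ->
  Rn_integrable R n (exp_cut R n L (fun _ => 0)) /\
  Rintegral leb setT (exp_cut R n L (fun _ => 0)) <= (volume_const * (L + 1)) ^+ n.
Proof.
move=> L0; have L10 : 0 < L + 1 by lra.
pose s := (L + 1) ^+ 2 / 4; have s0 : 0 < s by rewrite divr_gt0// exprn_gt0.
have s4 : 4 * s = (L + 1) ^+ 2 by rewrite /s; field.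
pose h (y : R) := expR 1 * expR (- (y - 0) ^+ 2 / (4 * s)).
have h0 y : 0 <= h y by rewrite mulr_ge0 ?expR_ge0.
have mh : measurable_fun setT h.
  apply: measurable_funM => //; apply: measurableT_comp; first exact: measurable_expR.
  apply: measurable_funM => //; apply: measurableT_comp => //.
  by apply: measurable_funX; exact: measurable_funB.
have hint (c : R) : (\int[mu]_y (h (1 * y + c))%:E = (volume_const * (L + 1))%:E)%E.
  under eq_integral => y _.
    rewrite /h (_ : 1 * y + c - 0 = y - - c); last by ring.
    rewrite EFinM; over.
  rewrite ge0_integralZl_EFin ?expR_ge0//.
  - rewrite integral_gauss// -EFinM; congr EFin.
    by rewrite s4 sqrtrM ?sqr_ge0// sqrtr_sqr gtr0_norm// /volume_const; ring.
  - apply/measurable_EFinP; apply: measurableT_comp; first exact: measurable_expR.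
    apply: measurable_funM => //; apply: measurableT_comp => //.
    by apply: measurable_funX; exact: measurable_funB.
have hint1 : (\int[mu]_y (h y)%:E = (volume_const * (L + 1))%:E)%E.
  by rewrite -(hint 0); apply: eq_integral => y _; rewrite mul1r addr0.
pose w (i : 'I_n) : R := if i == ord0 then 1 else 0.
have := @iint_prod R m h (fun _ => h) w 0 _ _ h0 (fun _ => h0) mh (fun _ => mh).
have -> : w ord0 = 1 by rewrite /w eqxx.
move=> /(_ _ _ hint (fun _ => hint1)).
set W := (fun x : E => _) => iW.
have XW x : ((exp_cut R n L (fun _ => 0) x)%:E <= W x)%E.
  rewrite /W lee_fin addr0 (_ : \sum_j w j * x ord0 j = x ord0 ord0); last first.
    rewrite big_ord_recl /w eqxx mul1r big1 ?addr0// => i _.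
    by rewrite (_ : (lift ord0 i == ord0) = false) ?mul0r//; apply/negbTE.
  have -> : h (x ord0 ord0) * \prod_(j < m) h (x ord0 (lift ord0 j)) = \prod_(j < n) h (x ord0 j).
    by rewrite big_ord_recl.
  apply: ler_prod => j _; rewrite exp_plateau_ge0 /=.
  have [->|] := eqVneq (exp_plateau R L 0 (x ord0 j)) 0; first exact: h0.
  move/exp_plateau_neq0 => xL; apply: (@le_trans _ _ 1).
    by rewrite /exp_plateau mul0r expR0 mulr1 plateau_le1.
  rewrite /h -expRD subr0 s4 -[leLHS]expR0 ler_expR mulNr subr_ge0 ler_pdivrMr ?exprn_gt0// mul1r.
  by rewrite -real_normK ?num_real// ler_pXn2r// nnegrE ltW.
have mX := mfun_exp_cut R n L (fun _ => 0).
have mEX : measurable_fun setT (fun x : E => (exp_cut R n L (fun _ => 0) x)%:E) by exact/measurable_EFinP.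
have mW : measurable_fun setT W.
  apply/measurable_EFinP; apply: measurable_funM.
    apply: measurableT_comp; first exact: mh.
    by apply: measurable_funD => //; exact: mfun_dot.
  apply: measurable_prod => j _; apply: measurableT_comp; [exact: mh|exact: measurable_coord].
have X0 x : (0 <= (exp_cut R n L (fun _ => 0) x)%:E)%E by rewrite lee_fin exp_cut_ge0.
have W0 x : (0 <= W x)%E by exact: le_trans (X0 x) (XW x).
have le : (\int[leb]_x (exp_cut R n L (fun _ => 0) x)%:E <= ((volume_const * (L + 1)) ^+ n)%:E)%E.
  by rewrite exprS -iW iintE//; apply: ge0_le_integral.
have int : Rn_integrable R n (exp_cut R n L (fun _ => 0)).
  apply/Rn_integrableP => //.
  under eq_integral do rewrite ger0_norm ?exp_cut_ge0//.
  by rewrite (le_lt_trans le)// ltry.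
split => //; rewrite /Rintegral -lee_fin fineK//; exact: integrable_fin_num.
Qed.

(** The exponent applied later, [m / 2 * (2 - p)], has the sign of [2 - p]; the minimum treats both
    signs at once. *)
Lemma powR_range (b tau rho : R) : 0 < tau -> tau <= rho -> rho <= 4 * tau ->
  Num.min 1 (4 `^ b) * tau `^ b <= rho `^ b.
Proof.
move=> t0 tr r4; have rho0 : 0 < rho by exact: lt_le_trans tr.
have [b0|b0] := leP 0 b.
  apply: (@le_trans _ _ (tau `^ b)); first by rewrite ler_piMl ?powR_ge0// ge_min lexx.
  by apply: ge0_ler_powR => //; rewrite nnegrE ltW.
apply: (@le_trans _ _ ((4 * tau) `^ b)).
  by rewrite powRM ?(ltW t0)// ler_wpM2r ?powR_ge0// ge_min lexx orbT.
have h : rho `^ (- b) <= (4 * tau) `^ (- b).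
  by apply: ge0_ler_powR; rewrite ?oppr_ge0 ?nnegrE ?(ltW b0) ?(ltW rho0) ?mulr_ge0 ?(ltW t0).
by rewrite -(opprK b) (powRN rho) (powRN (4 * tau)) lef_pV2 ?posrE ?powR_gt0 ?mulr_gt0.
Qed.

Variables (p q : R).
Hypotheses (p1 : 1 < p) (q1 : 1 < q).
Variables (f g ft gt : E -> R) (I0 : R).
Hypotheses (f0 : forall x, 0 <= f x) (g0 : forall x, 0 <= g x).
Hypotheses (ft0 : forall x, 0 <= ft x) (gt0 : forall x, 0 <= gt x).
Hypotheses (mf : Rn_mfun R n f) (mg : Rn_mfun R n g) (mft : Rn_mfun R n ft) (mgt : Rn_mfun R n gt).
Hypotheses (I0pos : 0 < I0) (I0le : (I0%:E <= iint (fun x : E => (f x + g x)%:E))%E).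

(** * Moments of one solution up to a time [sg] before [T] *)

Section Solution.
Variables (eps : R) (T : \bar R) (u ut v vt : R -> E -> R).
Hypotheses (eps0 : 0 < eps) (T0 : (0 < T)%E).
Hypothesis sol : weak_solution p q T u ut v vt.
Hypotheses (u_0 : L1_eq (u 0) (fun x => eps * f x)) (ut_0 : L1_eq (ut 0) (fun x => eps * g x)).
Hypotheses (v_0 : L1_eq (v 0) (fun x => eps * ft x)) (vt_0 : L1_eq (vt 0) (fun x => eps * gt x)).
Hypotheses (cone_u : in_cone T u) (cone_v : in_cone T v) (cone_ut : in_cone T ut).

Let dtu : is_dt T u ut. Proof. by case: sol. Qed.
Let dtv : is_dt T v vt. Proof. by case: sol. Qed.
Let cu : contL 1 (Ico0 T) u. Proof. by case: sol => _ _ _ _ []. Qed.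
Let cv : contL 1 (Ico0 T) v. Proof. by case: sol => _ _ _ _ []. Qed.
Let cut : contL 1 (Ico0 T) ut. Proof. by case: sol => _ _ _ _ []. Qed.
Let cvt : contL 1 (Ico0 T) vt. Proof. by case: sol => _ _ _ _ []. Qed.
Let cvq : contL q (Ioo0 T) v. Proof. by case: sol => _ _ _ _ [_ _ _ _ []]. Qed.
Let cutp : contL p (Ioo0 T) ut. Proof. by case: sol => _ _ _ _ [_ _ _ _ []]. Qed.

Let vq (s : R) (x : E) := `|v s x| `^ q.
Let utp (s : R) (x : E) := `|ut s x| `^ p.

Let Ico_0 : Ico0 T 0. Proof. by split. Qed.

Let initial_ge0 (w : R -> E -> R) (d : E -> R) X K : contL 1 (Ico0 T) w -> Rn_mfun R n d ->
  (forall x, 0 <= d x) -> L1_eq (w 0) (fun x => eps * d x) ->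
  Rn_mfun R n X -> (forall x, 0 <= X x <= K) -> 0 <= moment R n X w 0.
Proof.
move=> cw md d0 wd mX XK.
have iw := inL1_integrable R n _ (cw.1 0 Ico_0); have mw := Rn_integrable_mfun R n _ iw.
have XK' x : `|X x| <= K by case/andP: (XK x) => h1 h2; rewrite ger0_norm.
have med : Rn_mfun R n (fun x => eps * d x) by exact: measurable_funM.
have ae := ae_L1_eq _ _ mw med wd.
have [_ <-] : Rn_integrable R n (fun x => eps * d x * X x) /\
    Rintegral leb setT (fun x => eps * d x * X x) = moment R n X w 0.
  apply: ae_eq_Rintegral; first exact: measurable_funM.
    exact: Rn_integrableM iw mX XK'.
  by apply: filterS ae => x ->.
apply: Rintegral_ge0 => x _; rewrite !mulr_ge0// ?(ltW eps0)//.
by case/andP: (XK x).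
Qed.

(** At time 0 the cone is the unit ball, where [e^{x.w} >= e^{-1}] for [|w| = 1]; restricting the
    data to that ball loses nothing almost everywhere. *)
Let initial_lower L (w : 'I_n -> R) : 1 <= L -> \sum_j w j ^+ 2 = 1 ->
  eps * expR (- 1) * I0 <= moment R n (exp_cut R n L w) u 0 + moment R n (exp_cut R n L w) ut 0.
Proof.
move=> L1 w1; pose X := exp_cut R n L w.
have [K hK] := exp_cut_bounded R n L w (le_trans ler01 L1).
have mX : Rn_mfun R n X by exact: mfun_exp_cut.
have XK x : `|X x| <= K by case/andP: (hK x) => h1 h2; rewrite ger0_norm.
have iu := inL1_integrable R n _ (cu.1 0 Ico_0); have iut := inL1_integrable R n _ (cut.1 0 Ico_0).
have mu0 := Rn_integrable_mfun R n _ iu; have mut := Rn_integrable_mfun R n _ iut.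
rewrite /moment -Rn_RintegralD; [|exact: Rn_integrableM iu mX XK|exact: Rn_integrableM iut mX XK].
pose P (x : E) := eps * (f x + g x).
pose S (x : E) := if enorm x <= 1 then P x else 0.
have mP : Rn_mfun R n P by apply: measurable_funM => //; exact: measurable_funD.
have P0 x : 0 <= P x by rewrite mulr_ge0 ?(ltW eps0)// addr_ge0.
have mS : Rn_mfun R n S.
  by apply: measurable_fun_ifT => //; apply: measurable_fun_ler => //; exact: mfun_enorm.
have S0 x : 0 <= S x by rewrite /S; case: ifP.
have mef : Rn_mfun R n (fun x => eps * f x) by exact: measurable_funM.
have meg : Rn_mfun R n (fun x => eps * g x) by exact: measurable_funM.
have aeP : {ae leb, forall x : E, P x = u 0 x + ut 0 x}.
  apply: filterS2 (ae_L1_eq _ _ mu0 mef u_0) (ae_L1_eq _ _ mut meg ut_0) => x -> ->.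
  by rewrite /P mulrDr.
have aeS : {ae leb, forall x : E, S x = u 0 x + ut 0 x}.
  have c1 := ae_cone R n (0 + 1) (u 0) mu0 (cone_u 0 Ico_0).
  have c2 := ae_cone R n (0 + 1) (ut 0) mut (cone_ut 0 Ico_0).
  apply: filterS3 aeP c1 c2 => x xP; rewrite add0r => xu xut; rewrite /S.
  by case: leP => // x1; rewrite xu// xut// addr0.
have iuut : Rn_integrable R n (fun x => u 0 x + ut 0 x) by exact: Rn_integrableD.
have [iS _] := ae_eq_Rintegral R n _ _ mS iuut aeS.
have iSX : Rn_integrable R n (fun x => S x * X x) by exact: Rn_integrableM iS mX XK.
have [_ <-] : Rn_integrable R n (fun x => S x * X x) /\
    Rintegral leb setT (fun x => S x * X x) = Rintegral leb setT (fun x => u 0 x * X x + ut 0 x * X x).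
  apply: ae_eq_Rintegral; first exact: measurable_funM.
    by apply: Rn_integrableD; [exact: Rn_integrableM iu mX XK|exact: Rn_integrableM iut mX XK].
  by apply: filterS aeS => x ->; rewrite mulrDl.
apply: (@le_trans _ _ (Rintegral leb setT (fun x => expR (- 1) * S x))); last first.
  apply: le_Rn_integral => //; first exact: Rn_integrableZ.
  move=> x; rewrite mulrC; have [x1|x1] := leP (enorm x) 1; last first.
    have -> : S x = 0 by rewrite /S leNgt x1.
    by rewrite !mul0r.
  rewrite ler_wpM2l// /X exp_cutE ?(le_trans x1)// ler_expR.
  have x2 : \sum_(i < n) x ord0 i ^+ 2 <= 1.
    have s0 : 0 <= \sum_(i < n) x ord0 i ^+ 2 by apply: sumr_ge0 => i _; exact: sqr_ge0.
    by rewrite -(sqr_sqrtr s0) -(expr1n R 2) ler_pXn2r// ?nnegrE ?sqrtr_ge0.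
  (* Expanding [|w + x|^2 >= 0] with [|w| = 1] and [|x| <= 1] gives [w.x >= -1]. *)
  have : 0 <= \sum_(i < n) (w i + x ord0 i) ^+ 2 by apply: sumr_ge0 => i _; exact: sqr_ge0.
  under eq_bigr do rewrite sqrrD.
  rewrite !big_split /= w1.
  have key (y z : R) : y <= 1 -> 0 <= 1 + (z + z) + y -> - 1 <= z by lra.
  exact: key.
rewrite RintegralZl// mulrAC mulrC ler_wpM2l ?expR_ge0//.
rewrite /Rintegral -lee_fin fineK; last exact: integrable_fin_num.
have -> : (\int[leb]_x (S x)%:E = \int[leb]_x (P x)%:E)%E.
  apply: ae_eq_integral => //; [exact/measurable_EFinP|exact/measurable_EFinP|].
  by apply: filterS2 aeS aeP => x -> -> _.
have mfg : measurable_fun setT (fun x : E => (f x + g x)%:E).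
  by apply/measurable_EFinP; exact: measurable_funD.
rewrite /P; under eq_integral do rewrite EFinM.
rewrite ge0_integralZl_EFin ?(ltW eps0)//; last by move=> x _; rewrite lee_fin addr_ge0.
rewrite EFinM lee_wpmul2l ?lee_fin ?(ltW eps0)//.
by rewrite -iintE// => x; rewrite lee_fin addr_ge0.
Qed.

Variable sg : R.
Hypotheses (sg0 : 0 < sg) (sgT : (sg%:E < T)%E).

Let Ioo_sg t : 0 < t -> t < sg -> Ioo0 T t.
Proof. by move=> t0 ts; split => //; rewrite (lt_trans _ sgT)// lte_fin. Qed.
Let Ico_sg t : 0 <= t -> t < sg -> Ico0 T t.
Proof. by move=> t0 ts; split => //; rewrite (lt_trans _ sgT)// lte_fin. Qed.

Let L := sg + 2.
Let X w := exp_cut R n L w.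
Let L0 : 0 <= L. Proof. by rewrite /L addr_ge0// ltW. Qed.

Let cont_source (r : R) (w : 'I_n -> R) (y : R -> E -> R) : 1 < r -> contL r (Ioo0 T) y ->
  cont_on R 0 sg (moment R n (X w) (fun s x => `|y s x| `^ r)).
Proof.
move=> r1 cy; have [K hK] := exp_cut_bounded R n L w L0.
apply: econt_cont_on Ioo_sg.
exact: (econt_pow_pairing R n _ r y (X w) K (ltW r1) cy (mfun_exp_cut R n L w) hK).
Qed.

Let within_moment w (y : R -> E -> R) s t : contL 1 (Ico0 T) y -> 0 <= s -> t < sg ->
  {within `[s, t], continuous (moment R n (X w) y)}.
Proof.
move=> cy s0 tsg; apply: (@econt_within R (Ico0 T)).
  exact: (econt_moment R n T w sg sg0 y cy).
by move=> r /andP[sr rt]; apply: Ico_sg; [exact: le_trans sr|exact: le_lt_trans tsg].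
Qed.

Let derive_u w t : 0 < t -> t < sg ->
  is_derive t 1 (moment R n (X w) u) (moment R n (X w) ut t).
Proof. exact: is_derive_moment sg0 sgT cu cut dtu t. Qed.

Let derive_v w t : 0 < t -> t < sg ->
  is_derive t 1 (moment R n (X w) v) (moment R n (X w) vt t).
Proof. exact: is_derive_moment sg0 sgT cv cvt dtv t. Qed.

Let derive_ut w t : 0 < t -> t < sg -> is_derive t 1 (moment R n (X w) ut)
  (moment R n (X w) vq t + (\sum_j w j ^+ 2) * moment R n (X w) u t).
Proof.
move=> t0 ts; apply: (is_derive_wave R n T u ut vq w sg sg0 sgT cu cut dtu _ _ cone_u _ t t0 ts).
- by move=> s Is; exact: inL_integrable (cvq.1 s Is).
- exact: cont_source.
- by case: sol.
Qed.

Let derive_vt w t : 0 < t -> t < sg -> is_derive t 1 (moment R n (X w) vt)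
  (moment R n (X w) utp t + (\sum_j w j ^+ 2) * moment R n (X w) v t).
Proof.
move=> t0 ts; apply: (is_derive_wave R n T v vt utp w sg sg0 sgT cv cvt dtv _ _ cone_v _ t t0 ts).
- by move=> s Is; exact: inL_integrable (cutp.1 s Is).
- exact: cont_source.
- by case: sol.
Qed.

(** [exponential_growth] gives a quarter of the initial bound times [e^t]; dividing by the
    normalisation [e^{t+1}] of the weight removes the growth and leaves a second factor [e^{-1}]
    beside that of the initial data. *)
Let direction_lower (w : 'I_n -> R) t : \sum_j w j ^+ 2 = 1 -> 1 <= t -> t < sg ->
  eps * (expR (- 2) * I0 / 4) <= Rintegral leb setT (fun x => `|ut t x| * dir_weight R m (t + 1) w x).
Proof.
move=> w1 t1 tsg; have t0 : 0 < t by exact: lt_le_trans t1.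
pose c1 := eps * expR (- 1) * I0.
have c10 : 0 <= c1 by rewrite !mulr_ge0 ?expR_ge0// ltW.
have [K hK] := exp_cut_bounded R n L w L0.
have mX : Rn_mfun R n (X w) by exact: mfun_exp_cut.
have XK x : `|X w x| <= K by case/andP: (hK x) => h1 h2; rewrite ger0_norm.
have L1 : 1 <= L by rewrite /L; move: sg0; lra.
have gr : c1 / 4 * expR t <= moment R n (X w) ut t.
  apply: (exponential_growth R (moment R n (X w) u) (moment R n (X w) ut) (moment R n (X w) vq)) => //.
  - exact: within_moment.
  - exact: within_moment.
  - by move=> r r0 rt; apply: derive_u => //; exact: lt_trans tsg.
  - move=> r r0 rt; have := derive_ut w r r0 (lt_trans rt tsg).
    by rewrite w1 mul1r.
  - move=> r _ _; apply: Rintegral_ge0 => x _; rewrite mulr_ge0 ?powR_ge0//.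
    by case/andP: (hK x).
  - exact: initial_lower.
  - exact: (initial_ge0 ut g (X w) K).
have It : Ico0 T t by apply: Ico_sg => //; exact: ltW.
have iut := inL1_integrable R n _ (cut.1 t It); have mut := Rn_integrable_mfun R n _ iut.
have md := mfun_dir_weight R m (t + 1) w.
have rho0 : 0 < t + 1 by rewrite addr_gt0.
have d1 x : `|dir_weight R m (t + 1) w x| <= 1.
  rewrite ger0_norm ?dir_weight_ge0// (le_trans (dir_weight_le_gauss _ _ _ _ _ rho0 w1))//.
  by rewrite expR_le1 mulNr oppr_le0 divr_ge0 ?tail_sq_ge0// mulr_ge0// ltW.
have iud := Rn_integrableM R n _ _ _ iut md d1.
have iad := Rn_integrableM R n _ _ _ (Rn_integrable_norm R n _ iut) md d1.
have [_ E1] : Rn_integrable R n (fun x => ut t x * X w x) /\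
    Rintegral leb setT (fun x => ut t x * X w x) =
    Rintegral leb setT (fun x => expR (t + 1) * (ut t x * dir_weight R m (t + 1) w x)).
  apply: ae_eq_Rintegral; [exact: measurable_funM|exact: Rn_integrableZ|].
  have := ae_cone R n (t + 1) (ut t) mut (cone_ut t It).
  apply: filterS => x hx; rewrite /dir_weight.
  case: leP => xt; last by rewrite hx// !mul0r mulr0.
  rewrite mulrCA -expRD subrKC /X exp_cutE//.
  by rewrite (le_trans xt)// /L; move: tsg; lra.
move: gr; rewrite /moment E1 RintegralZl// => gr.
have le1 : Rintegral leb setT (fun x => ut t x * dir_weight R m (t + 1) w x) <=
    Rintegral leb setT (fun x => `|ut t x| * dir_weight R m (t + 1) w x).
  by apply: le_Rn_integral => // x; rewrite ler_wpM2r ?dir_weight_ge0// ler_norm.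
apply: le_trans le1; rewrite -(ler_pM2l (expR_gt0 (t + 1))); apply: le_trans gr.
rewrite /c1 (_ : expR (- 2) = expR (- 1) * expR (- 1)); last by rewrite -expRD; congr expR; ring.
rewrite expRD.
have -> : expR t * expR 1 * (eps * (expR (-1) * expR (-1) * I0 / 4)) =
   eps * expR (- 1) * I0 / 4 * expR t * (expR 1 * expR (- 1)) by ring.
by rewrite -expRD subrr expR0 mulr1.
Qed.

Let w0 : 'I_n -> R := fun _ => 0.
Let F := moment R n (X w0) v.
Let G := moment R n (X w0) ut.
Let H := moment R n (X w0) vt.

Let X0_01 x : 0 <= X w0 x <= 1.
Proof.
rewrite exp_cut_ge0 /=; apply: prodr_ile1 => j _; rewrite exp_plateau_ge0 /=.
by rewrite /exp_plateau mul0r expR0 mulr1 plateau_le1.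
Qed.

Let incr_F s t y : 0 <= s -> t < sg -> s <= t -> (forall r, s <= r <= t -> y <= H r) ->
  y * (t - s) <= F t - F s.
Proof.
move=> s0 tsg st yH; apply: (increment_ge R F H) => //; first exact: within_moment.
  by move=> r sr rt; apply: derive_v; [exact: le_lt_trans sr|exact: lt_trans tsg].
by move=> r sr rt; apply: yH; rewrite !ltW.
Qed.

Let lam0 : \sum_j w0 j ^+ 2 = 0.
Proof. by rewrite big1// => j _; rewrite /w0 expr0n. Qed.

Let incr_G s t c : 0 <= s -> t < sg -> s <= t ->
  (forall r, s < r -> r < t -> c <= moment R n (X w0) vq r) -> c * (t - s) <= G t - G s.
Proof.
move=> s0 tsg st cN; apply: (increment_ge R G (moment R n (X w0) vq)) => //; first exact: within_moment.
move=> r sr rt; have := derive_ut w0 r (le_lt_trans s0 sr) (lt_trans rt tsg).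
by rewrite lam0 mul0r addr0.
Qed.

Let incr_H s t c : 0 <= s -> t < sg -> s <= t ->
  (forall r, s < r -> r < t -> c <= moment R n (X w0) utp r) -> c * (t - s) <= H t - H s.
Proof.
move=> s0 tsg st cN; apply: (increment_ge R H (moment R n (X w0) utp)) => //; first exact: within_moment.
move=> r sr rt; have := derive_vt w0 r (le_lt_trans s0 sr) (lt_trans rt tsg).
by rewrite lam0 mul0r addr0.
Qed.

Let source_ge0 (r : R) (y : R -> E -> R) s : 0 <= moment R n (X w0) (fun s x => `|y s x| `^ r) s.
Proof.
by apply: Rintegral_ge0 => x _; rewrite mulr_ge0 ?powR_ge0//; case/andP: (X0_01 x).
Qed.

Let mX0 : Rn_mfun R n (X w0). Proof. exact: mfun_exp_cut. Qed.

Let G_ge0 t : 0 <= t -> t < sg -> 0 <= G t.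
Proof.
move=> t0 tsg; have G00 : 0 <= G 0 by exact: (initial_ge0 ut g _ 1).
have := incr_G 0 t 0 (lexx 0) tsg t0 (fun r _ _ => source_ge0 q v r).
by rewrite mul0r subr_ge0; exact: le_trans.
Qed.

Let H_ge0 t : 0 <= t -> t < sg -> 0 <= H t.
Proof.
move=> t0 tsg; have H00 : 0 <= H 0 by exact: (initial_ge0 vt gt _ 1).
have := incr_H 0 t 0 (lexx 0) tsg t0 (fun r _ _ => source_ge0 p ut r).
by rewrite mul0r subr_ge0; exact: le_trans.
Qed.

Let F_ge0 t : 0 <= t -> t < sg -> 0 <= F t.
Proof.
move=> t0 tsg; have F00 : 0 <= F 0 by exact: (initial_ge0 v ft _ 1).
have := incr_F 0 t 0 (lexx 0) tsg t0 _.
rewrite mul0r subr_ge0 => h; apply: (le_trans F00); apply: h => r /andP[r0 rt].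
by apply: H_ge0 => //; exact: le_lt_trans tsg.
Qed.

(** Jensen with the cut-off itself as weight; its mass, comparable to the volume of a ball, is the
    price for passing from a moment to the r-th power. *)
Let source_jensen (r y M : R) (z : R -> E -> R) t : 1 < r -> contL r (Ioo0 T) z ->
  contL 1 (Ico0 T) z -> 0 < t -> t < sg -> 0 <= y -> y <= moment R n (X w0) z t ->
  0 < M -> Rintegral leb setT (X w0) <= M ->
  M `^ (1 - r) * y `^ r <= moment R n (X w0) (fun s x => `|z s x| `^ r) t.
Proof.
move=> r1 czr cz t0 tsg y0 yz M0 XM; rewrite mulrC.
have XK x : `|X w0 x| <= 1 by case/andP: (X0_01 x) => h1 h2; rewrite ger0_norm.
have iz := inL1_integrable R n _ (cz.1 t (Ico_sg _ (ltW t0) tsg)).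
have izr := inL_integrable R n _ _ (czr.1 t (Ioo_sg _ t0 tsg)).
have [iX _] := integral_exp_cut0 L L0.
have iaz := Rn_integrableM R n _ _ _ (Rn_integrable_norm R n _ iz) mX0 XK.
apply: (@jensen_weight R m r y M (z t) (X w0)) => //.
- by move=> x; case/andP: (X0_01 x).
- exact: Rn_integrableM izr mX0 XK.
- apply: (le_trans yz); apply: le_Rn_integral => //.
    exact: Rn_integrableM iz mX0 XK.
  by move=> x; rewrite ler_wpM2r ?ler_norm//; case/andP: (X0_01 x).
Qed.

(** Three stages fit below [5 * tau]: concentration bounds the source of [H] on [[tau, 3 tau]]; two
    integrations over lengths [tau] bound [F (3 tau)]; [blowup] runs on [[3 tau, 4 tau]]. The margin
    beyond [4 tau] is there because derivatives of moments are known only strictly before [sg]. [K]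
    enters through its property, so it is fixed before [eps] and the solution. *)
Lemma lifespan_bound_at (K tau : R) :
  (forall (rho c : R) (phi : E -> R), 1 <= rho -> 0 <= c ->
    Rn_integrable R n (fun x => `|phi x| `^ p) -> Rn_integrable R n phi ->
    (forall w : 'I_n -> R, \sum_j w j ^+ 2 = 1 ->
       c <= Rintegral leb setT (fun x => `|phi x| * dir_weight R m rho w x)) ->
    K * c `^ p * (Num.sqrt rho ^+ m) `^ (2 - p) <=
    Rintegral leb setT (fun x => `|phi x| `^ p * (if enorm x <= rho then 1 else 0))) ->
  0 < K -> 1 <= tau -> sg = 5 * tau ->
  forall M b mu0 : R, M = (8 * volume_const * tau) ^+ n -> b = m%:R / 2 * (2 - p) ->
  2 <= mu0 -> 2 `^ (p + 2) <= mu0 `^ (p * q - 1) ->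
  M `^ (1 - p) * (M `^ (1 - q)) `^ p * (tau / 6) `^ (p + 2) *
  (K * (eps * (expR (- 2) * I0 / 4)) `^ p * (Num.min 1 (4 `^ b) * tau `^ b) * tau * tau) `^ (p * q - 1) < mu0.
Proof.
move=> HK K0 tau1 sgE M b mu0 ME bE mu02 mu0pq.
have tau0 : 0 < tau by exact: lt_le_trans tau1.
have vc0 : 0 < volume_const by rewrite mulr_gt0 ?expR_gt0// sqrtr_gt0 pi_gt0.
have M0 : 0 < M by rewrite ME; apply: exprn_gt0; apply: mulr_gt0 => //; apply: mulr_gt0.
(* [L + 1 = 5 * tau + 3 <= 8 * tau] because [tau >= 1]; hence the 8 in [M]. *)
have XM : Rintegral leb setT (X w0) <= M.
  have [_ h] := integral_exp_cut0 L L0; apply: (le_trans h).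
  rewrite ME; apply: lerXn2r.
  - by rewrite nnegrE mulr_ge0 ?(ltW vc0)// addr_ge0.
  - by rewrite nnegrE !mulr_ge0 ?(ltW vc0)// ltW.
  rewrite (_ : 8 * volume_const * tau = volume_const * (8 * tau)); last by rewrite (mulrC 8) -(mulrA volume_const).
  rewrite ler_pM2l// /L sgE.
  by move: tau1; lra.
pose c := eps * (expR (- 2) * I0 / 4).
have c0 : 0 < c by rewrite mulr_gt0// divr_gt0// mulr_gt0// expR_gt0.
pose n2 := K * c `^ p * (Num.min 1 (4 `^ b) * tau `^ b).
have n20 : 0 < n2.
  by rewrite !mulr_gt0 ?powR_gt0// lt_min ltr01 powR_gt0.
have low t : tau <= t -> t <= 3 * tau -> n2 <= moment R n (X w0) utp t.
  move=> tt t3; have t1 : 1 <= t by exact: le_trans tt.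
  have t0 : 0 < t by exact: lt_le_trans tt.
  have tsg : t < sg by rewrite sgE; move: t3 tau0; lra.
  have rho1 : 1 <= t + 1 by rewrite lerDr ltW.
  have iut := inL1_integrable R n _ (cut.1 t (Ico_sg _ (ltW t0) tsg)).
  have iutp := inL_integrable R n _ _ (cutp.1 t (Ioo_sg _ t0 tsg)).
  have h := HK (t + 1) c (ut t) rho1 (ltW c0) iutp iut (fun w w1 => direction_lower w t w1 t1 tsg).
  have XK x : `|X w0 x| <= 1 by case/andP: (X0_01 x) => h1 h2; rewrite ger0_norm.
  apply: (@le_trans _ _ (Rintegral leb setT (fun x => `|ut t x| `^ p * (if enorm x <= t + 1 then 1 else 0)))); last first.
    apply: le_Rn_integral; last first.
    - move=> x; rewrite ler_wpM2l ?powR_ge0//; case: ifP => xt; last by case/andP: (X0_01 x).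
      rewrite /X exp_cutE; last by rewrite (le_trans xt)// /L; move: tsg; lra.
      by rewrite big1 ?expR0// => j _; rewrite /w0 mul0r.
    - exact: Rn_integrableM iutp mX0 XK.
    - apply: (@Rn_integrableM R n _ _ 1) => //.
        by apply: measurable_fun_ifT => //; apply: measurable_fun_ler => //; exact: mfun_enorm.
      by move=> x; case: ifP; rewrite ?normr1 ?normr0.
  apply: le_trans h; rewrite /n2 ler_wpM2l ?mulr_ge0 ?powR_ge0 ?(ltW K0)//.
  have -> : (Num.sqrt (t + 1) ^+ m) `^ (2 - p) = (t + 1) `^ b.
    rewrite -powR12_sqrt ?(le_trans ler01 rho1)// -powR_mulrn ?powR_ge0// -!powRrM bE.
    by congr (_ `^ _); field.
  apply: powR_range => //; first by rewrite (le_trans tt)// lerDl.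
  by move: t3 tau1; lra.
have in0 r : 3 * tau <= r <= 3 * tau + tau -> 0 <= r /\ r < sg.
  by move=> /andP[r1 r2]; rewrite sgE; split; move: r1 r2 tau0; lra.
have in0' r : 0 <= r -> r <= 4 * tau -> r < sg.
  by move=> r1 r2; rewrite sgE; move: r1 r2 tau0; lra.
apply: (@blowup R F G H (3 * tau) tau (M `^ (1 - q)) (M `^ (1 - p)) (n2 * tau * tau) p q mu0) => //.
- by rewrite powR_gt0.
- by rewrite powR_gt0.
- by apply: mulr_gt0 => //; exact: mulr_gt0.
- by move=> r /in0[r0 rs]; exact: G_ge0.
- by move=> r /in0[r0 rs]; exact: H_ge0.
(* The starting value: the source bound [n2] gives [H >= n2 * tau] on [[2 tau, 3 tau]], which
   integrates to [F (3 tau) >= n2 * tau * tau]. *)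
- have t20 : 0 <= 2 * tau by rewrite mulr_ge0// ltW.
  have H2 r : 2 * tau <= r <= 3 * tau -> n2 * tau <= H r.
    move=> /andP[r2 r3].
    have rs : r < sg by rewrite sgE; move: r3 tau0; lra.
    have tr : tau <= r by move: r2 tau0; lra.
    have := incr_H tau r n2 (ltW tau0) rs tr _.
    move=> /(_ _)/le_trans h; apply: (@le_trans _ _ (n2 * (r - tau))).
      by rewrite ler_wpM2l ?(ltW n20)//; move: r2; lra.
    apply: h.
      by move=> x x1 x2; apply: low; [exact: ltW|exact: le_trans (ltW x2) r3].
    have ts : tau < sg by exact: le_lt_trans rs.
    by rewrite lerBlDr lerDl; apply: H_ge0 => //; exact: ltW.
  have s3 : 3 * tau < sg by apply: in0'; move: tau0; lra.
  have := incr_F (2 * tau) (3 * tau) (n2 * tau) t20 s3 _ H2.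
  have -> : 2 * tau <= 3 * tau by move: tau0; lra.
  move=> /(_ isT); rewrite (_ : 3 * tau - 2 * tau = tau); last by ring.
  have : 0 <= F (2 * tau) by apply: F_ge0 => //; apply: in0' => //; move: tau0; lra.
  move: (n2 * tau * tau) => A; lra.
- move=> s t y /in0[s0 _] /in0[_ ts] st y0 yF; apply: incr_G => // r sr rt.
  apply: source_jensen => //; first exact: le_lt_trans sr.
    exact: lt_trans ts.
  by apply: yF; rewrite !ltW.
- move=> s t y /in0[s0 _] /in0[_ ts] st y0 yG; apply: incr_H => // r sr rt.
  apply: source_jensen => //; first exact: le_lt_trans sr.
    exact: lt_trans ts.
  by apply: yG; rewrite !ltW.
- by move=> s t y /in0[s0 _] /in0[_ ts] st y0 yH; exact: incr_F.
Qed.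

End Solution.
End LifespanBound.

(** * The lifespan estimate *)

(** Both sides are positive, so taking logarithms reduces the claim to a polynomial identity in the
    logarithms and exponents. [c5] depends on neither [eps] nor [tau]. *)
Lemma collect_powers (R : realType) (n : nat) (p q V K c A b : R) :
  0 < V -> 0 < K -> 0 < c -> 0 < A ->
  exists2 c5 : R, 0 < c5 & forall eps tau : R, 0 < eps -> 0 < tau ->
    ((V * tau) ^+ n) `^ (1 - p) * (((V * tau) ^+ n) `^ (1 - q)) `^ p * (tau / 6) `^ (p + 2) *
    (K * (eps * c) `^ p * (A * tau `^ b) * tau * tau) `^ (p * q - 1) =
    c5 * eps `^ (p * (p * q - 1)) * tau `^ (n%:R * (1 - p * q) + (p + 2) + (b + 2) * (p * q - 1)).
Proof.
move=> V0 K0 c0 A0.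
exists (expR (n%:R * (1 - p * q) * ln V - (p + 2) * ln 6 + (p * q - 1) * (ln K + p * ln c + ln A))).
  exact: expR_gt0.
move=> eps tau e0 t0; have Vt : 0 < V * tau by exact: mulr_gt0.
have ec : 0 < eps * c by exact: mulr_gt0.
have Vtn : 0 < (V * tau) ^+ n by exact: exprn_gt0.
have t6 : 0 < tau / 6 by exact: divr_gt0.
have K2 : 0 < K * (eps * c) `^ p * (A * tau `^ b) * tau * tau by rewrite !mulr_gt0 ?powR_gt0.
apply: ln_inj; rewrite ?posrE ?mulr_gt0 ?powR_gt0 ?expR_gt0 ?mulr_gt0 ?powR_gt0//.
have K1 : 0 < K * (eps * c) `^ p by rewrite mulr_gt0// powR_gt0.
have A1 : 0 < A * tau `^ b by rewrite mulr_gt0// powR_gt0.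
rewrite !lnM ?posrE ?mulr_gt0 ?powR_gt0 ?expR_gt0 ?invr_gt0//.
rewrite !ln_powR expRK !lnM ?posrE ?mulr_gt0 ?powR_gt0 ?invr_gt0// !ln_powR lnV ?posrE//.
have -> : ln ((V * tau) ^+ n) = n%:R * (ln V + ln tau) by rewrite lnXn// lnM ?posrE// mulr_natl.
rewrite (lnM _ _ : ln (eps * c) = ln eps + ln c) ?posrE//.
ring.
Qed.

Theorem theorem1p1 (R : realType) (n : nat) (p q : R)
    (f g ft gt : 'rV[R]_n -> R) :
  (2 <= n)%N -> 1 < q -> 1 < p -> p < 2 * n%:R / (n%:R - 1) ->
  ((n%:R - 1) / 2 * p - 1) * (p * q - 1) < p + 2 ->
  (forall x, 0 <= f x) -> (forall x, 0 <= g x) ->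
  (forall x, 0 <= ft x) -> (forall x, 0 <= gt x) ->
  Rn_measurable f -> Rn_measurable g -> Rn_measurable ft -> Rn_measurable gt ->
  (iint (fun x => (f x + g x)%:E) != 0)%E ->
  (iint (fun x => (gt x)%:E) != 0)%E ->
  exists2 C1 : R, 0 < C1 &
    forall (eps : R) (T : \bar R) (u ut v vt : R -> 'rV[R]_n -> R),
      0 < eps <= 1 -> (0 < T)%E ->
      weak_solution p q T u ut v vt ->
      L1_eq (u 0) (fun x => eps * f x) -> L1_eq (ut 0) (fun x => eps * g x) ->
      L1_eq (v 0) (fun x => eps * ft x) -> L1_eq (vt 0) (fun x => eps * gt x) ->
      in_cone T u -> in_cone T v -> in_cone T ut -> in_cone T vt ->
      (T <= (C1 * eps `^ (- (p * (p * q - 1)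
                 / (p + 2 - ((n%:R - 1) / 2 * p - 1) * (p * q - 1)))))%:E)%E.
Proof.
case: n f g ft gt => [//|m] f g ft gt; rewrite ltnS => m0 q1 p1 _ subcrit f0 g0 ft0 gt0.
move=> /Rn_measurableP mf /Rn_measurableP mg /Rn_measurableP mft /Rn_measurableP mgt fg_neq0 _.
set gam := p + 2 - _; have gam0 : 0 < gam by rewrite subr_gt0.
have s0 : 0 < p * q - 1 by rewrite subr_gt0 (lt_trans p1)// ltr_pMr ?(lt_trans ltr01).
(* The integral of [f + g] may be infinite at this point; any finite positive lower bound serves. *)
have [I0 I0pos I0le] : exists2 I0 : R, 0 < I0 & (I0%:E <= iint (fun x => (f x + g x)%:E))%E.
  have : (0 < iint (fun x => (f x + g x)%:E))%E.
    have fg0 (x : borel_rV R m.+1) : (0 <= (f x + g x)%:E)%E by rewrite lee_fin addr_ge0.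
    rewrite lt0e fg_neq0 /= iintE//; first by apply: integral_ge0 => x _.
    by apply/measurable_EFinP; exact: measurable_funD.
  case: (iint _) => [r| |//]; first by rewrite lte_fin; exists r.
  by exists 1; rewrite ?leey.
have [K K0 HK] := concentration R m p m0 p1.
pose b := m%:R / 2 * (2 - p).
have V0 : 0 < 8 * volume_const R.
  by apply: mulr_gt0 => //; rewrite mulr_gt0 ?expR_gt0// sqrtr_gt0 pi_gt0.
have c0 : 0 < expR (- 2) * I0 / 4 by rewrite divr_gt0// mulr_gt0 ?expR_gt0.
have A0 : 0 < Num.min 1 (4 `^ b) :> R by rewrite lt_min ltr01 powR_gt0.
have [c5 c50 c5E] := collect_powers R m.+1 p q _ K _ _ b V0 K0 c0 A0.
have gamE : m.+1%:R * (1 - p * q) + (p + 2) + (b + 2) * (p * q - 1) = gam.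
  by rewrite /gam /b -natr1; field.
(* The smallest value meeting both demands of [blowup] on its ratio. *)
pose mu0 : R := Num.max 2 (2 `^ ((p + 2) / (p * q - 1))).
have mu02 : 2 <= mu0 by rewrite le_max lexx.
have mu0pq : 2 `^ (p + 2) <= mu0 `^ (p * q - 1).
  rewrite -[in leLHS](divfK (lt0r_neq0 s0) (p + 2)) powRrM.
  apply: ge0_ler_powR; [exact: ltW|exact: powR_ge0| |by rewrite le_max lexx orbT].
  exact: le_trans mu02.
(* The power makes [c5 * D ^ gam >= mu0]; the 1, together with [eps <= 1], ensures [tau >= 1]. *)
pose D := Num.max 1 ((mu0 / c5) `^ gam^-1).
have D1 : 1 <= D by rewrite le_max lexx.
have D0 : 0 < D by exact: lt_le_trans D1.
have Dgam : mu0 <= c5 * D `^ gam.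
  have r0 : 0 <= mu0 / c5 by rewrite divr_ge0 ?(ltW c50)// (le_trans _ mu02).
  rewrite mulrC -ler_pdivrMr// -[leLHS]powRr1// -(mulVf (lt0r_neq0 gam0)) powRrM.
  by apply: ge0_ler_powR; [exact: ltW|exact: powR_ge0|exact: ltW|rewrite le_max lexx orbT].
(* The 5 is that of [sg = 5 * tau] in [lifespan_bound_at]. *)
exists (5 * D); first by rewrite mulr_gt0.
move=> eps T u ut v vt /andP[eps0 eps1] T0 sol u_0 ut_0 v_0 vt_0 cu cv cut _.
set kap := p * (p * q - 1) / gam; rewrite leNgt; apply/negP => sgT.
have kap0 : 0 <= kap by rewrite divr_ge0 ?(ltW gam0)// mulr_ge0 ?(ltW s0)// (le_trans ler01)// ltW.
pose tau := D * eps `^ (- kap).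
have e1 : 1 <= eps `^ (- kap).
  rewrite powRN invf_ge1 ?powR_gt0// (_ : 1 = 1 `^ kap); last by rewrite powR1.
  by apply: ge0_ler_powR; rewrite ?nnegrE ?(ltW eps0).
have tau1 : 1 <= tau by rewrite /tau -[leLHS]mul1r ler_pM.
have tau0 : 0 < tau by exact: lt_le_trans tau1.
have sgE : 5 * D * eps `^ (- kap) = 5 * tau by rewrite mulrA.
have sg0 : 0 < 5 * D * eps `^ (- kap) by rewrite sgE mulr_gt0.
have := lifespan_bound_at R m p q p1 q1 f g ft gt I0 f0 g0 ft0 gt0 mf mg mft mgt I0pos I0le
  eps T u ut v vt eps0 T0 sol u_0 ut_0 v_0 vt_0 cu cv cut _ sg0 sgT K tau HK K0 tau1 sgE
  _ b mu0 erefl erefl mu02 mu0pq.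
(* Since [tau ^ gam = D ^ gam * eps ^ (- p (pq - 1))], the powers of [eps] cancel and the strict
   bound becomes [c5 * D ^ gam < mu0], against [Dgam]. *)
rewrite c5E// gamE ltNge => /negP; apply; apply: (le_trans Dgam).
rewrite /tau powRM ?powR_ge0 ?(ltW D0)// -powRrM mulNr /kap divfK ?lt0r_neq0// powRN.
by rewrite -mulrA [X in _ <= c5 * X]mulrCA divff ?mulr1// gt_eqF// powR_gt0.
Qed.
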